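(* Let $\sigma\colon\mathbb{R}^n\to\mathrm{Aut}(\mathcal{A})$ be a C*-dynamical system and let $\tau$ be a state on $\mathcal{A}$. Let $\Lambda_\beta$ be a $\beta$-prescribing set for $0<\beta=(\beta_1,\dots,\beta_n)\in\mathbb{R}^n$. Then $\tau$ is a $(\sigma,\Lambda_\beta)$-KMS state if and only if for all $\gamma\in C_\beta$ we have that $$\tau(a\,\sigma_{i\gamma}(b))=\begin{cases}\tau(ba)&\text{when }\gamma\in\Lambda_\beta,\\ \tau(ab)&\text{when }\gamma\notin\Lambda_\beta,\end{cases}$$ for all $a,b$ in a norm-dense $\sigma$-invariant $*$-subalgebra of $\mathcal{A}_{\mathrm{an}}$.
   Context: A C*-dynamical system $\sigma\colon\mathbb{R}^n\to\mathrm{Aut}(\mathcal{A})$ is a point-norm continuous action of $\mathbb{R}^n$ by $*$-automorphisms of a C*-algebra $\mathcal{A}$. $\mathcal{A}_{\mathrm{an}}$ is the norm-dense $\sigma$-invariant $*$-subalgebra of analytic elements, i.e. those $a\in\mathcal{A}$ for which $t\mapsto\sigma_t(a)$ ($t\in\mathbb{R}^n$) extends to an entire function $z\mapsto\sigma_z(a)$ on $\mathbb{C}^n$. The order $\le$ on $\mathbb{R}^n$ is the coordinatewise partial order (induced by $\mathbb{R}_+^n$), and $0<\beta$ means $0\le\beta$ and $\beta\neq0$; that is, $\beta_k\ge0$ for all $k$ and $\beta_k\ne0$ for at least one $k$. For such $\beta$ let $C_\beta=\{(\varepsilon_1\beta_1,\dots,\varepsilon_n\beta_n):\varepsilon_k\in\{0,1\}\}$.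 A $\beta$-prescribing set $\Lambda_\beta$ is a subset of $C_\beta$ with $0\notin\Lambda_\beta$. Let $D=\{z\in\mathbb{C}^n: 0\le\mathrm{Im}(z_k)\le\beta_k,\ k=1,\dots,n\}$. A state $\tau$ of $\mathcal{A}$ is a $(\sigma,\Lambda_\beta)$-KMS state if for every pair $a,b\in\mathcal{A}$ there is a complex-valued function $F_{a,b}$ that is analytic on the interior of $D$ and continuous and bounded on $D$, such that $F_{a,b}(t)=\tau(a\sigma_t(b))$ and $$F_{a,b}(t+i\gamma)=\begin{cases}\tau(\sigma_t(b)a)&\text{when }\gamma\in\Lambda_\beta,\\ \tau(a\sigma_t(b))&\text{when }\gamma\notin\Lambda_\beta,\end{cases}$$ for all $\gamma\in C_\beta$ and all $t\in\mathbb{R}^n$.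
   Formalization: When some β_k = 0, D has empty interior in C^n and the claim fails as written; here the interior of D is taken inside {Im z_k = 0 whenever β_k = 0}, and F is required to be analytic there in the variables z_k with β_k ≠ 0. *)

(* Defs.v *)
From HB Require Import structures.
From mathcomp Require Import all_boot all_order all_algebra.
From mathcomp Require Import complex.
From mathcomp Require Import lra.
From mathcomp Require Import all_classical all_reals all_analysis.

Set Implicit Arguments.
Unset Strict Implicit.
Unset Printing Implicit Defensive.

Import Order.TTheory GRing.Theory Num.Theory.
Import numFieldNormedType.Exports.

Local Open Scope classical_set_scope.
Local Open Scope complex_scope.
Local Open Scope ring_scope.

(* C*-algebras, not necessarily unital (so not a [GRing.PzRing]).  The norm of
   a normed R[i]-module takes its values in R[i], in the nonnegative reals. *)
HB.mixin Record isCStarAlgebra (R : realType) A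
    of CompleteNormedModule R[i] A := {
  cmul : A -> A -> A ;
  cstar : A -> A ;
  cmulA : associative cmul ;
  cmulDl : left_distributive cmul +%R ;
  cmulDr : right_distributive cmul +%R ;
  cscaleAl : forall (k : R[i]) (x y : A), k *: cmul x y = cmul (k *: x) y ;
  cscaleAr : forall (k : R[i]) (x y : A), k *: cmul x y = cmul x (k *: y) ;
  cstarK : involutive cstar ;
  cstarD : {morph cstar : x y / x + y} ;
  cstarZ : forall (k : R[i]) (x : A), cstar (k *: x) = conjc k *: cstar x ;
  cstarM : forall x y : A, cstar (cmul x y) = cmul (cstar y) (cstar x) ;
  cnormM : forall x y : A, `|cmul x y| <= `|x| * `|y| ;
  cnorm_cstar : forall x : A, `|cmul (cstar x) x| = `|x| ^+ 2
}.

#[short(type="cstarAlgType")]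
HB.structure Definition CStarAlgebra (R : realType) :=
  {A of isCStarAlgebra R A & CompleteNormedModule R[i] A}.

Declare Scope cstar_scope.
Infix "**" := cmul (at level 40, left associativity) : cstar_scope.
Local Open Scope cstar_scope.

(* [R[i]] seen through the generic [numFieldType] instances, which is what
   equips it (and the row vectors over it) with a norm and a topology. *)
Notation CC R := (Num.NumField.sort (complex R)) (only parsing).

Section CStarDynamics.
Variables (R : realType) (A : cstarAlgType R) (n : nat).
Implicit Types (sigma : 'rV[R]_n -> A -> A) (tau : {scalar A}) (B : set A).
Implicit Types (beta gamma t : 'rV[R]_n) (z w : 'rV[CC R]_n).

Definition functional_norm tau : R :=
  sup [set complex.Re `|tau a| | a in [set a : A | `|a| <= 1]].

(* [sup] is 0 on unbounded sets, so the norm condition entails boundedness. *)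
Definition is_state tau : Prop :=
  (forall a : A, 0 <= tau (cstar a ** a)) /\ functional_norm tau = 1.

Definition star_automorphism (f : A -> A) : Prop :=
  [/\ linear f, {morph f : a b / a ** b}, {morph f : a / cstar a}
    & bijective f].

Definition cstar_dynamical_system sigma : Prop :=
  [/\ forall t, star_automorphism (sigma t),
      forall a, sigma 0 a = a,
      forall s t a, sigma (s + t) a = sigma s (sigma t a)
    & forall a, continuous (fun t => sigma t a)].

(* The point x + i y of C^n. *)
Definition cvec (x y : 'rV[R]_n) : 'rV[CC R]_n := \row_k (x 0 k +i* y 0 k).

Definition entire (f : 'rV[CC R]_n -> A) : Prop :=
  forall z, differentiable f z.

Definition analytic_extension sigma (a : A) (f : 'rV[CC R]_n -> A) : Prop :=
  entire f /\ forall t, f (cvec t 0) = sigma t a.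

Definition analytic_elements sigma : set A :=
  [set a | exists f, analytic_extension sigma a f].

(* sigma_z(a); meaningful for [a] in [analytic_elements sigma], where the
   extension is unique by the identity theorem. *)
Definition sigma_ext sigma z (a : A) : A :=
  xget (fun=> 0) [set f | analytic_extension sigma a f] z.

Definition star_subalgebra B : Prop :=
  [/\ B 0,
      forall (k : R[i]) a b, B a -> B b -> B (k *: a + b),
      forall a b, B a -> B b -> B (a ** b)
    & forall a, B a -> B (cstar a)].

Definition action_invariant sigma B : Prop :=
  forall t a, B a -> B (sigma t a).

Definition vec_pos beta : Prop := (forall k, 0 <= beta 0 k) /\ beta != 0.

Definition corners beta : set 'rV[R]_n :=
  [set gamma | exists e : 'I_n -> bool,
     forall k, gamma 0 k = if e k then beta 0 k else 0].

Definition prescribing_set beta (Lambda : set 'rV[R]_n) : Prop :=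
  Lambda `<=` corners beta /\ ~ Lambda 0.

Definition polystrip beta : set 'rV[CC R]_n :=
  [set z | forall k, 0 <= complex.Im (z 0 k) <= beta 0 k].

(* When some beta_k vanishes, the polystrip has empty interior in C^n; its
   interior is then taken in the real subspace { Im z_k = 0 if beta_k = 0 }
   containing it, and analyticity is in the variables z_k with beta_k != 0.
   If all beta_k are positive, these are the interior in C^n and analyticity
   in all variables: see [polystrip_interiorE] and [free_partE]. *)
Definition polystrip_interior beta : set 'rV[CC R]_n :=
  [set z | forall k, if beta 0 k == 0 then complex.Im (z 0 k) = 0
                     else 0 < complex.Im (z 0 k) < beta 0 k].

Definition free_part beta w : 'rV[CC R]_n :=
  \row_k (if beta 0 k == 0 then 0 else w 0 k).

Definition analytic_on_polystrip_interior beta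
    (F : 'rV[CC R]_n -> (CC R)^o) : Prop :=
  forall z, polystrip_interior beta z ->
    differentiable (fun w => F (z + free_part beta w)) (0 : 'rV[CC R]_n).

Definition KMS_state sigma beta (Lambda : set 'rV[R]_n) tau : Prop :=
  forall a b : A, exists F : 'rV[CC R]_n -> (CC R)^o,
    [/\ analytic_on_polystrip_interior beta F,
        {within polystrip beta, continuous F},
        exists M : R, forall z, polystrip beta z -> `|F z| <= M%:C,
        forall t, F (cvec t 0) = tau (a ** sigma t b)
      & forall gamma t, corners beta gamma ->
          F (cvec t gamma) = if gamma \in Lambda then tau (sigma t b ** a)
                             else tau (a ** sigma t b)].

Lemma free_partE beta w : (forall k, 0 < beta 0 k) -> free_part beta w = w.
Proof. by move=> b0; apply/rowP => k; rewrite mxE gt_eqF. Qed.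

Lemma normC_Im (x : CC R) : (`|complex.Im x|)%:C <= `|x| :> R[i].
Proof.
case: x => a b; rewrite normc_def /= lecR -sqrtr_sqr.
by rewrite ler_wsqrtr // lerDr sqr_ge0.
Qed.

Lemma polystrip_interiorE beta : (forall k, 0 < beta 0 k) ->
  polystrip_interior beta = (polystrip beta)°.
Proof.
move=> b0; apply/seteqP; split => z.
- move=> zI; rewrite /interior /polystrip /=.
  suff H k : nbhs z [set w : 'rV[CC R]_n | 0 <= complex.Im (w 0 k) <= beta 0 k].
    exact: filter_forall H.
  have := zI k; rewrite gt_eqF ?b0// => /andP[z0 zb].
  pose e := Num.min (complex.Im (z 0 k)) (beta 0 k - complex.Im (z 0 k)).
  have e0 : (0 : CC R) < e%:C by rewrite ltcR lt_min z0 subr_gt0.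
  apply/nbhs_ballP; exists e%:C => //= w [_ /(_ 0 k) zw].
  have : (`|complex.Im (z 0 k - w 0 k)|)%:C < e%:C :> R[i].
    by apply: le_lt_trans (normC_Im _) zw.
  rewrite ltcR lt_min raddfB /= !ltr_norml => /andP[/andP[h1 h2] /andP[h3 h4]].
  by apply/andP; split; lra.
- rewrite /interior => /nbhs_ballP[e /= e0 zD] k; rewrite gt_eqF ?b0//.
  have eR : e = (complex.Re e)%:C by rewrite RRe_real// gtr0_real.
  set d := complex.Re e in eR; have d0 : 0 < d by move: e0; rewrite eR ltcR.
  have h (c : R) : `|c| < d -> 0 <= complex.Im (z 0 k) + c <= beta 0 k.
    move=> cd; have := zD (z + \row__ (0 +i* c)) => /(_ _ k).
    rewrite !mxE raddfD /=; apply; split=> // i j; rewrite /ball/= !mxE opprD addNKr.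
    rewrite normrN normc_def /= expr0n add0r sqrtr_sqr eR.
    by rewrite [X in X < _]/= ltcR.
  have := h (d / 2); have := h (- (d / 2)).
  rewrite normrN gtr0_norm ?divr_gt0//.
  have dd : d / 2 < d by lra.
  by move=> /(_ dd)/andP[? _] /(_ dd)/andP[_ ?]; apply/andP; split; lra.
Qed.

End CStarDynamics.

(* Main.v *)
(* A state is contractive and every *-automorphism is isometric: for a
   self-adjoint h of norm < 1 there is k commuting with h such that
   h^2 + (1 - k)^2 = 1, so that the image of h + i (1 - k) is unitary.

   If tau satisfies the boundary identities on B, then for a, b in B the entire
   function z |-> tau (a sigma_z b) is bounded by |a| |b| on the sets
   R^n + i gamma, hence on the polystrip by Phragmen-Lindelof applied to one
   coordinate at a time; for general a and b one takes uniform limits.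
   Conversely, a KMS function F_{a,b} and z |-> tau (a sigma_z b), for b
   analytic, agree on R^n, hence on every slice t + w gamma' with gamma' close
   to the corner gamma and positive in the directions where beta is, hence at
   i gamma by continuity.  The analytic elements are dense because mollifying
   an orbit by a Gaussian in each coordinate makes it entire.

   No contour integral is needed: the dyadic Riemann sums of a complex
   differentiable, vector-valued f over a rectangle tend to 0 by bisection
   (they vanish exactly for affine f).  Applied to
   f(p + exp w), this shows that the means of f over the 2^m-th roots of unity
   around p tend to f p, which gives the maximum principle; divided differences
   then give Schwarz-type estimates, and these yield the differentiability of
   bounded pointwise limits in several variables. *)

Require Import Defs.
From HB Require Import structures.
From mathcomp Require Import all_boot all_order all_algebra.
From mathcomp Require Import complex.
From mathcomp Require Import ring lra.
From mathcomp Require Import all_classical all_reals all_analysis.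

Import Order.TTheory GRing.Theory Num.Theory.
Import numFieldNormedType.Exports.

Local Open Scope classical_set_scope.
Local Open Scope complex_scope.
Local Open Scope ring_scope.
Set Implicit Arguments.
Unset Strict Implicit.
Unset Printing Implicit Defensive.

Local Notation Re := complex.Re.
Local Notation Im := complex.Im.
Local Open Scope cstar_scope.

(** * Real-valued norm and complex differentiability *)

(** Norms take values in [R[i]], whose order is partial; estimates are therefore made on their real
    part [nm], where [lra] and [nra] apply. One direction must overcome that sigma_z is unbounded
    for non-real z: approximating b in norm says nothing about sigma_z b. Only the scalar tau (a
    sigma_z b) passes to the limit, because its bound |a| |b| does not involve the norm of sigma_z
    b. In the other direction, a KMS function is merely continuous on the boundary of the polystrip,
    and the slice through a corner gamma stays in that boundary as soon as some gamma_k is 0 while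
    beta_k is not; hence the detour by gamma'. The maximum principle allows isolated points of mere
    continuity, because nothing better is known of a divided difference at its base point. The
    Gaussian integrals are limits of dyadic sums as well. These are compatible only with dyadic
    translations, so covariance under the flow is proved for those and extended by continuity.
    Treating one coordinate at a time leaves only integrals over the line. *)

Definition nm (R : realType) (V : normedZmodType R[i]) (v : V) : R := Re `|v|.

Section RealNorm.
Variable R : realType.
Implicit Types (V : normedZmodType R[i]) (W : normedModType R[i]).

Lemma nmE V (v : V) : (nm v)%:C = `|v|.
Proof. by rewrite /nm RRe_real// normr_real. Qed.

Lemma nm_ge0 V (v : V) : 0 <= nm v.
Proof. by rewrite -lecR nmE normr_ge0. Qed.

Lemma nm0 V : nm (0 : V) = 0.
Proof. by rewrite /nm normr0. Qed.

Lemma nmN V (v : V) : nm (- v) = nm v.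
Proof. by rewrite /nm normrN. Qed.

Lemma nmB V (v w : V) : nm (v - w) = nm (w - v).
Proof. by rewrite /nm distrC. Qed.

Lemma nm_triangle V (v w : V) : nm (v + w) <= nm v + nm w.
Proof. by rewrite -lecR raddfD /= !nmE ler_normD. Qed.

Lemma nm_triangleB V (v w : V) : nm (v - w) <= nm v + nm w.
Proof. by rewrite -(nmN w) nm_triangle. Qed.

Lemma nm_dist V (u v w : V) : nm (v - w) <= nm (v - u) + nm (u - w).
Proof. by rewrite -[v - w](subrKA u) nm_triangle. Qed.

Lemma nm_split V (v w : V) : nm v <= nm w + nm (v - w).
Proof. by rewrite addrC -{1}(subrK w v) nm_triangle. Qed.

Lemma nm_eq0 V (v : V) : nm v = 0 -> v = 0.
Proof.
move=> h; have : (nm v)%:C = 0 by rewrite h.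
by rewrite nmE => /normr0_eq0.
Qed.

Lemma nm_gt0 V (v : V) : v != 0 -> 0 < nm v.
Proof.
by move=> v0; rewrite lt_neqAle nm_ge0 andbT eq_sym; apply: contra_neq v0 => /nm_eq0.
Qed.

Lemma nmZ W (k : R[i]) (v : W) : nm (k *: v) = nm k * nm v.
Proof. by apply: complexI; rewrite rmorphM /= !nmE normrZ. Qed.

Lemma nmM (z w : R[i]) : nm (z * w) = nm z * nm w.
Proof. by apply: complexI; rewrite rmorphM /= !nmE normrM. Qed.

Lemma nmV (z : R[i]) : nm z^-1 = (nm z)^-1.
Proof. by apply: complexI; rewrite fmorphV /= !nmE normfV. Qed.

Lemma nmR (x : R) : nm (x%:C) = `|x|.
Proof. by rewrite /nm normc_def /= expr0n addr0 sqrtr_sqr. Qed.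

Lemma nmiR (x : R) : nm (0 +i* x : R[i]) = `|x|.
Proof. by rewrite /nm normc_def /= expr0n add0r sqrtr_sqr. Qed.

Lemma nm1 : nm (1 : R[i]) = 1.
Proof. by rewrite nmR normr1. Qed.

Lemma nm_sqr (z : R[i]) : nm z ^+ 2 = Re z ^+ 2 + Im z ^+ 2.
Proof.
by rewrite /nm normc_def /= sqr_sqrtr// addr_ge0 ?sqr_ge0.
Qed.

Lemma Re_le_nm (z : R[i]) : `|Re z| <= nm z.
Proof. by rewrite -lecR nmE normc_ge_Re. Qed.

Lemma Im_le_nm (z : R[i]) : `|Im z| <= nm z.
Proof. by rewrite -lecR nmE normC_Im. Qed.

Lemma nm_le_ReIm (z : R[i]) : nm z <= `|Re z| + `|Im z|.
Proof.
case: z => x y.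
have -> : x +i* y = x%:C + (0 +i* y) :> R[i].
  by apply/eqP; rewrite eq_complex /= addr0 add0r !eqxx.
by apply: le_trans (nm_triangle _ _) _; rewrite nmR nmiR /= addr0 add0r.
Qed.

End RealNorm.

Lemma addr_diff3 (V : zmodType) (a b c d x y : V) :
  a + b - (c + d) - (x + y) = (a - c - x) + (b - d - y).
Proof. by rewrite !opprD (addrACA a b) [LHS]addrACA. Qed.

Lemma addr_telescope3 (V : zmodType) (x y z u v t : V) :
  (x - y - z) + (y - u - v) + (z - t) = x - u - (v + t).
Proof.
rewrite opprD !addrA.
by rewrite [LHS](ACl (1*5*6*8*(2*4)*(3*7)))/= !addNr !addr0.
Qed.

Section ComplexDiff.
Variables (R : realType) (V : normedModType R[i]).
Implicit Types (f g : R[i] -> V) (p w : R[i]).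

(** The difference quotient is cleared of its denominator, so that [w = p] needs no exclusion and
    error terms combine by linear arithmetic on [nm]. *)
Definition has_cderiv f p (L : V) := forall e : R, 0 < e ->
  exists2 d : R, 0 < d &
  forall w, nm (w - p) < d -> nm (f w - f p - (w - p) *: L) <= e * nm (w - p).

Definition cdiff f p := exists L, has_cderiv f p L.

Definition ccont (S : set R[i]) f p := forall e : R, 0 < e ->
  exists2 d : R, 0 < d & forall w, S w -> nm (w - p) < d -> nm (f w - f p) <= e.

Lemma ccontS (S T : set R[i]) f p : S `<=` T -> ccont T f p -> ccont S f p.
Proof.
by move=> ST h e /h[d d0 hd]; exists d => // w /ST; exact: hd.
Qed.

Lemma cdiff_cont f p : cdiff f p -> ccont setT f p.
Proof.
move=> [L hL] e e0; have [d d0 hd] := hL 1 ltr01.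
have c0 : 0 < 1 + nm L by rewrite ltr_pwDl ?nm_ge0.
exists (Num.min d (e / (1 + nm L))); first by rewrite lt_min d0 divr_gt0.
move=> w _; rewrite lt_min => /andP[/hd h1]; rewrite ltr_pdivlMr// => h2.
have := nm_split (f w - f p) ((w - p) *: L); rewrite nmZ.
have := nm_ge0 (w - p); nra.
Qed.

Lemma has_cderiv_eq f g p L r : 0 < r -> (forall w, nm (w - p) < r -> f w = g w) ->
  has_cderiv f p L -> has_cderiv g p L.
Proof.
move=> r0 fg h e /h[d d0 hd]; exists (Num.min r d); first by rewrite lt_min r0.
move=> w; rewrite lt_min => /andP[h1 h2].
by rewrite -!fg ?subrr ?nm0//; exact: hd.
Qed.

Lemma cdiff_eq f g p r : 0 < r -> (forall w, nm (w - p) < r -> f w = g w) ->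
  cdiff f p -> cdiff g p.
Proof. by move=> r0 fg [L h]; exists L; apply: has_cderiv_eq fg h. Qed.

Lemma has_cderiv_cst v p : has_cderiv (fun=> v) p 0.
Proof.
move=> e e0; exists 1 => // w _.
by rewrite subrr scaler0 subrr nm0 mulr_ge0 ?nm_ge0// ltW.
Qed.

Lemma has_cderivD f g p L M : has_cderiv f p L -> has_cderiv g p M ->
  has_cderiv (fun w => f w + g w) p (L + M).
Proof.
move=> hf hg e e0; have e2 : 0 < e / 2 by rewrite divr_gt0.
have [d1 d10 h1] := hf _ e2; have [d2 d20 h2] := hg _ e2.
exists (Num.min d1 d2); first by rewrite lt_min d10.
move=> w; rewrite lt_min => /andP[/h1{}h1 /h2{}h2].
have -> : f w + g w - (f p + g p) - (w - p) *: (L + M) =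
  (f w - f p - (w - p) *: L) + (g w - g p - (w - p) *: M).
  by rewrite scalerDr addr_diff3.
apply: le_trans (nm_triangle _ _) _; lra.
Qed.


Lemma has_cderivZ (phi : R[i] -> R[i]^o) f p l L :
  (forall e : R, 0 < e -> exists2 d : R, 0 < d &
    forall w, nm (w - p) < d -> nm (phi w - phi p - (w - p) * l) <= e * nm (w - p)) ->
  has_cderiv f p L ->
  has_cderiv (fun w => phi w *: f w) p (phi p *: L + l *: f p).
Proof.
move=> hphi hf e e0.
have cf := cdiff_cont (ex_intro _ L hf).
pose K := 1 + nm (phi p) + nm l + nm (f p).
have K0 : 0 < K.
  by have := nm_ge0 (phi p); have := nm_ge0 l; have := nm_ge0 (f p); rewrite /K; lra.
(* Each of the three error terms below is at most [e1 * nm (w - p)] times a factor bounded by [K];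
   [e1 <= 1] serves to bound [nm (f w)] by [1 + nm (f p)]. *)
pose e1 := Num.min 1 (e / (4 * K)).
have e10 : 0 < e1 by rewrite lt_min ltr01 divr_gt0// mulr_gt0.
have [d1 d10 h1] := hphi _ e10; have [d2 d20 h2] := hf _ e10.
have [d3 d30 h3] := cf _ e10.
exists (Num.min d1 (Num.min d2 d3)); first by rewrite !lt_min d10 d20.
move=> w; rewrite !lt_min => /andP[/h1{}h1 /andP[/h2{}h2 /(h3 _ I){}h3]].
have -> : phi w *: f w - phi p *: f p - (w - p) *: (phi p *: L + l *: f p) =
  (phi w - phi p - (w - p) * l) *: f w + phi p *: (f w - f p - (w - p) *: L)
  + ((w - p) * l) *: (f w - f p).
  rewrite scalerDr; move: (w - p) => u.
  by rewrite !scalerBl !scalerBr !scalerA [phi p * u]mulrC addr_telescope3.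
apply: le_trans (nm_triangle _ _) _; rewrite nmZ nmM.
have := nm_triangle ((phi w - phi p - (w - p) * l) *: f w) (phi p *: (f w - f p - (w - p) *: L)).
rewrite !nmZ => h4.
have h5 := nm_split (f w) (f p).
have e11 : e1 <= 1 by rewrite ge_min lexx.
have e1K : 4 * (K * e1) <= e.
  by rewrite mulrA -ler_pdivlMl ?mulr_gt0// mulrC ge_min lexx orbT.
move: h1 h2 h3 h4 h5 e11 e1K (nm_ge0 (phi p)) (nm_ge0 l) (nm_ge0 (f p)).
move: (nm_ge0 (w - p)) (nm_ge0 (f w)) (nm_ge0 (f w - f p)); rewrite /K.
set x1 := nm (phi w - _ - _); set x2 := nm (f w - _ - _); set x3 := nm (f w - _).
set x4 := nm (_ + _); set P := nm (phi p); set F := nm (f p); set l' := nm l.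
set G := nm (f w); set t := nm (w - p) => t0 G0 x30 h1 h2 h3 h4 h5 e11 e1K P0 l0 F0.
have G1 : G <= 1 + F by lra.
have hA : x1 * G <= e1 * t * (1 + F).
  by apply: ler_pM => //; exact: nm_ge0.
have hB : P * x2 <= P * (e1 * t) by rewrite ler_wpM2l.
have hC : t * l' * x3 <= t * l' * e1 by rewrite ler_wpM2l ?mulr_ge0.
have : t * (4 * ((1 + P + l' + F) * e1)) <= t * e by rewrite ler_wpM2l.
have h6 : 0 <= t * ((1 + P + l' + F) * e1).
  by rewrite !mulr_ge0 ?addr_ge0 // ltW.
nra.
Qed.

End ComplexDiff.

(** * Complex exponential *)

Section CExp.
Variable R : realType.
Implicit Types (V : normedModType R[i]).

Lemma cdiffZ V (phi : R[i] -> R[i]^o) (f : R[i] -> V) p :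
  cdiff phi p -> cdiff f p -> cdiff (fun w => phi w *: f w) p.
Proof.
by move=> [l hl] [L hL]; exists (phi p *: L + l *: f p); exact: has_cderivZ.
Qed.

Lemma cdiffM (phi psi : R[i] -> R[i]) p :
  cdiff (phi : _ -> R[i]^o) p -> cdiff (psi : _ -> R[i]^o) p ->
  cdiff (fun w => phi w * psi w : R[i]^o) p.
Proof. exact: cdiffZ. Qed.

Lemma cdiffD V (f g : R[i] -> V) p :
  cdiff f p -> cdiff g p -> cdiff (fun w => f w + g w) p.
Proof. by move=> [L hL] [M hM]; exists (L + M); exact: has_cderivD. Qed.

Lemma cdiff_cst V (v : V) p : cdiff (fun=> v) p.
Proof. by exists 0; exact: has_cderiv_cst. Qed.

Lemma cdiffZl V (k : R[i]) (f : R[i] -> V) p :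
  cdiff f p -> cdiff (fun w => k *: f w) p.
Proof. by move=> hf; apply: cdiffZ => //; exact: cdiff_cst. Qed.

Lemma cdiffB V (f g : R[i] -> V) p :
  cdiff f p -> cdiff g p -> cdiff (fun w => f w - g w) p.
Proof.
move=> hf hg; apply: (@cdiff_eq _ _ (fun w => f w + (-1) *: g w) _ _ 1) => //.
  by move=> w _; rewrite scaleN1r.
by apply: cdiffD => //; exact: cdiffZl.
Qed.

Lemma cdiff_id p : cdiff (id : R[i] -> R[i]^o) p.
Proof.
exists 1 => e e0; exists 1 => // w _.
have -> : w - p - (w - p) *: (1 : R[i]^o) = 0 by rewrite /GRing.scale /= mulr1 subrr.
by rewrite nm0 mulr_ge0 ?nm_ge0// ltW.
Qed.

Lemma cdiff_affine (a b p : R[i]) : cdiff (fun w => b + w * a : R[i]^o) p.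
Proof.
apply: cdiffD; first exact: cdiff_cst.
by apply: cdiffM; [exact: cdiff_id|exact: cdiff_cst].
Qed.

Lemma cdiff_comp V (g : R[i] -> R[i]^o) (f : R[i] -> V) p :
  cdiff g p -> cdiff f (g p) -> cdiff (fun w => f (g w)) p.
Proof.
move=> [l hl] [L hL]; exists (l *: L) => e e0.
have cg := cdiff_cont (ex_intro _ l hl).
have K0 : 0 < 2 * (1 + nm l + nm L).
  by have := nm_ge0 l; have := nm_ge0 L; lra.
pose e1 := Num.min 1 (e / (2 * (1 + nm l + nm L))).
have e10 : 0 < e1 by rewrite lt_min ltr01 divr_gt0.
have [d1 d10 h1] := hL _ e10.
have [d2 d20 h2] := hl _ e10.
have d12 : 0 < d1 / 2 by rewrite divr_gt0.
have [d3 d30 h3] := cg _ d12.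
exists (Num.min d2 d3); first by rewrite lt_min d20.
move=> w; rewrite lt_min => /andP[/h2{}h2 /(h3 _ I){}h3].
have h4 : nm (g w - g p) < d1 by apply: le_lt_trans h3 _; lra.
have {}h1 := h1 _ h4.
have -> : f (g w) - f (g p) - (w - p) *: (l *: L) =
  (f (g w) - f (g p) - (g w - g p) *: L) + ((g w - g p) - (w - p) * l) *: L.
  by rewrite scalerA; move: (g w - g p) => u; rewrite [in RHS]scalerBl addrA subrK.
apply: le_trans (nm_triangle _ _) _; rewrite nmZ.
have h5 := nm_split (g w - g p) ((w - p) * l); rewrite nmM in h5.
have e11 : e1 <= 1 by rewrite ge_min lexx.
have e1K : 2 * (1 + nm l + nm L) * e1 <= e.
  by rewrite -ler_pdivlMl// mulrC ge_min lexx orbT.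
have -> : nm (w - p) = nm (w - p : R[i]^o) by [].
move: h1 h2 h5 e11 e1K (nm_ge0 l) (nm_ge0 L) (nm_ge0 (w - p)) (ltW e10).
rewrite -[(w - p) *: (l : R[i]^o)]/((w - p) * l).
set x1 := nm (f _ - _ - _); set x2 := nm (g w - _ - _); set x3 := nm (g w - _).
set l' := nm l; set L' := nm L; set t := nm (w - p).
move=> h1 h2 h5 e11 e1K l0 L0 t0 e1_0.
have hA : e1 * x3 <= e1 * (t * l' + e1 * t) by rewrite ler_wpM2l//; lra.
have hB : x2 * L' <= e1 * t * L' by rewrite ler_wpM2r.
have hC : 2 * (1 + l' + L') * e1 * t <= e * t by rewrite ler_wpM2r.
have hD : e1 * (e1 * t) <= e1 * t by rewrite ler_piMl// mulr_ge0.
have hE : 0 <= e1 * t * l' by rewrite !mulr_ge0.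
have hF : 0 <= e1 * t * L' by rewrite !mulr_ge0.
have hG : 0 <= e1 * t by rewrite mulr_ge0.
nra.
Qed.

Definition cexp (z : R[i]) : R[i] :=
  (expR (Re z) * cos (Im z)) +i* (expR (Re z) * sin (Im z)).

Lemma cexpD z w : cexp (z + w) = cexp z * cexp w.
Proof.
case: z w => [x y] [x' y']; apply/eqP; rewrite eq_complex /= expRD cosD sinD.
by apply/andP; split; apply/eqP; ring.
Qed.

Lemma cexp0 : cexp 0 = 1.
Proof.
apply/eqP; rewrite eq_complex /=.
by rewrite expR0 cos0 sin0 mulr1 mulr0 !eqxx.
Qed.

Lemma nm_cexp z : nm (cexp z) = expR (Re z).
Proof.
rewrite /nm normc_def /= !exprMn -mulrDr cos2Dsin2 mulr1 sqrtr_sqr.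
by rewrite ger0_norm// expR_ge0.
Qed.

Lemma cexp_neq0 z : cexp z != 0.
Proof.
by apply/eqP => h; have := nm_cexp z; rewrite h nm0 => /esym/eqP; rewrite gt_eqF ?expR_gt0.
Qed.

Lemma cexp2pi z : cexp (z + (0 +i* (2 * pi))) = cexp z.
Proof.
rewrite cexpD; have -> : cexp (0 +i* (2 * pi)) = 1; last by rewrite mulr1.
apply/eqP; rewrite eq_complex /= expR0 !mul1r mulr_natl cos2pi sin2pi.
by rewrite !eqxx.
Qed.

(** Brings the real derivatives of [expR], [cos] and [sin] into the quotient-free form of
    [has_cderiv]. *)
Lemma is_derive1_eps (f : R -> R) (x df : R) : is_derive x 1 f df ->
  forall e : R, 0 < e ->
  exists2 d : R, 0 < d & forall h, `|h| < d -> `|f (x + h) - f x - h * df| <= e * `|h|.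
Proof.
move=> [dd dv] e e0.
have : h^-1 *: ((f \o shift x) (h *: (1 : R)) - f x) @[h --> 0^'] --> df.
  by rewrite -dv; exact: dd.
move=> /cvgrPdist_le /(_ e e0); rewrite near_withinE => /nbhs_ballP[d /= d0 hd].
exists d => // h hh; have [->|h0] := eqVneq h 0.
  by rewrite addr0 subrr mul0r subrr normr0 mulr0.
have := hd h; rewrite /ball /= sub0r normrN => /(_ hh h0).
rewrite -[h *: 1]/(h * 1) mulr1 -[_ *: _]/(_ * _) => {}hd.
have -> : f (x + h) - f x - h * df = - (h * (df - h^-1 * (f (h + x) - f x))).
  by rewrite mulrBr mulVKf// opprB (addrC h x).
by rewrite normrN normrM mulrC ler_wpM2r.
Qed.

Lemma has_cderiv_cexp0 : has_cderiv (cexp : _ -> R[i]^o) 0 1.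
Proof.
move=> e e0.
pose e1 := Num.min 1 (e / 8).
have e10 : 0 < e1 by rewrite lt_min ltr01 divr_gt0.
have e11 : e1 <= 1 by rewrite ge_min lexx.
have e1e : 8 * e1 <= e by rewrite -ler_pdivlMl// mulrC ge_min lexx orbT.
have [d1 d10 h1] := is_derive1_eps (is_derive_expR 0) e10.
have [d2 d20 h2] := is_derive1_eps (is_derive_cos 0) e10.
have [d3 d30 h3] := is_derive1_eps (is_derive_sin 0) e10.
exists (Num.min (e1 / 2) (Num.min d1 (Num.min d2 d3))).
  by rewrite !lt_min d10 d20 d30 divr_gt0.
case=> x y; rewrite subr0 cexp0 -[_ *: _]/(_ * (1 : R[i])) mulr1.
rewrite !lt_min => /and4P[h0 hd1 hd2 hd3].
have hx := Re_le_nm (x +i* y); have hy := Im_le_nm (x +i* y); rewrite /= in hx hy.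
have := h1 x (le_lt_trans hx hd1); have := h2 y (le_lt_trans hy hd2).
have := h3 y (le_lt_trans hy hd3).
rewrite !add0r expR0 cos0 sin0 oppr0 mulr0 !subr0 ?addr0 !mulr1 => {h1 h2 h3 hd1 hd2 hd3}.
move=> hs hc hexp.
apply: le_trans (nm_le_ReIm _) _; rewrite /= subr0.
(* Both parts are split so that every summand contains the first-order error of [expR], [cos] or
   [sin], or else is a product of two small quantities. *)
have -> : expR x * cos y - 1 - x = (expR x - 1 - x) * cos y + (1 + x) * (cos y - 1) by ring.
have -> : expR x * sin y - y = expR x * (sin y - y) + (expR x - 1 - x + x) * y by ring.
set t := nm _ in h0 hx hy *; have t0 : 0 <= t by exact: nm_ge0.
have cy : `|cos y| <= 1 by rewrite ler_norml cos_geN1 cos_le1.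
have ht1 : t <= 1 by lra.
have ex : `|expR x - 1 - x| <= e1 * t by apply: le_trans hexp _; rewrite ler_wpM2l// ltW.
have cy1 : `|cos y - 1| <= e1 * t by apply: le_trans hc _; rewrite ler_wpM2l// ltW.
have sy1 : `|sin y - y| <= e1 * t by apply: le_trans hs _; rewrite ler_wpM2l// ltW.
have e1t : e1 * t <= 1 / 2 by nra.
have A1 : `|(expR x - 1 - x) * cos y| <= e1 * t.
  by rewrite normrM -[leRHS]mulr1 ler_pM.
have A2 : `|(1 + x) * (cos y - 1)| <= 2 * (e1 * t).
  rewrite normrM ler_pM//; apply: le_trans (ler_normD _ _) _.
  by rewrite normr1; lra.
have A3 : `|expR x * (sin y - y)| <= 5 / 2 * (e1 * t).
  rewrite normrM ler_pM// ger0_norm ?expR_ge0//.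
  by move: ex hx; rewrite !ler_norml => /andP[_ h] /andP[_ h']; lra.
have A4 : `|(expR x - 1 - x + x) * y| <= e1 * t / 2 + t * (e1 / 2).
  rewrite normrM.
  have := ler_normD (expR x - 1 - x) x => h4.
  have h5 : `|expR x - 1 - x + x| <= e1 * t + t by lra.
  have h6 : `|y| <= e1 / 2 by lra.
  have h7 := ler_pM (normr_ge0 _) (normr_ge0 _) h5 h6.
  have h8 : e1 * t * e1 <= e1 * t by rewrite ler_piMr// mulr_ge0// ltW.
  by apply: le_trans h7 _; lra.
have := ler_normD ((expR x - 1 - x) * cos y) ((1 + x) * (cos y - 1)).
have := ler_normD (expR x * (sin y - y)) ((expR x - 1 - x + x) * y).
have : 8 * e1 * t <= e * t by rewrite ler_wpM2r.
have : 0 <= e1 * t by rewrite mulr_ge0 // ltW.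
lra.
Qed.

Lemma cdiff_cexp p : cdiff (cexp : _ -> R[i]^o) p.
Proof.
exists (cexp p) => e e0.
have c0 : 0 < nm (cexp p) by apply: nm_gt0; exact: cexp_neq0.
have [d d0 hd] := has_cderiv_cexp0 (divr_gt0 e0 c0).
exists d => // w hw; have := hd (w - p); rewrite subr0 => /(_ hw).
rewrite cexp0 -[_ *: _]/(_ * (1 : R[i])) mulr1.
have -> : cexp w - cexp p - (w - p) *: cexp p =
    cexp p * (cexp (w - p) - 1 - (w - p)).
  rewrite -[_ *: _]/(_ * cexp p) -{1}(subrK p w) (cexpD (w - p)).
  by move: (cexp (w - p)) (cexp p) (w - p) => a b u; ring.
by rewrite nmM mulrAC ler_pdivlMr// mulrC.
Qed.

Lemma cdiff_cexp_comp (g : R[i] -> R[i]^o) p :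
  cdiff g p -> cdiff (fun w => cexp (g w) : R[i]^o) p.
Proof. by move=> hg; apply: (cdiff_comp hg); exact: cdiff_cexp. Qed.

End CExp.

(** * Goursat's lemma for dyadic Riemann sums *)

Section SquareCousin.
Variable R : realType.

(** The [s k] are the left ends of nested intervals of length [2^-1 ^+ k]; the supremum of the left
    ends lies in all of them. *)
Lemma nested_dyadic (s : nat -> R) :
  (forall k, s k <= s k.+1 <= s k + 2^-1 ^+ k.+1) ->
  exists l, forall k, s k <= l <= s k + 2^-1 ^+ k.
Proof.
move=> hs.
have mono k j : s k <= s (k + j)%N.
  elim: j => [|j ih]; first by rewrite addn0.
  by rewrite addnS; apply: le_trans ih _; case/andP: (hs (k + j)%N).
have up k j : s (k + j)%N + 2^-1 ^+ (k + j) <= s k + 2^-1 ^+ k.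
  elim: j => [|j ih]; first by rewrite addn0.
  rewrite addnS; apply: le_trans ih; case/andP: (hs (k + j)%N) => _.
  rewrite exprS; set y := _ ^+ _; have : 0 <= y by rewrite exprn_ge0// invr_ge0.
  by lra.
have ub k j : s j <= s k + 2^-1 ^+ k.
  have y0 i : 0 <= (2^-1 : R) ^+ i by rewrite exprn_ge0// invr_ge0.
  have [kj|/ltnW jk] := leqP k j.
    by have := up k (j - k)%N; rewrite subnKC//; have := y0 j; lra.
  by have := mono j (k - j)%N; rewrite subnKC//; have := y0 k; lra.
pose E := range s.
have E0 : E !=set0 by exists (s 0%N), 0%N.
have supE : has_sup E.
  by split => //; exists (s 0%N + 2^-1 ^+ 0) => _ [j _ <-]; exact: ub.
exists (sup E) => k; apply/andP; split.
  by apply: sup_upper_bound => //; exists k.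
by apply: ge_sup => // _ [j _ <-]; exact: ub.
Qed.

(* Bisection form of the compactness of the unit square. *)
Lemma square_bisection (Q : R -> R -> nat -> Prop) :
  (forall s t k, let h := 2^-1 ^+ k.+1 in Q s t k.+1 -> Q (s + h) t k.+1 ->
     Q s (t + h) k.+1 -> Q (s + h) (t + h) k.+1 -> Q s t k) ->
  (forall s t, 0 <= s <= 1 -> 0 <= t <= 1 -> exists K, forall k, (K <= k)%N ->
     forall s' t', s' <= s <= s' + 2^-1 ^+ k -> t' <= t <= t' + 2^-1 ^+ k ->
     Q s' t' k) ->
  Q 0 0 0%N.
Proof.
move=> hsplit hloc; apply: contrapT => nQ.
pose h k : R := 2^-1 ^+ k.+1.
(* Picks the first quarter on which [Q] fails. The last one is taken without a test: if the other
   three satisfy [Q], it must fail there, since [Q] fails on the parent. *)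
pose step k (x : R * R) : R * R :=
  if ~~ `[< Q x.1 x.2 k.+1 >] then x else
  if ~~ `[< Q (x.1 + h k) x.2 k.+1 >] then (x.1 + h k, x.2) else
  if ~~ `[< Q x.1 (x.2 + h k) k.+1 >] then (x.1, x.2 + h k)
  else (x.1 + h k, x.2 + h k).
pose fix x k : R * R := if k is j.+1 then step j (x j) else (0, 0).
have h0 k : 0 <= h k by rewrite exprn_ge0// invr_ge0.
have nQx k : ~ Q (x k).1 (x k).2 k.
  elim: k => [//|k ih] /=; rewrite /step.
  case: asboolP => //= q1; case: asboolP => //= q2; case: asboolP => //= q3 q4.
  by apply: ih; exact: hsplit.
have hx1 k : (x k).1 <= (x k.+1).1 <= (x k).1 + 2^-1 ^+ k.+1.
  rewrite /= /step; have := h0 k; rewrite -/(h k).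
  by do 3 (case: ifP => _ /=; first by lra); lra.
have hx2 k : (x k).2 <= (x k.+1).2 <= (x k).2 + 2^-1 ^+ k.+1.
  rewrite /= /step; have := h0 k; rewrite -/(h k).
  by do 3 (case: ifP => _ /=; first by lra); lra.
have [s hs] := nested_dyadic hx1; have [t ht] := nested_dyadic hx2.
have s01 : 0 <= s <= 1 by have := hs 0%N; rewrite /= expr0 add0r.
have t01 : 0 <= t <= 1 by have := ht 0%N; rewrite /= expr0 add0r.
have [K hK] := hloc s t s01 t01.
exact: (nQx K (hK K (leqnn K) _ _ (hs K) (ht K))).
Qed.

End SquareCousin.

Section Goursat.
Variables (R : realType) (V : normedModType R[i]).
Implicit Types (f g : R[i] -> V) (p q u v : R[i]).

(* The mean of f over 2^m equally spaced points of the segment [p, p + d[. *)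
Fixpoint edge f m p d : V :=
  if m is k.+1 then 2^-1 *: (edge f k p (d / 2) + edge f k (p + d / 2) (d / 2))
  else f p.

(* A Riemann sum for the integral of f along the parallelogram (p, u, v). *)
Definition contour f m p u v : V :=
  u *: (edge f m p u - edge f m (p + v) u) +
  v *: (edge f m (p + u) v - edge f m p v).

Lemma half2 (d : R[i]) : d / 2 + d / 2 = d.
Proof. by rewrite -splitr. Qed.

Lemma edgeB f g m p d : edge (fun w => f w - g w) m p d = edge f m p d - edge g m p d.
Proof.
elim: m p d => //= m ih p d.
by rewrite !ih -scalerBr opprD addrACA.
Qed.

Lemma edge_shift f m p q d : edge f m (p + q) d = edge (fun w => f (w + q)) m p d.
Proof. by elim: m p d => //= m ih p d; rewrite -!ih addrAC. Qed.

Lemma eq_edge f g m p d : f =1 g -> edge f m p d = edge g m p d.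
Proof. by move=> fg; elim: m p d => //= m ih p d; rewrite !ih. Qed.

Lemma real_half (t : R) : (t / 2)%:C = t%:C / 2 :> R[i].
Proof. by rewrite rmorphM fmorphV /= rmorphMn /= rmorph1. Qed.

Lemma nm2V : nm (2^-1 : R[i]) = 2^-1.
Proof.
have -> : 2^-1 = (2^-1 : R)%:C :> R[i] by rewrite -[in RHS]div1r real_half div1r.
by rewrite nmR ger0_norm// invr_ge0.
Qed.

Lemma edge_bound f m p d K :
  (forall t : R, 0 <= t <= 1 -> nm (f (p + t%:C * d)) <= K) ->
  nm (edge f m p d) <= K.
Proof.
elim: m p d => [|m ih] p d h /=.
  by have := h 0; rewrite lexx ler01 mul0r addr0; exact.
rewrite nmZ nm2V.
have E (t : R) : t%:C * (d / 2) = (t / 2)%:C * d.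
  by rewrite real_half mulrA mulrAC.
have h1 : nm (edge f m p (d / 2)) <= K.
  by apply: ih => t t01; rewrite E; apply: h; lra.
have h2 : nm (edge f m (p + d / 2) (d / 2)) <= K.
  apply: ih => t t01; rewrite E.
  have -> : p + d / 2 + (t / 2)%:C * d = p + ((1 + t) / 2)%:C * d.
    rewrite !real_half rmorphD rmorph1; by field.
  by apply: h; lra.
by have := nm_triangle (edge f m p (d / 2)) (edge f m (p + d / 2) (d / 2)); lra.
Qed.

Lemma edge_affine a b m p q d :
  edge (fun w => a + w *: b : V) m (p + q) d =
  edge (fun w => a + w *: b) m p d + q *: b.
Proof.
elim: m p d => [|m ih] p d /=; first by rewrite scalerDl addrA.
rewrite (addrAC p) !ih addrACA scalerDr; congr (_ + _).
by rewrite -scalerDl scalerA mulrDr !(mulrC 2^-1) half2.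
Qed.

Lemma contourB f g m p u v :
  contour (fun w => f w - g w) m p u v = contour f m p u v - contour g m p u v.
Proof.
rewrite /contour !edgeB [in RHS]opprD [RHS]addrACA -!scalerBr.
by congr (_ *: _ + _ *: _); rewrite !opprB addrACA [in RHS]addrACA; congr (_ + _);
  rewrite addrC.
Qed.

(** Means over opposite edges differ by exactly [v *: b] and [u *: b], so the two contributions
    cancel for every [m], not only in the limit. *)
Lemma contour_affine a b m p u v : contour (fun w => a + w *: b : V) m p u v = 0.
Proof.
rewrite /contour !edge_affine opprD addrA subrr add0r addrAC subrr add0r.
by rewrite scalerN !scalerA mulrC addNr.
Qed.

(** Inner edges are run through twice in opposite senses with the same nodes. One level is spent on
    halving, so the four quarters at level [m] match the parent at level [m.+1] and the identity is
    exact. *)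
Lemma contour_split f m p u v : let u' := u / 2 in let v' := v / 2 in
  contour f m.+1 p u v = contour f m p u' v' + contour f m (p + u') u' v' +
    contour f m (p + v') u' v' + contour f m (p + u' + v') u' v'.
Proof.
move=> u' v'; rewrite /contour /= -/u' -/v'.
have -> : p + u' + u' = p + u by rewrite -addrA half2.
have -> : p + v' + v' = p + v by rewrite -addrA half2.
have -> : p + v' + u' = p + u' + v' by rewrite addrAC.
have -> : p + u' + v' + v' = p + v + u' by rewrite -addrA half2 addrAC.
have -> : p + u' + v' + u' = p + u + v' by rewrite addrAC -(addrA p) half2.
have h2 w (x : V) : w *: (2^-1 *: x) = (w / 2) *: x by rewrite scalerA.
rewrite -!scalerBr !h2 -/u' -/v' !addrA [RHS](ACl (1*3*5*7*(2*4*6*8)))/=.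
rewrite -!scalerDr !opprD !addrA; congr (_ *: _ + _ *: _).
  by rewrite [RHS](ACl (1*3*6*8*(2*5)*(4*7)))/= !addNr !addr0.
by rewrite [RHS](ACl (3*7*2*6*(1*4)*(5*8)))/= !subrr !addr0.
Qed.

Definition parallelogram p u v : set R[i] :=
  [set w | exists s t : R, [/\ 0 <= s <= 1, 0 <= t <= 1 & w = p + s%:C * u + t%:C * v]].

Lemma contour_bound f m p u v K :
  (forall w, parallelogram p u v w -> nm (f w) <= K) ->
  nm (contour f m p u v) <= 2 * (nm u + nm v) * K.
Proof.
move=> h.
have hu (t : R) : (t = 0) \/ (t = 1) -> nm (edge f m (p + t%:C * v) u) <= K.
  move=> t01; apply: edge_bound => s s01; apply: h; exists s, t; split => //.
    by case: t01 => ->; lra.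
  by rewrite addrAC.
have hv (t : R) : (t = 0) \/ (t = 1) -> nm (edge f m (p + t%:C * u) v) <= K.
  move=> t01; apply: edge_bound => s s01; apply: h; exists t, s; split => //.
  by case: t01 => ->; lra.
have := hu 0 (or_introl erefl); have := hu 1 (or_intror erefl).
have := hv 0 (or_introl erefl); have := hv 1 (or_intror erefl).
rewrite !mul0r !mul1r !addr0 => h1 h2 h3 h4.
apply: le_trans (nm_triangle _ _) _; rewrite !nmZ.
have := nm_triangleB (edge f m p u) (edge f m (p + v) u).
have := nm_triangleB (edge f m (p + u) v) (edge f m p v).
have := nm_ge0 u; have := nm_ge0 v => v0 u0 hV hU.
have : nm u * nm (edge f m p u - edge f m (p + v) u) <= nm u * (2 * K).
  by rewrite ler_wpM2l//; lra.
have : nm v * nm (edge f m (p + u) v - edge f m p v) <= nm v * (2 * K).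
  by rewrite ler_wpM2l//; lra.
lra.
Qed.

Theorem goursat f p u v :
  (forall w, parallelogram p u v w -> cdiff f w) ->
  forall e : R, 0 < e -> exists M, forall m, (M <= m)%N -> nm (contour f m p u v) <= e.
Proof.
move=> df c c0.
pose h k : R := 2^-1 ^+ k.
have h0 k : 0 < h k by rewrite exprn_gt0// invr_gt0.
pose hu k := (h k)%:C * u; pose hv k := (h k)%:C * v.
have hS k (x : R[i]) : (h k)%:C * x / 2 = (h k.+1)%:C * x.
  by rewrite /h exprSr real_half mulrAC.
(* The bound is proportional to the area, so the bounds of four quarters add up to that of the
   parent. The threshold [M] may depend on the square, since each splitting involves only four of
   them. *)
pose Q s t k := exists M, forall m, (M <= m)%N ->
  nm (contour f m (p + s%:C * u + t%:C * v) (hu k) (hv k)) <= c * h k ^+ 2.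
suff : Q 0 0 0%N.
  move=> [M hM]; exists M => m /hM.
  by rewrite /hu /hv /h expr0 expr1n !mul0r !mul1r mulr1 !addr0.
apply: square_bisection.
  move=> s t k h1 [M1 q1] [M2 q2] [M3 q3] [M4 q4].
  exists (maxn (maxn M1 M2) (maxn M3 M4)).+1 => -[//|m]; rewrite ltnS !geq_max.
  move=> /andP[/andP[/q1{}q1 /q2{}q2] /andP[/q3{}q3 /q4{}q4]].
  rewrite contour_split /= -/(hu k) -/(hv k) !hS -/(hu k.+1) -/(hv k.+1).
  set a := p + _ + _.
  have e2 : p + (s + h1)%:C * u + t%:C * v = a + hu k.+1.
    by rewrite rmorphD mulrDl !addrA (addrAC _ (h1%:C * u)).
  have e3 : p + s%:C * u + (t + h1)%:C * v = a + hv k.+1.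
    by rewrite rmorphD mulrDl !addrA.
  have e4 : p + (s + h1)%:C * u + (t + h1)%:C * v = a + hu k.+1 + hv k.+1.
    by rewrite [(t + h1)%:C]rmorphD mulrDl addrA e2.
  rewrite e2 in q2; rewrite e3 in q3; rewrite e4 in q4.
  have := nm_triangle (contour f m a (hu k.+1) (hv k.+1)) (contour f m (a + hu k.+1) (hu k.+1) (hv k.+1)).
  have := nm_triangle (contour f m a (hu k.+1) (hv k.+1) + contour f m (a + hu k.+1) (hu k.+1) (hv k.+1)) (contour f m (a + hv k.+1) (hu k.+1) (hv k.+1)).
  move=> t1 t2; apply: le_trans (nm_triangle _ _) _.
  have -> : c * h k ^+ 2 = 4 * (c * h k.+1 ^+ 2) by rewrite (_ : h k.+1 = h k / 2); [field|rewrite /h exprSr].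
  by rewrite -/a in q1; lra.
move=> s t s01 t01.
set q := p + s%:C * u + t%:C * v.
have [L hL] := df q (ex_intro _ s (ex_intro _ t (And3 s01 t01 erefl))).
pose D := nm u + nm v.
have D0 : 0 <= D by rewrite addr_ge0 ?nm_ge0.
(* With accuracy [c / (1 + 2 * D ^+ 2)] at [q], [contour_bound] gives at most [2 * (h k * D)] times
   that accuracy times [h k * D], which is below [c * h k ^+ 2]. *)
have D1 : 0 < 1 + 2 * D ^+ 2 by have := sqr_ge0 D; lra.
have [d d0 hd] := hL _ (divr_gt0 c0 D1).
have [K hK] : exists K, forall k, (K <= k)%N -> h k * D < d.
  have D11 : 0 < D + 1 by lra.
  have /cvgrPdist_lt /(_ _ (divr_gt0 d0 D11)) [K _ hK] := @cvg_expr R 2^-1 (ltac:(rewrite ger0_norm; lra)).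
  exists K => k /hK /=; rewrite sub0r normrN ger0_norm; last by rewrite ltW ?h0.
  rewrite ltr_pdivlMr// -/(h k); have := h0 k; lra.
exists K => k /hK{}hK s' t' hs ht; exists 0%N => m _.
set a := p + _ + _.
(* The tangent map of [f] at [q] has zero contour sums and may be subtracted. *)
pose lin w := (f q - q *: L) + w *: L.
have -> : contour f m a (hu k) (hv k) = contour (fun w => f w - lin w) m a (hu k) (hv k).
  by rewrite contourB contour_affine subr0.
have hD : nm (hu k) + nm (hv k) = h k * D.
  by rewrite !nmM nmR ger0_norm ?ltW ?h0// mulrDr.
apply: le_trans (@contour_bound _ _ _ _ _ (c / (1 + 2 * D ^+ 2) * (h k * D)) _) _.
  move=> w [x [y [x01 y01 ->]]].
  set w' := _ + _ * hv k.
  have hw : nm (w' - q) <= h k * D.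
    have -> : w' - q = (s' + x * h k - s)%:C * u + (t' + y * h k - t)%:C * v.
      rewrite /w' /q /a /hu /hv !rmorphD !rmorphN !rmorphM /=; ring.
    apply: le_trans (nm_triangle _ _) _; rewrite !nmM !nmR mulrDr.
    have hx : 0 <= x * h k <= h k by have := h0 k; nra.
    have hy : 0 <= y * h k <= h k by have := h0 k; nra.
    rewrite /h in hx hy *.
    by apply: lerD; rewrite ler_wpM2r ?nm_ge0// ler_norml; lra.
  have -> : f w' - lin w' = f w' - f q - (w' - q) *: L.
    by rewrite /lin scalerBl !opprD !opprK !addrA [RHS]addrAC.
  apply: le_trans (hd _ (le_lt_trans hw hK)) _.
  by rewrite ler_wpM2l// ltW// divr_gt0.
rewrite hD.
have -> : 2 * (h k * D) * (c / (1 + 2 * D ^+ 2) * (h k * D)) = c * h k ^+ 2 * (2 * D ^+ 2 / (1 + 2 * D ^+ 2)).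
  by field; rewrite gt_eqF.
rewrite ler_piMr//; first by rewrite mulr_ge0 ?sqr_ge0// ltW.
by rewrite ler_pdivrMr//; lra.
Qed.

End Goursat.

(** * Mean value property and maximum principle *)

Section MeanValue.
Variables (R : realType) (V : normedModType R[i]).
Implicit Types (f : R[i] -> V) (p q w : R[i]).

(** Compares a vector-valued mean with the mean of the harmonic function [Re g] on the same nodes;
    [no_strict_max] uses it on a circle. *)
Lemma edge_le f (g : R[i] -> R[i]^o) m p d :
  (forall t : R, 0 <= t <= 1 -> nm (f (p + t%:C * d)) <= Re (g (p + t%:C * d))) ->
  nm (edge f m p d) <= Re (edge g m p d).
Proof.
elim: m p d => [|m ih] p d h /=.
  by have := h 0; rewrite lexx ler01 mul0r addr0; exact.
have E (t : R) : t%:C * (d / 2) = (t / 2)%:C * d.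
  by rewrite real_half mulrA mulrAC.
have h1 : nm (edge f m p (d / 2)) <= Re (edge g m p (d / 2)).
  by apply: ih => t t01; rewrite E; apply: h; lra.
have h2 : nm (edge f m (p + d / 2) (d / 2)) <= Re (edge g m (p + d / 2) (d / 2)).
  apply: ih => t t01; rewrite E.
  have -> : p + d / 2 + (t / 2)%:C * d = p + ((1 + t) / 2)%:C * d.
    by rewrite !real_half rmorphD rmorph1; field.
  by apply: h; lra.
have -> (z : R[i]^o) : Re (2^-1 *: z) = 2^-1 * Re z.
  have -> : 2^-1 *: z = (2^-1)%:C * z by rewrite fmorphV rmorphMn.
  by case: z => a b /=; rewrite mul0r subr0.
rewrite nmZ nm2V [Re (_ + _)]raddfD /=.
by have := nm_triangle (edge f m p (d / 2)) (edge f m (p + d / 2) (d / 2)); lra.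
Qed.

Lemma edge_cst (v : V) m p d : edge (fun=> v) m p d = v.
Proof.
elim: m p d => //= m ih p d; rewrite !ih -mulr2n -[v *+ 2]scaler_nat scalerA.
by rewrite mulVf ?scale1r// pnatr_eq0.
Qed.

Local Notation tau := (0 +i* (2 * pi) : R[i]).

(* The mean of f over the 2^m-th roots of unity on the circle of centre p and
   radius exp a. *)
Definition circle_mean f m p (a : R) : V := edge (fun w => f (p + cexp w)) m a%:C tau.

Lemma nm_circle (a t : R) : nm (cexp (a%:C + t%:C * tau)) = expR a.
Proof. by rewrite nm_cexp /= !mul0r mulr0 subr0 addr0. Qed.

(** In the rectangle [a <= Re w <= b], [0 <= Im w <= 2 pi], the vertical edges carry the means over
    the circles of radii [expR a] and [expR b], and the horizontal edges cancel because [cexp] has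
    period 2 pi i. When [expR a] is small, continuity at [p] alone puts the inner mean close to
    [f p]. *)
Theorem mean_value f p b : ccont setT f p ->
  (forall w, 0 < nm (w - p) <= expR b -> cdiff f w) ->
  forall e : R, 0 < e -> exists M, forall m, (M <= m)%N ->
  nm (circle_mean f m p b - f p) <= e.
Proof.
move=> cf df e e0.
have e2 : 0 < e / 2 by rewrite divr_gt0.
have [d d0 hd] := cf _ e2.
pose a := Num.min (b - 1) (ln (d / 2)).
have d2 : d / 2 < d by lra.
have ad : expR a < d.
  apply: le_lt_trans d2; rewrite -[leRHS]lnK ?posrE ?divr_gt0// ler_expR.
  by rewrite ge_min lexx orbT.
have ab : a < b by apply: (@le_lt_trans _ _ (b - 1)); [rewrite ge_min lexx|lra].
have ha m : nm (circle_mean f m p a - f p) <= e / 2.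
  rewrite -(edge_cst (f p) m a%:C tau).
  rewrite /circle_mean -edgeB; apply: edge_bound => t t01; apply: hd => //.
  by rewrite (addrC p) addrK nm_circle.
pose G w := f (p + cexp w).
have dG w : parallelogram a%:C (b - a)%:C tau w -> cdiff G w.
  move=> [s [t [s01 t01 ->]]]; rewrite /G.
  apply: (@cdiff_comp _ _ (fun w => p + cexp w)).
    by apply: cdiffD; [exact: cdiff_cst|exact: cdiff_cexp].
  apply: df; rewrite (addrC p) addrK nm_cexp expR_gt0 /= ler_expR.
  by rewrite !mul0r !mulr0 !subr0 addr0; nra.
have t0 : 0 < nm tau by rewrite nmiR ger0_norm ?mulr_ge0 ?mulr_gt0 ?pi_ge0 ?pi_gt0.
have [M hM] := goursat dG (mulr_gt0 e2 t0).
exists M => m /hM; rewrite /contour.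
have -> : edge G m (a%:C + tau) (b - a)%:C = edge G m a%:C (b - a)%:C.
  by rewrite edge_shift; apply: eq_edge => w; rewrite /G cexp2pi.
rewrite subrr scaler0 add0r -rmorphD /= (addrC a) subrK nmZ mulrC ler_pM2r// => h.
apply: le_trans (nm_dist (circle_mean f m p a) _ _) _.
by have := ha m; rewrite /circle_mean -/G; lra.
Qed.

End MeanValue.

(** * Maximum principle on rectangles, with removable singularities *)

Section MaximumPrinciple.
Variables (R : realType) (V : normedModType R[i]).
Implicit Types (f : R[i] -> V) (p q w : R[i]).

(** The hypothesis of a removable singularity: continuity at [p] and differentiability on a
    punctured disc. It is what a divided difference satisfies at its base point. *)
Definition isolated_cdiff f p := ccont setT f p /\
  exists2 r : R, 0 < r & forall w, 0 < nm (w - p) < r -> cdiff f w.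

Lemma cdiff_isolated f p r : 0 < r -> (forall w, nm (w - p) < r -> cdiff f w) ->
  isolated_cdiff f p.
Proof.
move=> r0 h; split; first by apply: cdiff_cont; apply: h; rewrite subrr nm0.
by exists r => // w /andP[_ /h].
Qed.

(** On a circle of radius rho the linear term averages to 0 in the limit, so the mean of the
    right-hand side tends to [nm (f p) - eps * rho ^+ 2], whereas the mean of [f] tends to [f p].
    The linear term is there because recentring [eps * |w|^2] at a maximum produces one. *)
Lemma no_strict_max f p (c : R[i]) (r eps : R) : isolated_cdiff f p -> 0 < r -> 0 < eps ->
  ~ (forall w, nm (w - p) < r ->
     nm (f w) <= nm (f p) - eps * nm (w - p) ^+ 2 + Re (c * (w - p))).
Proof.
move=> [cf [r1 r10 df]] r0 eps0 h.
pose b := ln (Num.min r r1 / 2).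
have m0 : 0 < Num.min r r1 by rewrite lt_min r0.
have eb : expR b = Num.min r r1 / 2 by rewrite lnK// posrE divr_gt0.
have br : expR b < r.
  rewrite eb; have : Num.min r r1 <= r by rewrite ge_min lexx.
  by lra.
have br1 : expR b < r1.
  rewrite eb; have : Num.min r r1 <= r1 by rewrite ge_min lexx orbT.
  by lra.
pose rho := expR b; have rho0 : 0 < rho := expR_gt0 _.
have e0 : 0 < eps * rho ^+ 2 / 4 by rewrite divr_gt0// mulr_gt0// exprn_gt0.
pose A : R := nm (f p) - eps * rho ^+ 2.
pose g w : R[i]^o := A%:C + c * (w - p).
have dg w : cdiff g w.
  apply: cdiffD; first exact: cdiff_cst.
  apply: cdiffM; first exact: cdiff_cst.
  by apply: cdiffB; [exact: cdiff_id|exact: cdiff_cst].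
have [M1 hM1] : exists M, forall m, (M <= m)%N -> nm (circle_mean f m p b - f p) <= eps * rho ^+ 2 / 4.
  apply: mean_value => // w /andP[h1 h2]; apply: df; rewrite h1/=.
  exact: le_lt_trans h2 _.
have [M2 hM2] : exists M, forall m, (M <= m)%N ->
    nm (circle_mean g m p b - g p) <= eps * rho ^+ 2 / 4.
  by apply: mean_value => //; exact: cdiff_cont.
have := hM1 _ (leq_maxl M1 M2); have := hM2 _ (leq_maxr M1 M2).
set m := maxn _ _.
have : nm (circle_mean f m p b) <= Re (circle_mean g m p b).
  apply: edge_le => t t01; set w := cexp _.
  have hw : nm (p + w - p) = rho by rewrite (addrC p) addrK /w nm_circle.
  have := h (p + w); rewrite hw => /(_ br).
  by rewrite /g /A raddfD /=.
set E := circle_mean g m p b => h1 h2 h3.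
have h4 := Re_le_nm (E - g p).
have h5 : Re (E - g p) = Re E - A by rewrite raddfB /= /g subrr mulr0 addr0.
have := nm_split (f p) (circle_mean f m p b); rewrite nmB.
have h6 := ler_norm (Re (E - g p)).
have : 0 < eps * rho ^+ 2 by rewrite mulr_gt0// exprn_gt0.
rewrite /A in h5; lra.
Qed.


Definition rectangle (x0 x1 y0 y1 : R) : set R[i] :=
  [set w | x0 <= Re w <= x1 /\ y0 <= Im w <= y1].

Lemma ccont_nm_within f (x0 x1 y0 y1 : R) :
  (forall w, rectangle x0 x1 y0 y1 w -> ccont (rectangle x0 x1 y0 y1) f w) ->
  {within `[x0, x1]%classic `*` `[y0, y1]%classic,
    continuous (fun t : R * R => nm (f (t.1 +i* t.2)))}.
Proof.
move=> cf.
have Az (t : R * R) : (`[x0, x1]%classic `*` `[y0, y1]%classic) t ->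
    rectangle x0 x1 y0 y1 (t.1 +i* t.2).
  by move=> [/=]; rewrite !in_itv.
apply/subspace_continuousP => t At; apply/cvgrPdist_le => e e0.
have [d d0 hd] := cf _ (Az _ At) _ e0.
rewrite near_withinE; apply/nbhs_ballP; exists (d / 2) => /=; first by rewrite divr_gt0.
move=> s [/= h1 h2] As.
have hz : nm ((s.1 +i* s.2) - (t.1 +i* t.2)) < d.
  apply: le_lt_trans (nm_le_ReIm _) _; rewrite /=.
  by move: h1 h2; rewrite /ball /= (distrC t.1) (distrC t.2); lra.
have := hd _ (Az _ As) hz; rewrite ler_norml => h3.
have := nm_split (f (s.1 +i* s.2)) (f (t.1 +i* t.2)).
have := nm_split (f (t.1 +i* t.2)) (f (s.1 +i* s.2)).
by rewrite nmB; lra.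
Qed.

Lemma ccont_rectangle_bounded f (x0 x1 y0 y1 : R) :
  (forall w, rectangle x0 x1 y0 y1 w -> ccont (rectangle x0 x1 y0 y1) f w) ->
  exists M, forall w, rectangle x0 x1 y0 y1 w -> nm (f w) <= M.
Proof.
move=> cf; have [[w0 hw0]|n0] := pselect (rectangle x0 x1 y0 y1 !=set0); last first.
  by exists 0 => w hw; case: n0; exists w.
have cA : compact (`[x0, x1]%classic `*` `[y0, y1]%classic).
  by apply: compact_setX; exact: segment_compact.
have A0 : `[x0, x1]%classic `*` `[y0, y1]%classic !=set0.
  by exists (Re w0, Im w0); move: hw0 => [h1 h2]; split; rewrite /= in_itv.
have [c _ hmax] := compact_EVT_max A0 cA (ccont_nm_within cf).
exists (nm (f (c.1 +i* c.2))) => w [h1 h2].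
have := hmax (Re w, Im w); rewrite /=; case: w h1 h2 => a b /= h1 h2.
by apply; rewrite inE; split; rewrite /= in_itv.
Qed.

Theorem maximum_principle f (x0 x1 y0 y1 K : R) :
  (forall w, rectangle x0 x1 y0 y1 w -> ccont (rectangle x0 x1 y0 y1) f w) ->
  (forall w, x0 < Re w < x1 -> y0 < Im w < y1 -> isolated_cdiff f w) ->
  (forall w, rectangle x0 x1 y0 y1 w ->
     [\/ Re w = x0, Re w = x1, Im w = y0 | Im w = y1] -> nm (f w) <= K) ->
  forall w, rectangle x0 x1 y0 y1 w -> nm (f w) <= K.
Proof.
move=> cf df bf w0 hw0.
pose B := `|x0| + `|x1| + (`|y0| + `|y1|).
have B0 : 0 <= B by rewrite !addr_ge0.
have hB w : rectangle x0 x1 y0 y1 w -> nm w <= B.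
  move=> [hx hy]; apply: le_trans (nm_le_ReIm _) _; apply: lerD.
    have := ler_norm x1; have := ler_norm (- x0); rewrite normrN => h1 h2.
    by rewrite ler_norml; have := normr_ge0 x0; have := normr_ge0 x1; lra.
  have := ler_norm y1; have := ler_norm (- y0); rewrite normrN => h1 h2.
  by rewrite ler_norml; have := normr_ge0 y0; have := normr_ge0 y1; lra.
suff H eps : 0 < eps -> nm (f w0) <= K + eps * B ^+ 2.
  apply/ler_addgt0Pr => e e0.
  have B1 : 0 < 1 + B ^+ 2 by have := sqr_ge0 B; lra.
  apply: le_trans (H _ (divr_gt0 e0 B1)) _; rewrite lerD2l mulrAC ler_pdivrMr//.
  by rewrite ler_pM2l//; lra.
move=> eps0.
pose A : set (R * R) := `[x0, x1]%classic `*` `[y0, y1]%classic.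
pose z (t : R * R) : R[i] := t.1 +i* t.2.
have zE w : z (Re w, Im w) = w by case: w.
have Az t : A t -> rectangle x0 x1 y0 y1 (z t).
  by move=> [/=]; rewrite !in_itv.
have cA : compact A by apply: compact_setX; exact: segment_compact.
have A0 : A !=set0.
  by exists (Re w0, Im w0); move: hw0 => [h1 h2]; split; rewrite /= in_itv.
(* The quadratic term gives an interior maximum the definite deficit that [no_strict_max] excludes;
   [eps] tends to 0 at the end. *)
pose h (t : R * R) : R := nm (f (z t)) + eps * (t.1 ^+ 2 + t.2 ^+ 2).
have ch : {within A, continuous h}.
  have c2 : {within A, continuous (fun t : R * R => eps * (t.1 ^+ 2 + t.2 ^+ 2))}.
    apply: continuous_subspaceT => t.
    apply: cvgM; first exact: cvg_cst.
    by apply: cvgD; (apply: cvgX || apply: cvgM); (exact: cvg_fst || exact: cvg_snd).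
  have c1 := ccont_nm_within cf.
  by move=> t; apply: cvgD; [exact: c1|exact: c2].
have [c] := compact_EVT_max A0 cA ch.
rewrite inE => Ac hmax.
have {}hmax w : rectangle x0 x1 y0 y1 w ->
    nm (f w) + eps * nm w ^+ 2 <= nm (f (z c)) + eps * nm (z c) ^+ 2.
  move=> [hx hy]; have := hmax (Re w, Im w); rewrite inE /h !nm_sqr /=.
  rewrite zE.
  by move=> h'; apply: h'; split; rewrite /= in_itv.
have hc := Az _ Ac.
have fin : nm (f (z c)) <= K -> nm (f w0) <= K + eps * B ^+ 2.
  move=> hK; have := hmax _ hw0; have := hB _ hc; have := nm_ge0 (z c); have := nm_ge0 w0.
  move=> n1 n2 n3 n4.
  have : eps * nm (z c) ^+ 2 <= eps * B ^+ 2 by rewrite ler_wpM2l ?(ltW eps0)// lerXn2r ?nnegrE.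
  have : 0 <= eps * nm w0 ^+ 2 by rewrite mulr_ge0 ?sqr_ge0 ?(ltW eps0).
  lra.
have [h1|] := boolP ([|| Re (z c) == x0, Re (z c) == x1, Im (z c) == y0 | Im (z c) == y1]).
  apply: fin; apply: bf => //.
  by case/or4P: h1 => /eqP ->; [constructor 1|constructor 2|constructor 3|constructor 4].
rewrite !negb_or => /and4P[n1 n2 n3 n4]; exfalso.
case: (hc) => /andP[c1 c2] /andP[c3 c4].
have i1 : x0 < Re (z c) by rewrite lt_neqAle eq_sym n1.
have i2 : Re (z c) < x1 by rewrite lt_neqAle n2.
have i3 : y0 < Im (z c) by rewrite lt_neqAle eq_sym n3.
have i4 : Im (z c) < y1 by rewrite lt_neqAle n4.
have dfc : isolated_cdiff f (z c) by apply: df; rewrite ?i1 ?i3.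
pose r := Num.min (Num.min (Re (z c) - x0) (x1 - Re (z c)))
                  (Num.min (Im (z c) - y0) (y1 - Im (z c))).
have r0 : 0 < r by rewrite !lt_min !subr_gt0 i1 i2 i3.
(* With [z] the maximum point, |w|^2 = |z|^2 + |w - z|^2 + 2 Re (conj z (w - z)), whence the
   coefficient -2 eps conj z. *)
apply: (no_strict_max (c := - (2 * eps)%:C * (Re (z c) -i* Im (z c))) dfc r0 eps0) => w hw.
have hr : rectangle x0 x1 y0 y1 w.
  have := Re_le_nm (w - z c); have := Im_le_nm (w - z c); rewrite !raddfB.
  move: hw; rewrite !lt_min => /andP[/andP[a1 a2] /andP[a3 a4]].
  by rewrite !ler_norml => hi hr'; split; lra.
have := hmax _ hr.
have -> : Re (- (2 * eps)%:C * (Re (z c) -i* Im (z c)) * (w - z c)) =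
   eps * (nm (z c) ^+ 2 + nm (w - z c) ^+ 2 - nm w ^+ 2).
  by rewrite !nm_sqr; case: (w) (z c) => [a b] [a' b'] /=; ring.
lra.
Qed.

End MaximumPrinciple.

(** * Schwarz estimates *)

Section DividedDifference.
Variables (R : realType) (V : normedModType R[i]).
Implicit Types (f : R[i] -> V) (p q w s : R[i]).

Lemma cdiff_inv p : p != 0 -> cdiff (fun w => w^-1 : R[i]^o) p.
Proof.
move=> p0; have np0 : 0 < nm p := nm_gt0 p0.
exists (- p ^- 2) => e e0.
pose d := Num.min (nm p / 2) (e * nm p ^+ 3 / 2).
exists d; first by rewrite lt_min !divr_gt0// mulr_gt0// exprn_gt0.
move=> w; rewrite lt_min => /andP[h1 h2].
have nw : nm p / 2 <= nm w by have := nm_split p w; rewrite nmB; lra.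
have nw0 : 0 < nm w by lra.
have w0 : w != 0 by apply/eqP => w0; rewrite w0 nm0 ltxx in nw0.
have -> : w^-1 - p^-1 - (w - p) *: (- p ^- 2 : R[i]^o) = (w - p) * ((w - p) * (w^-1 * p ^- 2)).
  by rewrite -[_ *: _]/((w - p) * (- p ^- 2)); field; rewrite w0 p0.
rewrite nmM mulrC ler_wpM2r ?nm_ge0// !nmM !nmV expr2 nmM -expr2.
have -> : e = e * nm p ^+ 3 / 2 * ((nm p / 2)^-1 * nm p ^- 2).
  by field; rewrite gt_eqF.
apply: ler_pM; rewrite ?nm_ge0 ?mulr_ge0 ?invr_ge0 ?sqr_ge0 ?nm_ge0//; first exact: ltW.
by rewrite ler_wpM2r ?invr_ge0 ?sqr_ge0// lef_pV2// posrE divr_gt0.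
Qed.

Lemma ccontZ (S : set R[i]) (phi : R[i] -> R[i]^o) f p :
  ccont S phi p -> ccont S f p -> ccont S (fun w => phi w *: f w) p.
Proof.
move=> cphi cf e e0.
have K0 : 0 < 1 + nm (phi p) + nm (f p).
  by have := nm_ge0 (phi p); have := nm_ge0 (f p); lra.
pose e1 := Num.min 1 (e / (1 + nm (phi p) + nm (f p))).
have e10 : 0 < e1 by rewrite lt_min ltr01 divr_gt0.
have e11 : e1 <= 1 by rewrite ge_min lexx.
have e1K : (1 + nm (phi p) + nm (f p)) * e1 <= e.
  by rewrite -ler_pdivlMl// mulrC ge_min lexx orbT.
have [d1 d10 h1] := cphi _ e10; have [d2 d20 h2] := cf _ e10.
exists (Num.min d1 d2); first by rewrite lt_min d10.
move=> w Sw; rewrite lt_min => /andP[/(h1 _ Sw){}h1 /(h2 _ Sw){}h2].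
have -> : phi w *: f w - phi p *: f p = (phi w - phi p) *: (f w - f p)
    + (phi p *: (f w - f p) + (phi w - phi p) *: f p).
  by rewrite !scalerBl !scalerBr !opprB !addrA
     [RHS](ACl (1*8*(2*7)*(3*6)*(4*5)))/= !addNr subrr !addr0.
apply: le_trans (nm_triangle _ _) _.
have := nm_triangle (phi p *: (f w - f p)) ((phi w - phi p) *: f p).
rewrite !nmZ => h3.
have hA : nm (phi w - phi p) * nm (f w - f p) <= e1 * 1.
  by apply: ler_pM; rewrite ?nm_ge0//; apply: le_trans h2 _.
have hB : nm (phi p) * nm (f w - f p) <= nm (phi p) * e1 by rewrite ler_wpM2l ?nm_ge0.
have hC : nm (phi w - phi p) * nm (f p) <= e1 * nm (f p) by rewrite ler_wpM2r ?nm_ge0.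
lra.
Qed.

Lemma ccontB (S : set R[i]) f (g : R[i] -> V) p :
  ccont S f p -> ccont S g p -> ccont S (fun w => f w - g w) p.
Proof.
move=> cf cg e e0; have e2 : 0 < e / 2 by lra.
have [d1 d10 h1] := cf _ e2; have [d2 d20 h2] := cg _ e2.
exists (Num.min d1 d2); first by rewrite lt_min d10.
move=> w Sw; rewrite lt_min => /andP[/(h1 _ Sw){}h1 /(h2 _ Sw){}h2].
have -> : f w - g w - (f p - g p) = (f w - f p) - (g w - g p).
  by rewrite !opprD !opprK !addrA [LHS](ACl (1*3*2*4)).
apply: le_trans (nm_triangleB _ _) _; lra.
Qed.

Definition divided_difference f s (L : V) w : V :=
  if w == s then L else (w - s)^-1 *: (f w - f s).

Lemma divided_difference_eq f s L p w : nm (w - p) < nm (p - s) ->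
  divided_difference f s L w = (w - s)^-1 *: (f w - f s).
Proof. by rewrite /divided_difference; case: eqP => // ->; rewrite nmB ltxx. Qed.

Lemma cdiff_inv_sub p s : p != s -> cdiff (fun w => (w - s)^-1 : R[i]^o) p.
Proof.
move=> ps; apply: (@cdiff_comp _ _ (fun w => w - s) (fun w => w^-1 : R[i]^o)).
  by apply: cdiffB; [exact: cdiff_id|exact: cdiff_cst].
by apply: cdiff_inv; rewrite subr_eq0.
Qed.

Lemma divided_difference_cdiff f s L p : p != s -> cdiff f p ->
  cdiff (divided_difference f s L) p.
Proof.
move=> ps dfp.
apply: (@cdiff_eq _ _ (fun w => (w - s)^-1 *: (f w - f s)) _ _ (nm (p - s))).
- by apply: nm_gt0; rewrite subr_eq0.
- by move=> w h; rewrite (@divided_difference_eq _ _ _ p).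
- by apply: cdiffZ; [exact: cdiff_inv_sub|apply: cdiffB => //; exact: cdiff_cst].
Qed.

(** At [q = s] the definition of the derivative yields only continuity of the slope, and
    differentiability is recovered on the punctured disc; elsewhere the slope is a product of
    functions as good as [f]. *)
Lemma divided_difference_isolated f s L q :
  has_cderiv f s L -> isolated_cdiff f s -> isolated_cdiff f q ->
  isolated_cdiff (divided_difference f s L) q.
Proof.
move=> hL [_ [r r0 dfs]] [cq [r' r'0 dfq]].
have [->|qs] := eqVneq q s.
  split.
    move=> e e0; have [d d0 hd] := hL e e0; exists d => // w _ /hd{}hd.
    rewrite /divided_difference eqxx; have [_|ws] := eqVneq w s.
      by rewrite subrr nm0 ltW.
    have ws0 : w - s != 0 by rewrite subr_eq0.
    have -> : (w - s)^-1 *: (f w - f s) - L = (w - s)^-1 *: (f w - f s - (w - s) *: L).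
      by rewrite [RHS]scalerBr scalerA mulVf// scale1r.
    by rewrite nmZ nmV mulrC ler_pdivrMr ?nm_gt0.
  exists r => // w hw; apply: divided_difference_cdiff; last exact: dfs.
  by apply/eqP => ws; move: hw; rewrite ws subrr nm0 ltxx.
have qs0 : 0 < nm (q - s) by apply: nm_gt0; rewrite subr_eq0.
split.
  have cg : ccont setT (fun w => (w - s)^-1 *: (f w - f s)) q.
    apply: ccontZ; first by apply: cdiff_cont; exact: cdiff_inv_sub.
    by apply: ccontB => //; apply: cdiff_cont; exact: cdiff_cst.
  move=> e /cg[d d0 hd]; exists (Num.min d (nm (q - s))); first by rewrite lt_min d0.
  move=> w _; rewrite lt_min => /andP[h1 h2].
  by rewrite !(@divided_difference_eq _ _ _ q) ?subrr ?nm0//; exact: hd.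
exists (Num.min r' (nm (q - s))); first by rewrite lt_min r'0.
move=> w /andP[h0]; rewrite lt_min => /andP[h1 h2]; apply: divided_difference_cdiff.
  by apply/eqP => ws; move: h2; rewrite ws nmB ltxx.
by apply: dfq; rewrite h0.
Qed.

(** Maximum principle on the square of half-side [r], whose boundary satisfies [r <= nm w] and which
    lies in the disc of radius [2 * r]. There the first divided difference is at most [2 * M / r];
    two of its values differ by at most [4 * M / r], and dividing by a distance of at least [r / 2]
    gives [8 * M / r ^+ 2]. *)
Lemma schwarz f L (r0 r M : R) : 0 < r -> 2 * r < r0 ->
  (forall w, nm w < r0 -> cdiff f w) -> (forall w, nm w < r0 -> nm (f w) <= M) ->
  has_cderiv f 0 L ->
  nm L <= 2 * M / r /\ forall s, nm s <= r / 2 ->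
  nm (f s - f 0) <= 2 * M / r * nm s /\
  nm (f s - f 0 - s *: L) <= 8 * M / r ^+ 2 * nm s ^+ 2.
Proof.
move=> r_gt0 rr0 df bf hL.
have M0 : 0 <= M.
  by apply: le_trans (nm_ge0 (f 0)) (bf _ _); rewrite nm0; lra.
have inr w : rectangle (- r) r (- r) r w -> nm w < r0.
  move=> [h1 h2]; apply: le_lt_trans (nm_le_ReIm _) _; apply: le_lt_trans rr0.
  have : `|Re w| <= r by rewrite ler_norml. have : `|Im w| <= r by rewrite ler_norml.
  lra.
have onb w : [\/ Re w = - r, Re w = r, Im w = - r | Im w = r] -> r <= nm w.
  have := Re_le_nm w; have := Im_le_nm w => h1 h2.
  by case=> h; [move: h2|move: h2|move: h1|move: h1];
     rewrite h ?normrN (ger0_norm (ltW r_gt0)).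
have isf w : nm w < r0 -> isolated_cdiff f w.
  move=> h; apply: (@cdiff_isolated _ _ _ _ (r0 - nm w)); first by rewrite subr_gt0.
  by move=> w' h'; apply: df; have := nm_split w' w; lra.
pose g := divided_difference f 0 L.
have is0 : isolated_cdiff f 0 by apply: isf; rewrite nm0; lra.
have isg w : nm w < r0 -> isolated_cdiff g w.
  by move=> h; apply: divided_difference_isolated => //; exact: isf.
have bg w : rectangle (- r) r (- r) r w -> nm (g w) <= 2 * M / r.
  apply: maximum_principle w => w hw.
  - by apply: (@ccontS _ _ _ setT) => //; case: (isg _ (inr _ hw)).
  - by move=> hw'; apply: isg; apply: inr; split; apply/andP; split; apply: ltW; lra.
  - move=> /onb rw; have w0 : 0 < nm w by lra.
    rewrite /g /divided_difference; case: eqP => [w00|_].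
      by move: w0; rewrite w00 nm0 ltxx.
    rewrite subr0 nmZ nmV mulrC; apply: ler_pM; rewrite ?nm_ge0 ?invr_ge0 ?nm_ge0//.
      have := nm_triangleB (f w) (f 0); have := bf _ (inr _ hw).
      have := bf 0; rewrite nm0 => h; have := h ltac:(lra); lra.
    by rewrite lef_pV2.
have gz w : f w - f 0 = w *: g w.
  rewrite /g /divided_difference; case: eqP => [->|/eqP w0].
    by rewrite subrr scale0r.
  by rewrite subr0 scalerA mulfV// scale1r.
have g0 : g 0 = L by rewrite /g /divided_difference eqxx.
have r00 : rectangle (- r) r (- r) r 0 by split=> /=; lra.
split; first by rewrite -g0; exact: bg.
move=> s hs.
have rs : rectangle (- r) r (- r) r s.
  have := Re_le_nm s; have := Im_le_nm s; rewrite !ler_norml.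
  by split; lra.
rewrite {1}gz nmZ; split.
  by rewrite mulrC ler_wpM2r ?nm_ge0//; exact: bg.
have [->|s0] := eqVneq s 0.
  by rewrite subrr scale0r subr0 !nm0 expr0n mulr0.
have ns0 : 0 < nm s := nm_gt0 s0.
(* The second divided difference is based at [s], where [g] is differentiable, and evaluated at 0:
   at 0 itself only continuity of [g] is known. *)
have [L2 hL2] : cdiff g s.
  by apply: divided_difference_cdiff => //; apply: df; exact: inr.
pose k := divided_difference g s L2.
have bk w : rectangle (- r) r (- r) r w -> nm (k w) <= 8 * M / r ^+ 2.
  apply: maximum_principle w => w hw.
  - apply: (@ccontS _ _ _ setT) => //.
    have [] // : isolated_cdiff k w.
    by apply: divided_difference_isolated => //; apply: isg; exact: inr.
  - move=> hw'; apply: divided_difference_isolated => //; apply: isg; apply: inr => //.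
    by split; apply/andP; split; apply: ltW; lra.
  - move=> /onb rw.
    have ws : r / 2 <= nm (w - s) by have := nm_split w s; lra.
    rewrite /k /divided_difference; case: eqP => [w00|_].
      by move: ws; rewrite w00 subrr nm0; lra.
    rewrite nmZ nmV mulrC.
    have -> : 8 * M / r ^+ 2 = 4 * M / r * (r / 2)^-1 by field; rewrite gt_eqF.
    apply: ler_pM; rewrite ?nm_ge0 ?invr_ge0 ?nm_ge0//; last first.
      by rewrite lef_pV2// posrE; lra.
    have := nm_triangleB (g w) (g s); have := bg _ hw; have := bg _ rs.
    have -> : 4 * M / r = 2 * (2 * M / r) by field; rewrite gt_eqF.
    by lra.
have -> : f s - f 0 - s *: L = s *: (s *: k 0).
  rewrite gz -scalerBr; congr (_ *: _).
  rewrite /k /divided_difference eq_sym (negbTE s0) sub0r g0 invrN scaleNr scalerN.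
  by rewrite scalerA mulfV// scale1r opprB.
rewrite !nmZ mulrA -expr2 mulrC ler_wpM2r ?sqr_ge0//; exact: bk.
Qed.

End DividedDifference.

(** * Vanishing on a side and Phragmen-Lindelof *)

Section StripLemmas.
Variable R : realType.
Implicit Types p : R[i].

Lemma ccont_cdiff (V : normedModType R[i]) (S : set R[i]) (f : R[i] -> V) p : cdiff f p -> ccont S f p.
Proof. by move=> /cdiff_cont; apply: ccontS. Qed.

Lemma cdiff_sqr_sub (x p : R[i]) : cdiff (fun w => (w - x) ^+ 2 : R[i]^o) p.
Proof.
by apply: cdiffM; apply: cdiffB; [exact: cdiff_id|exact: cdiff_cst|exact: cdiff_id|exact: cdiff_cst].
Qed.

Lemma le_of_archi (x y B : R) : 0 <= B -> (forall e, 0 < e -> x <= y + e * B) -> x <= y.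
Proof.
move=> B0 h; apply/ler_addgt0Pr => e e0.
have B1 : 0 < 1 + B by lra.
apply: le_trans (h _ (divr_gt0 e0 B1)) _; rewrite lerD2l mulrAC ler_pdivrMr//.
by rewrite ler_pM2l//; lra.
Qed.

End StripLemmas.

Section Strip.
Variables (R : realType) (V : normedModType R[i]).
Implicit Types (f : R[i] -> V) (p w : R[i]).

Lemma open_rectangle_ball (x0 x1 y0 y1 : R) p :
  x0 < Re p < x1 -> y0 < Im p < y1 -> exists2 r : R, 0 < r &
  forall w, nm (w - p) < r -> x0 < Re w < x1 /\ y0 < Im w < y1.
Proof.
move=> /andP[h1 h2] /andP[h3 h4].
exists (Num.min (Num.min (Re p - x0) (x1 - Re p)) (Num.min (Im p - y0) (y1 - Im p))).
  by rewrite !lt_min !subr_gt0 h1 h2 h3.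
move=> w; rewrite !lt_min => /andP[/andP[a1 a2] /andP[a3 a4]].
have := Re_le_nm (w - p); have := Im_le_nm (w - p).
by rewrite !raddfB !ler_norml => hi hr; split; lra.
Qed.

(* Compare f exp(- lam (w^2 - 3 i w)) at i y with its values on the boundary,
   where Re (w^2 - 3 i w) >= 2 except on the bottom side. *)
Theorem vanishing_on_side f :
  (forall w, rectangle (-2) 2 0 1 w -> ccont (rectangle (-2) 2 0 1) f w) ->
  (forall w, -2 < Re w < 2 -> 0 < Im w < 1 -> cdiff f w) ->
  (forall x : R, `|x| <= 2 -> f x%:C = 0) ->
  forall y : R, 0 <= y < 1 -> f (0 +i* y) = 0.
Proof.
move=> cf df f0 y /andP[y0 y1].
have [M hM] := ccont_rectangle_bounded cf.
pose E lam w : R[i] := cexp (- lam%:C * (w ^+ 2 - (0 +i* 3) * w)).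
have dE lam w : cdiff (E lam : _ -> R[i]^o) w.
  apply: cdiff_cexp_comp; apply: cdiffM; first exact: cdiff_cst.
  apply: cdiffB; last by apply: cdiffM; [exact: cdiff_cst|exact: cdiff_id].
  by apply: cdiffM; exact: cdiff_id.
have nE lam w : nm (E lam w) = expR (- lam * (Re w ^+ 2 - Im w ^+ 2 + 3 * Im w)).
  rewrite nm_cexp; congr expR; case: w => a b /=; ring.
have hy : rectangle (-2) 2 0 1 (0 +i* y) by split => /=; lra.
have M0 : 0 <= M := le_trans (nm_ge0 _) (hM _ hy).
have bound lam : 0 < lam -> nm (E lam (0 +i* y) *: f (0 +i* y)) <= expR (- lam * 2) * M.
  move=> lam0; move: (0 +i* y) hy; apply: maximum_principle.
  - by move=> w hw; apply: ccontZ; [exact: ccont_cdiff|exact: cf].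
  - move=> w h1 h2; have [r r0 hr] := open_rectangle_ball h1 h2.
    apply: (cdiff_isolated r0) => w' /hr[h3 h4].
    by apply: cdiffZ => //; exact: df.
  - move=> w hw; case: (hw) => h1 h2 hb.
    have [iw0|iw0] := eqVneq (Im w) 0.
      have -> : w = (Re w)%:C by case: (w) iw0 => a b /= ->.
      rewrite f0 ?scaler0 ?nm0 ?mulr_ge0 ?expR_ge0// ler_norml; lra.
    rewrite nmZ nE; apply: ler_pM; rewrite ?expR_ge0 ?nm_ge0//; last exact: hM.
    rewrite ler_expR !mulNr lerN2 ler_pM2l//.
    case: hb => h; [rewrite h; nra|rewrite h; nra|by move: iw0; rewrite h eqxx|].
    by rewrite h; have := sqr_ge0 (Re w); lra.
apply: nm_eq0; apply/eqP; rewrite eq_le nm_ge0 andbT.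
(* [del] is 2 - (3 y - y^2), the gap between the exponent on the other three sides and the exponent
   at i y. With [lam * del = e^-1] the remaining factor exp(-1/e) is at most [e]. *)
pose del := (1 - y) * (2 - y).
have del0 : 0 < del by rewrite mulr_gt0; lra.
apply: (@le_of_archi _ _ _ M) => // e e0; rewrite add0r.
have lam0 : 0 < (e * del)^-1 by rewrite invr_gt0 mulr_gt0.
have := bound _ lam0; rewrite nmZ nE /= expr0n/= sub0r.
set lam := (e * del)^-1; set F := nm _.
have -> : expR (- lam * 2) = expR (- lam * (- y ^+ 2 + 3 * y)) * expR (- (lam * del)).
  by rewrite -expRD /del; congr expR; ring.
rewrite -mulrA ler_pM2l ?expR_gt0// => h; apply: le_trans h _.
rewrite ler_wpM2r// expRN.
have : 1 + lam * del <= expR (lam * del) by exact: expR_ge1Dx.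
have ld : lam * del = e^-1 by rewrite /lam; field; rewrite !gt_eqF.
rewrite ld => h; rewrite -[leRHS]invrK lef_pV2 ?posrE ?expR_gt0 ?invr_gt0//; lra.
Qed.

(** The affine map [z |-> Re w + 2 z Im w] preserves the real line and sends i/2, a point of the
    segment covered by [vanishing_on_side], to [w]. *)
Theorem entire_vanishing f : (forall w, cdiff f w) ->
  (forall x : R, f x%:C = 0) -> forall w, f w = 0.
Proof.
move=> df f0 w.
pose g z := f ((Re w)%:C + z * (2 * Im w)%:C).
have dg z : cdiff g z.
  apply: (@cdiff_comp _ _ (fun z => (Re w)%:C + z * (2 * Im w)%:C)) => //.
  exact: cdiff_affine.
have -> : f w = g (0 +i* 2^-1).
  rewrite /g; congr f; case: (w) => a b; apply/eqP; rewrite eq_complex /=.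
  by apply/andP; split; apply/eqP; field.
apply: vanishing_on_side.
- by move=> z _; exact: ccont_cdiff.
- by move=> z _ _; exact: dg.
- by move=> x _; rewrite /g -rmorphM -rmorphD f0.
- lra.
Qed.

Theorem phragmen_lindelof f (Y M K : R) :
  let S : set R[i] := [set w | 0 <= Im w <= Y] in
  (forall w, S w -> ccont S f w) ->
  (forall w, 0 < Im w < Y -> cdiff f w) ->
  (forall w, S w -> nm (f w) <= M) ->
  (forall w, S w -> Im w = 0 \/ Im w = Y -> nm (f w) <= K) ->
  forall w, S w -> nm (f w) <= K.
Proof.
move=> S cf df bf lf p Sp.
have K0 : 0 <= K.
  apply: le_trans (nm_ge0 _) (lf 0 _ _); rewrite /S/=; last by left.
  by rewrite lexx /=; move: Sp; rewrite /S /=; lra.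
have M0 : 0 <= M := le_trans (nm_ge0 _) (bf _ Sp).
apply: (@le_of_archi _ _ _ 1) => // eta eta0; rewrite mulr1.
(* [K] may be 0, and the width [T] of the rectangle is obtained by dividing by it. *)
set K' := K + eta; have K'0 : 0 < K' by rewrite /K'; lra.
apply: (@le_of_archi _ _ _ (nm (f p) * Y ^+ 2)).
  by rewrite mulr_ge0 ?nm_ge0 ?sqr_ge0.
move=> e e0.
(* A Gaussian weight centred at [Re p]: its modulus is at least 1 at [p], at most
   [expR (e * Y ^+ 2)] on the strip, and it decays horizontally. *)
pose E w : R[i] := cexp (- e%:C * (w - (Re p)%:C) ^+ 2).
have dE w : cdiff (E : _ -> R[i]^o) w.
  apply: cdiff_cexp_comp; apply: cdiffM; first exact: cdiff_cst.
  exact: cdiff_sqr_sub.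
have nE w : nm (E w) = expR (- e * ((Re w - Re p) ^+ 2 - Im w ^+ 2)).
  rewrite nm_cexp; congr expR; case: w => a b /=; ring.
(* This width gives [M <= K' * (e * T)]; with [T <= T ^+ 2] and [1 + x <= expR x] it follows that
   [M * expR (- (e * T ^+ 2)) <= K'], which settles the vertical sides. *)
pose T := 1 + M / (K' * e).
have MKe : 0 <= M / (K' * e) by rewrite divr_ge0 ?mulr_ge0// ltW.
have T1 : 1 <= T by rewrite /T; lra.
have hp : rectangle (Re p - T) (Re p + T) 0 Y p.
  by split => //; lra.
have bound : nm (E p *: f p) <= expR (e * Y ^+ 2) * K'.
  have hT w : rectangle (Re p - T) (Re p + T) 0 Y w -> S w by case.
  apply: (@maximum_principle _ _ (fun w => E w *: f w) _ _ _ _ _ _ _ _ _ hp).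
  - move=> w hw; apply: ccontZ; first exact: ccont_cdiff.
    by apply: (ccontS hT); apply: cf; exact: hT.
  - move=> w h1 h2; have [r r0 hr] := open_rectangle_ball h1 h2.
    apply: (cdiff_isolated r0) => w' /hr[h3 h4].
    by apply: cdiffZ => //; exact: df.
  - move=> w hw hb; have Sw := hT _ hw; rewrite nmZ nE.
    have hY : Im w ^+ 2 <= Y ^+ 2 by rewrite lerXn2r ?nnegrE; move: Sw; rewrite /S/=; lra.
    have lines : Im w = 0 \/ Im w = Y -> expR (- e * ((Re w - Re p) ^+ 2 - Im w ^+ 2)) * nm (f w) <= expR (e * Y ^+ 2) * K'.
      move=> hl; apply: ler_pM; rewrite ?expR_ge0 ?nm_ge0//.
        rewrite ler_expR mulNr -mulrN ler_pM2l//.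
        by have := sqr_ge0 (Re w - Re p); lra.
      by apply: le_trans (lf _ Sw hl) _; rewrite /K'; lra.
    have sides : (Re w - Re p) ^+ 2 = T ^+ 2 -> expR (- e * ((Re w - Re p) ^+ 2 - Im w ^+ 2)) * nm (f w) <= expR (e * Y ^+ 2) * K'.
      move=> ->.
      have -> : - e * (T ^+ 2 - Im w ^+ 2) = e * Im w ^+ 2 + - (e * T ^+ 2) by ring.
      rewrite expRD -mulrA; apply: ler_pM; rewrite ?expR_ge0 ?mulr_ge0 ?expR_ge0 ?nm_ge0//.
        by rewrite ler_expR ler_pM2l.
      rewrite expRN mulrC ler_pdivrMr ?expR_gt0//.
      apply: le_trans (bf _ Sw) _.
      have : 1 + e * T ^+ 2 <= expR (e * T ^+ 2) by exact: expR_ge1Dx.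
      have TT : T <= T ^+ 2 by rewrite expr2 ler_peMr//; lra.
      have eT : M <= K' * (e * T).
        rewrite /T mulrDr mulrDr mulr1.
        have -> : K' * (e * (M / (K' * e))) = M by field; rewrite !gt_eqF.
        by have := mulr_ge0 (ltW K'0) (ltW e0); lra.
      have eTT : K' * (e * T) <= K' * (e * T ^+ 2) by rewrite !ler_pM2l.
      move=> h; have := ler_wpM2l (ltW K'0) h; lra.
    case: hb => h; [apply: sides|apply: sides|apply: lines|apply: lines].
    + by rewrite h; ring.
    + by rewrite h; ring.
    + by left.
    + by right.
have : nm (f p) <= expR (e * Y ^+ 2) * K'.
  apply: le_trans bound; rewrite nmZ nE subrr expr0n/= sub0r mulNr mulrN opprK.
  rewrite ler_peMl ?nm_ge0//; apply: le_trans (expR_ge1Dx _).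
  by rewrite lerDl mulr_ge0 ?sqr_ge0 ?(ltW e0).
rewrite mulrC -ler_pdivrMr ?expR_gt0// -expRN => h.
have h1 : 1 + - (e * Y ^+ 2) <= expR (- (e * Y ^+ 2)) by exact: expR_ge1Dx.
have := ler_wpM2l (nm_ge0 (f p)) h1; lra.
Qed.

End Strip.

(** * Sequences and several complex variables *)

Section Topology.
Variable R : realType.

Lemma posC_real (e : R[i]) : 0 < e -> exists2 d : R, 0 < d & e = d%:C.
Proof.
move=> e0; have eE : e = (Re e)%:C by rewrite RRe_real// gtr0_real.
by exists (Re e) => //; rewrite -ltcR -eE.
Qed.

Lemma le_nm (V W : normedZmodType R[i]) (k : R) (v : V) (w : W) :
  (`|v| <= k%:C * `|w|) = (nm v <= k * nm w).
Proof. by rewrite -lecR rmorphM /= !nmE. Qed.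

Lemma lt_nm (V : normedZmodType R[i]) (d : R) (v : V) : (`|v| < d%:C) = (nm v < d).
Proof. by rewrite -ltcR nmE. Qed.

Lemma nbhs_nm (V : normedModType R[i]) (x : V) (P : set V) :
  nbhs x P <-> exists2 d : R, 0 < d & forall w, nm (w - x) < d -> P w.
Proof.
split.
  move=> /nbhs_ballP[e /= /posC_real[d d0 ->] h]; exists d => // w hw.
  by apply: h; rewrite -ball_normE /= distrC lt_nm.
move=> [d d0 h]; apply/nbhs_ballP; exists d%:C; first by rewrite /= ltcR.
by move=> w; rewrite -ball_normE /= distrC lt_nm; exact: h.
Qed.

Definition seqlim (V : normedZmodType R[i]) (u : nat -> V) (l : V) :=
  forall e : R, 0 < e -> exists N, forall m, (N <= m)%N -> nm (u m - l) <= e.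

Definition nm_cauchy (V : normedZmodType R[i]) (u : nat -> V) :=
  forall e : R, 0 < e -> exists N, forall m k, (N <= m)%N -> (N <= k)%N ->
    nm (u m - u k) <= e.

(** A predicate on the norm rather than a structure, so that one statement of the limit theorems
    covers both [A] and the scalars [R[i]^o]. *)
Definition nm_complete (V : normedZmodType R[i]) :=
  forall u : nat -> V, nm_cauchy u -> exists l, seqlim u l.

Lemma seqlim_unique (V : normedZmodType R[i]) (u : nat -> V) l l' :
  seqlim u l -> seqlim u l' -> l = l'.
Proof.
move=> h h'; apply/subr0_eq/nm_eq0/eqP; rewrite eq_le nm_ge0 andbT.
apply/ler_addgt0Pr => e e0; rewrite add0r.
have [N hN] := h _ (divr_gt0 e0 (ltr0n _ 2)).
have [N' hN'] := h' _ (divr_gt0 e0 (ltr0n _ 2)).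
have := hN _ (leq_maxl N N'); have := hN' _ (leq_maxr N N').
have := nm_dist (u (maxn N N')) l l'; rewrite (nmB l (u _)); lra.
Qed.

Lemma seqlim_cst (V : normedZmodType R[i]) (l : V) : seqlim (fun=> l) l.
Proof. by move=> e e0; exists 0%N => m _; rewrite subrr nm0 ltW. Qed.

Lemma seqlim_le (V : normedZmodType R[i]) (u : nat -> V) l N0 (K : R) :
  seqlim u l -> (forall m, (N0 <= m)%N -> nm (u m) <= K) -> nm l <= K.
Proof.
move=> h hK; apply/ler_addgt0Pr => e e0; have [N hN] := h _ e0.
have := hN _ (leq_maxl N N0); have := hK _ (leq_maxr N N0).
have := nm_split l (u (maxn N N0)); rewrite nmB; lra.
Qed.

Lemma seqlimD (V : normedZmodType R[i]) (u v : nat -> V) l l' :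
  seqlim u l -> seqlim v l' -> seqlim (fun m => u m + v m) (l + l').
Proof.
move=> h h' e e0.
have [N hN] := h _ (divr_gt0 e0 (ltr0n _ 2)).
have [N' hN'] := h' _ (divr_gt0 e0 (ltr0n _ 2)).
exists (maxn N N') => m; rewrite geq_max => /andP[/hN{}hN /hN'{}hN'].
rewrite opprD addrACA; have := nm_triangle (u m - l) (v m - l'); lra.
Qed.

Lemma seqlim_bounded_linear (V W : normedZmodType R[i]) (L : V -> W) (C : R)
    (u : nat -> V) l :
  (forall v w, L (v - w) = L v - L w) -> (forall v, nm (L v) <= C * nm v) ->
  seqlim u l -> seqlim (fun m => L (u m)) (L l).
Proof.
move=> LB LC h e e0; pose C' := `|C| + 1.
have C'0 : 0 < C' by rewrite /C'; have := normr_ge0 C; lra.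
have [N hN] := h _ (divr_gt0 e0 C'0); exists N => m /hN.
rewrite ler_pdivlMr// => h1; rewrite -LB; apply: le_trans (LC _) _.
apply: le_trans h1; rewrite mulrC ler_wpM2l ?nm_ge0// /C'.
by have := ler_norm C; lra.
Qed.

Lemma seqlimN (V : normedZmodType R[i]) (u : nat -> V) l :
  seqlim u l -> seqlim (fun m => - u m) (- l).
Proof. by move=> h e /h[N hN]; exists N => m /hN; rewrite -opprD nmN. Qed.

Lemma seqlimB (V : normedZmodType R[i]) (u v : nat -> V) l l' :
  seqlim u l -> seqlim v l' -> seqlim (fun m => u m - v m) (l - l').
Proof. by move=> h /seqlimN; exact: seqlimD. Qed.

Lemma seqlimZ (V : normedModType R[i]) k (u : nat -> V) l :
  seqlim u l -> seqlim (fun m => k *: u m) (k *: l).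
Proof.
apply: (@seqlim_bounded_linear _ _ _ (nm k)); first by move=> v w; rewrite scalerBr.
by move=> v; rewrite nmZ.
Qed.

Lemma seqlim_cauchy (V : normedZmodType R[i]) (u : nat -> V) l :
  seqlim u l -> nm_cauchy u.
Proof.
move=> h e e0; have [N hN] := h _ (divr_gt0 e0 (ltr0n _ 2)).
exists N => m k /hN h1 /hN h2; have := nm_dist l (u m) (u k); rewrite (nmB l (u _)); lra.
Qed.

Lemma completeNormedMod_nm_complete (V : completeNormedModType R[i]) : nm_complete V.
Proof.
move=> u cu.
have : cvg (u @ \oo).
  apply: cauchy_cvg; apply: cauchy_exP => e /posC_real[d d0 ->].
  have [N hN] := cu _ (divr_gt0 d0 (ltr0n _ 2)); exists (u N).
  exists N => // m /= Nm; rewrite -ball_normE /= lt_nm.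
  by have := hN N m (leqnn N) Nm; lra.
move=> cvu; exists (lim (u @ \oo)) => e e0.
have /cvgrPdist_le /(_ e%:C) := cvu; rewrite ltcR => /(_ e0)[N _ hN].
by exists N => m /hN /=; rewrite distrC -nmE lecR.
Qed.

Lemma real_cauchy (u : nat -> R) :
  (forall e : R, 0 < e -> exists N, forall m k, (N <= m)%N -> (N <= k)%N ->
    `|u m - u k| <= e) ->
  exists l, forall e : R, 0 < e -> exists N, forall m, (N <= m)%N -> `|u m - l| <= e.
Proof.
move=> cu.
have : cvg (u @ \oo).
  apply: cauchy_cvg; apply: cauchy_exP => d d0.
  have [N hN] := cu _ (divr_gt0 d0 (ltr0n _ 2)); exists (u N).
  exists N => // m /= Nm; rewrite -ball_normE /=.
  by have := hN N m (leqnn N) Nm; lra.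
move=> cvu; exists (lim (u @ \oo)) => e e0.
have /cvgrPdist_le /(_ e e0)[N _ hN] := cvu.
by exists N => m /hN /=; rewrite distrC.
Qed.

Lemma complex_nm_complete : nm_complete (R[i]^o : normedModType R[i]).
Proof.
move=> u cu.
have [a ha] : exists a, forall e : R, 0 < e -> exists N, forall m, (N <= m)%N -> `|Re (u m) - a| <= e.
  apply: real_cauchy => e /cu[N hN]; exists N => m k h1 h2.
  by rewrite -raddfB; apply: le_trans (Re_le_nm _) _; exact: hN.
have [b hb] : exists a, forall e : R, 0 < e -> exists N, forall m, (N <= m)%N -> `|Im (u m) - a| <= e.
  apply: real_cauchy => e /cu[N hN]; exists N => m k h1 h2.
  by rewrite -raddfB; apply: le_trans (Im_le_nm _) _; exact: hN.
exists (a +i* b) => e e0.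
have [N hN] := ha _ (divr_gt0 e0 (ltr0n _ 2)).
have [N' hN'] := hb _ (divr_gt0 e0 (ltr0n _ 2)).
exists (maxn N N') => m; rewrite geq_max => /andP[/hN{}hN /hN'{}hN'].
apply: le_trans (nm_le_ReIm _) _; rewrite !raddfB /=; lra.
Qed.

End Topology.

(** * Frechet differentiability over the complex numbers *)

Section MDiff.
Variables (R : realType) (U V : normedModType R[i]).
Implicit Types (f : U -> V).

(** The Frechet derivative in quantifier form, with a norm bound in place of the continuity of [L];
    the next two lemmas identify it with [differentiable]. *)
Definition has_mderiv f x (L : U -> V) := [/\ linear L,
  exists C : R, forall v, nm (L v) <= C * nm v &
  forall e : R, 0 < e -> exists2 d : R, 0 < d &
    forall v, nm v < d -> nm (f (x + v) - f x - L v) <= e * nm v].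

Definition mdiff f x := exists L, has_mderiv f x L.

Lemma mdiff_differentiable f x : mdiff f x -> differentiable f x.
Proof.
move=> [L [linL [C hC] hL]].
pose df : {linear U -> V} := HB.pack L (GRing.isLinear.Build _ _ _ _ L linL).
have cdf : continuous df.
  move=> y; apply/cvgrPdist_le => _ /posC_real[e e0 ->]; apply/nbhs_nm.
  have C0 : 0 < `|C| + 1 by have := normr_ge0 C; lra.
  exists (e / (`|C| + 1)); first by rewrite divr_gt0.
  move=> w; rewrite ltr_pdivlMr// => hw.
  rewrite -linearB -nmE lecR; apply: le_trans (hC _) _; rewrite nmB; apply: le_trans (ltW hw).
  by rewrite mulrC ler_wpM2l ?nm_ge0//; have := ler_norm C; lra.
have E : f \o shift x = cst (f x) + df +o_ 0 id.
  apply/eqaddoP => _ /posC_real[e e0 ->]; apply/nbhs_nm.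
  have [d d0 hd] := hL _ e0; exists d => // w; rewrite subr0 => /hd.
  rewrite -le_nm; congr (_ <= _).
  by rewrite /= /shift !fctE /= opprD addrA (addrC w).
by apply/diff_locallyP; rewrite (diff_unique cdf E).
Qed.

Lemma differentiable_mdiff f x : differentiable f x -> mdiff f x.
Proof.
move=> dfx; have /diff_locallyP[cdf E] := dfx.
exists ('d f x); split; first exact: linearP.
  have /cvgrPdist_le /(_ 1%:C) := cdf 0; rewrite linear0.
  rewrite ltcR ltr01 => /(_ isT) /nbhs_nm[d d0 hd].
  (* Continuity at 0 bounds the differential by 1 on the ball of radius [d]; every nonzero [v] is
     rescaled to norm [d / 2]. *)
  exists (2 / d) => v; have [->|v0] := eqVneq v 0; first by rewrite linear0 !nm0 mulr0.
  have nv0 : 0 < nm v := nm_gt0 v0.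
  pose k := d / 2 / nm v.
  have k0 : 0 < k by rewrite /k !divr_gt0.
  have := hd (k%:C *: v); rewrite subr0 nmZ nmR (ger0_norm (ltW k0)).
  have -> : k * nm v = d / 2 by rewrite /k; field; rewrite gt_eqF.
  rewrite ltr_pdivrMr// ltr_pMr// ltr1n => /(_ isT).
  rewrite linearZ /= sub0r normrN -nmE lecR nmZ nmR (ger0_norm (ltW k0)).
  rewrite mulrC -ler_pdivlMr// => h; apply: le_trans h _.
  have -> : 1 / k = 2 / d * nm v by rewrite /k; field; rewrite !gt_eqF.
  exact: lexx.
move: E => /eqaddoP E e e0; have := E e%:C; rewrite ltcR => /(_ e0) /nbhs_nm[d d0 hd].
exists d => // v; have := hd v; rewrite subr0 => h /h.
rewrite -le_nm; congr (_ <= _).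
by rewrite /= /shift !fctE /= opprD addrA (addrC v).
Qed.

End MDiff.

Section MDiffCalculus.
Variables (R : realType) (U V : normedModType R[i]).
Implicit Types (f g : U -> V) (x : U).

Lemma linear_mapB (L : U -> V) : linear L -> forall u v, L (u - v) = L u - L v.
Proof. by move=> linL u v; rewrite -scaleN1r addrC linL scaleN1r addrC. Qed.

Lemma linear_mapZ (L : U -> V) : linear L -> forall k v, L (k *: v) = k *: L v.
Proof.
move=> linL k v; have L0 : L 0 = 0.
  by have := linear_mapB linL 0 0; rewrite !subrr.
by have := linL k v 0; rewrite L0 !addr0.
Qed.

Lemma linear_mapD (L : U -> V) : linear L -> forall u v, L (u + v) = L u + L v.
Proof. by move=> linL u v; have := linL 1 u v; rewrite !scale1r. Qed.

Lemma mdiff_shift f x a : mdiff (fun w => f (a + w)) x <-> mdiff f (a + x).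
Proof.
split=> -[L [h1 h2 h3]]; exists L; split=> // e /h3[d d0 hd]; exists d => // v /hd.
  by rewrite addrA.
by rewrite addrA.
Qed.

Lemma mderiv_slice f a v (s0 : R[i]) L : has_mderiv f (a + s0 *: v) L ->
  has_cderiv (fun s => f (a + s *: v)) s0 (L v).
Proof.
move=> [linL _ hL] e e0.
have v1 : 0 < 1 + nm v by have := nm_ge0 v; lra.
have [d d0 hd] := hL _ (divr_gt0 e0 v1).
exists (d / (1 + nm v)); first by rewrite divr_gt0.
move=> w; rewrite ltr_pdivlMr// => hw.
have hw' : nm ((w - s0) *: v) < d.
  by rewrite nmZ; apply: le_lt_trans hw; rewrite ler_wpM2l ?nm_ge0//; lra.
have E : a + s0 *: v + (w - s0) *: v = a + w *: v.
  by rewrite -addrA -scalerDl addrCA subrr addr0.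
have := hd _ hw'; rewrite E (linear_mapZ linL) => h; apply: le_trans h _.
rewrite nmZ mulrAC ler_pdivrMr//.
have : 0 <= e * nm (w - s0) by rewrite mulr_ge0 ?nm_ge0// ltW.
lra.
Qed.

Lemma mdiff_slice f a v (s0 : R[i]) : mdiff f (a + s0 *: v) ->
  cdiff (fun s => f (a + s *: v)) s0.
Proof. by move=> [L /mderiv_slice h]; exists (L v). Qed.

Lemma mdiff_cst (c : V) x : mdiff (fun _ : U => c) x.
Proof.
exists (fun=> 0); split; first by move=> k u v; rewrite scaler0 addr0.
  by exists 0 => v; rewrite nm0 mul0r.
move=> e e0; exists 1 => // v _.
by rewrite !subrr nm0 mulr_ge0 ?nm_ge0// ltW.
Qed.

Lemma mdiffD f g x : mdiff f x -> mdiff g x -> mdiff (fun w => f w + g w) x.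
Proof.
move=> [L [linL [C hC] hL]] [M [linM [C' hC'] hM]].
exists (fun v => L v + M v); split.
- by move=> k u v; rewrite linL linM scalerDr addrACA.
- exists (C + C') => v; apply: le_trans (nm_triangle _ _) _.
  by rewrite mulrDl lerD.
- move=> e e0; have e2 : 0 < e / 2 by lra.
  have [d1 d10 h1] := hL _ e2; have [d2 d20 h2] := hM _ e2.
  exists (Num.min d1 d2); first by rewrite lt_min d10.
  move=> v; rewrite lt_min => /andP[/h1{}h1 /h2{}h2]; rewrite addr_diff3.
  apply: le_trans (nm_triangle _ _) _; lra.
Qed.

Lemma mdiff_cont f x : mdiff f x -> forall e : R, 0 < e ->
  exists2 d : R, 0 < d & forall v, nm v < d -> nm (f (x + v) - f x) <= e.
Proof.
move=> [L [linL [C hC] hL]] e e0; have [d d0 hd] := hL 1 ltr01.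
have C0 : 0 < 1 + `|C| by have := normr_ge0 C; lra.
exists (Num.min d (e / (1 + `|C|))); first by rewrite lt_min d0 divr_gt0.
move=> v; rewrite lt_min => /andP[/hd h1]; rewrite ltr_pdivlMr// => h2.
have := nm_split (f (x + v) - f x) (L v); have := hC v.
have : C * nm v <= `|C| * nm v by rewrite ler_wpM2r ?nm_ge0 ?ler_norm.
lra.
Qed.

End MDiffCalculus.

Section MDiffLinear.
Variables (R : realType) (U V W X : normedModType R[i]).

(* T may be conjugate-linear in a compatible way: only the composite
   derivative has to be linear. *)
Lemma mdiff_comp_additive (T : V -> W) (S : U -> U) (C : R) (f : U -> V) x :
  (forall u v, T (u - v) = T u - T v) -> (forall v, nm (T v) <= C * nm v) ->
  (forall u v, S (u + v) = S u + S v) -> (forall u, nm (S u) = nm u) ->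
  (forall L : U -> V, linear L -> linear (fun v => T (L (S v)))) ->
  mdiff f (S x) -> mdiff (fun w => T (f (S w))) x.
Proof.
move=> TB TC SD Sn lin [L [linL [C' hC'] hL]].
have C0 : 0 < 1 + `|C| by have := normr_ge0 C; lra.
have TC' v : nm (T v) <= (1 + `|C|) * nm v.
  apply: le_trans (TC v) _; rewrite ler_wpM2r ?nm_ge0//.
  by have := ler_norm C; lra.
exists (fun v => T (L (S v))); split; first exact: lin.
- exists ((1 + `|C|) * C') => v; apply: le_trans (TC' _) _.
  by rewrite -mulrA ler_pM2l// -(Sn v).
- move=> e e0; have [d d0 hd] := hL _ (divr_gt0 e0 C0); exists d => // v hv.
  rewrite SD -!TB; apply: le_trans (TC' _) _.
  by rewrite mulrC -ler_pdivlMr// mulrAC -(Sn v); apply: hd; rewrite Sn.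
Qed.

Lemma mdiff_comp_linear (T : V -> W) (C : R) (f : U -> V) x :
  linear T -> (forall v, nm (T v) <= C * nm v) ->
  mdiff f x -> mdiff (fun w => T (f w)) x.
Proof.
move=> linT TC; apply: (@mdiff_comp_additive T id C) => //.
  exact: linear_mapB.
by move=> L linL k u v; rewrite linL linT.
Qed.

Lemma mdiff_bilinear (b : V -> W -> X) (f : U -> V) (g : U -> W) x :
  (forall w, linear (b^~ w)) -> (forall v, linear (b v)) ->
  (forall v w, nm (b v w) <= nm v * nm w) ->
  mdiff f x -> mdiff g x -> mdiff (fun u => b (f u) (g u)) x.
Proof.
move=> bl br bb df dg.
have [L [linL [C hC] hL]] := df; have [M [linM [C' hC'] hM]] := dg.
exists (fun v => b (f x) (M v) + b (L v) (g x)); split.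
- by move=> k u v; rewrite linL linM bl br scalerDr addrACA.
- exists (nm (f x) * C' + C * nm (g x)) => v; apply: le_trans (nm_triangle _ _) _.
  rewrite mulrDl; apply: lerD; apply: le_trans (bb _ _) _.
    by rewrite -mulrA ler_wpM2l ?nm_ge0.
  by rewrite mulrAC ler_wpM2r ?nm_ge0.
move=> e e0.
pose K := 1 + nm (f x) + `|C| + nm (g x).
have K0 : 0 < K.
  by have := nm_ge0 (f x); have := normr_ge0 C; have := nm_ge0 (g x); rewrite /K; lra.
pose e1 := Num.min 1 (e / (4 * K)).
have e10 : 0 < e1 by rewrite lt_min ltr01 divr_gt0// mulr_gt0.
have [d1 d10 h1] := hL _ e10; have [d2 d20 h2] := hM _ e10.
have [d3 d30 h3] := mdiff_cont dg e10.
exists (Num.min d1 (Num.min d2 d3)); first by rewrite !lt_min d10 d20.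
move=> v; rewrite !lt_min => /andP[/h1{}h1 /andP[/h2{}h2 /h3{}h3]].
set f1 := f (x + v) in h1 *; set g1 := g (x + v) in h2 h3 *.
have -> : b f1 g1 - b (f x) (g x) - (b (f x) (M v) + b (L v) (g x)) =
    b (f1 - f x - L v) g1 + b (f x) (g1 - g x - M v) + b (L v) (g1 - g x).
  rewrite !(linear_mapB (bl _)) !(linear_mapB (br _)).
  by rewrite addr_telescope3.
have e11 : e1 <= 1 by rewrite ge_min lexx.
have e1K : 4 * (K * e1) <= e.
  by rewrite mulrA -ler_pdivlMl ?mulr_gt0// mulrC ge_min lexx orbT.
apply: le_trans (nm_triangle _ _) _.
have h4 := nm_triangle (b (f1 - f x - L v) g1) (b (f x) (g1 - g x - M v)).
have h5 := nm_split g1 (g x).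
have hA : nm (b (f1 - f x - L v) g1) <= e1 * nm v * (1 + nm (g x)).
  by apply: le_trans (bb _ _) _; apply: ler_pM; rewrite ?nm_ge0//; lra.
have hB : nm (b (f x) (g1 - g x - M v)) <= nm (f x) * (e1 * nm v).
  by apply: le_trans (bb _ _) _; rewrite ler_wpM2l ?nm_ge0.
have hC2 : nm (b (L v) (g1 - g x)) <= `|C| * nm v * e1.
  apply: le_trans (bb _ _) _; apply: ler_pM; rewrite ?nm_ge0//.
  apply: le_trans (hC v) _; rewrite ler_wpM2r ?nm_ge0//; exact: ler_norm.
have : nm v * (4 * (K * e1)) <= nm v * e by rewrite ler_wpM2l ?nm_ge0.
have h6 : 0 <= nm v * (K * e1).
  by rewrite !mulr_ge0 ?nm_ge0// ltW.
rewrite /K in h6 *; lra.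
Qed.

End MDiffLinear.

Section MDiffScalar.
Variables (R : realType) (U V : normedModType R[i]).

Lemma mdiffZ (phi : U -> R[i]^o) (f : U -> V) x :
  mdiff phi x -> mdiff f x -> mdiff (fun w => phi w *: f w) x.
Proof.
apply: (@mdiff_bilinear _ _ (R[i]^o) V V (fun k v => k *: v)).
- by move=> w k u v; rewrite scalerDl scalerA.
- by move=> k c u v; rewrite scalerDr !scalerA mulrC.
- by move=> k v; rewrite nmZ.
Qed.

Lemma mdiffN (f : U -> V) x : mdiff f x -> mdiff (fun w => - f w) x.
Proof.
apply: (@mdiff_comp_linear _ _ _ _ (fun v => - v) 1).
  by move=> k u v; rewrite opprD scalerN.
by move=> v; rewrite nmN mul1r.
Qed.

Lemma mdiffB (f g : U -> V) x : mdiff f x -> mdiff g x -> mdiff (fun w => f w - g w) x.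
Proof. by move=> hf /mdiffN; exact: mdiffD. Qed.

Lemma mdiff_cdiff_comp (phi : R[i] -> V) (g : U -> R[i]^o) x :
  mdiff g x -> cdiff phi (g x) -> mdiff (fun w => phi (g w)) x.
Proof.
move=> dg [l hl]; have [L [linL [C hC] hL]] := dg.
exists (fun v => L v *: l); split.
- by move=> k u v; rewrite linL scalerDl scalerA.
- exists (C * nm l) => v; rewrite nmZ mulrAC ler_wpM2r ?nm_ge0//; exact: hC.
move=> e e0.
pose K := 1 + `|C| + nm l.
have K0 : 0 < K by have := normr_ge0 C; have := nm_ge0 l; rewrite /K; lra.
pose e1 := Num.min 1 (e / (2 * K)).
have e10 : 0 < e1 by rewrite lt_min ltr01 divr_gt0// mulr_gt0.
have e11 : e1 <= 1 by rewrite ge_min lexx.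
have e1K : 2 * (K * e1) <= e.
  by rewrite mulrA -ler_pdivlMl ?mulr_gt0// mulrC ge_min lexx orbT.
have [d1 d10 h1] := hl _ e10; have [d2 d20 h2] := hL _ e10.
have [d3 d30 h3] := mdiff_cont dg (divr_gt0 d10 (ltr0n _ 2)).
exists (Num.min d2 d3); first by rewrite !lt_min d20.
move=> v; rewrite !lt_min => /andP[/h2{}h2 /h3{}h3].
have hgv : nm (g (x + v) - g x) < d1 by lra.
have {}h1 := h1 (g (x + v)) hgv.
have -> : phi (g (x + v)) - phi (g x) - L v *: l =
  (phi (g (x + v)) - phi (g x) - (g (x + v) - g x) *: l) + (g (x + v) - g x - L v) *: l.
  by rewrite [(_ - L v) *: l]scalerBl addrA subrK.
apply: le_trans (nm_triangle _ _) _; rewrite nmZ.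
have h5 := nm_split (g (x + v) - g x) (L v); have h6 := hC v.
have h7 : C * nm v <= `|C| * nm v by rewrite ler_wpM2r ?nm_ge0 ?ler_norm.
have hA : e1 * nm (g (x + v) - g x) <= e1 * (`|C| * nm v + e1 * nm v).
  by rewrite ler_pM2l//; lra.
have hB : nm (g (x + v) - g x - L v) * nm l <= e1 * nm v * nm l.
  by rewrite ler_wpM2r ?nm_ge0.
have hD : e1 * (e1 * nm v) <= e1 * nm v.
  by rewrite ler_piMl ?mulr_ge0 ?nm_ge0// ltW.
have : nm v * (2 * (K * e1)) <= nm v * e by rewrite ler_wpM2l ?nm_ge0.
have h8 : 0 <= nm v * (K * e1) by rewrite !mulr_ge0 ?nm_ge0// ltW.
rewrite /K in h8 *; lra.
Qed.

End MDiffScalar.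

(** * Weierstrass convergence theorem *)

Section Weierstrass.
Variables (R : realType) (U V : normedModType R[i]).

(** On the complex line [s |-> s *: v] the disc of radius [r / nm v] is available, and [schwarz] is
    read at [s = 1] with a third of that radius: 2 * 3 = 6 and 8 * 3^2 = 72. *)
Lemma mderiv_schwarz (f : U -> V) (L : U -> V) (r M : R) : 0 < r ->
  (forall w, nm w < r -> mdiff f w) -> (forall w, nm w < r -> nm (f w) <= M) ->
  has_mderiv f 0 L -> forall v, nm v <= r / 6 ->
  nm (L v) <= 6 * M / r * nm v /\
  nm (f v - f 0 - L v) <= 72 * M / r ^+ 2 * nm v ^+ 2.
Proof.
move=> r0 df bf hL v hv.
have [v0|v0] := eqVneq v 0.
  have [linL _ _] := hL; have L0 : L 0 = 0.
    by have := linear_mapB linL 0 0; rewrite !subrr.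
  by rewrite v0 L0 !subrr !nm0 expr0n !mulr0.
have nv0 : 0 < nm v := nm_gt0 v0.
pose g (s : R[i]) := f (0 + s *: v).
have hg : has_cderiv g 0 (L v).
  by apply: mderiv_slice; rewrite scale0r addr0.
pose r0' := r / nm v; pose rr := r0' / 3.
have r0'0 : 0 < r0' by rewrite divr_gt0.
have rr0 : 0 < rr by rewrite divr_gt0.
have rr1 : 2 * rr < r0' by rewrite /rr; lra.
have small s : nm s < r0' -> nm (0 + s *: v) < r by rewrite add0r nmZ ltr_pdivlMr.
have dg s : nm s < r0' -> cdiff g s by move=> /small h; apply: mdiff_slice; exact: df.
have bg s : nm s < r0' -> nm (g s) <= M by move=> /small; exact: bf.
have [h1 /(_ 1)] := schwarz rr0 rr1 dg bg hg.
have hone : nm (1 : R[i]) <= rr / 2.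
  have -> : rr / 2 = r / 6 / nm v by rewrite /rr /r0'; field; rewrite gt_eqF.
  by rewrite nm1 ler_pdivlMr// mul1r.
move=> /(_ hone)[_]; rewrite /g scale1r scale0r !add0r scale1r nm1 expr1n mulr1.
move=> h2; split.
  by apply: le_trans h1 _; rewrite le_eqVlt; apply/orP; left; apply/eqP; rewrite /rr /r0'; field; rewrite !gt_eqF.
by apply: le_trans h2 _; rewrite le_eqVlt; apply/orP; left; apply/eqP; rewrite /rr /r0'; field; rewrite !gt_eqF.
Qed.

(** Pointwise convergence suffices because the quadratic remainder is bounded uniformly in [m].
    Comparing increments along a small multiple of [v] shows that the derivatives at 0 are Cauchy in
    each direction, and the estimates pass to the limit. *)
Theorem mdiff_limit (G : nat -> U -> V) (Ginf : U -> V) (r M : R) :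
  nm_complete V -> 0 < r ->
  (forall m w, nm w < r -> mdiff (G m) w) ->
  (forall m w, nm w < r -> nm (G m w) <= M) ->
  (forall w, nm w < r -> seqlim (G^~ w) (Ginf w)) ->
  mdiff Ginf 0.
Proof.
move=> cV r0 dG bG lG.
have M0 : 0 <= M.
  by have := bG 0%N 0; rewrite nm0 => /(_ r0); exact: le_trans (nm_ge0 _).
have d0 m : mdiff (G m) 0 by apply: dG; rewrite nm0.
pose L m : U -> V := sval (cid (d0 m)).
have hL m : has_mderiv (G m) 0 (L m) by rewrite /L; case: cid.
have linL m : linear (L m) by case: (hL m).
have est m v := mderiv_schwarz r0 (dG m) (bG m) (hL m) (v := v).
pose K : R := 72 * M / r ^+ 2.
have K0 : 0 <= K by apply: divr_ge0; [apply: mulr_ge0|exact: sqr_ge0].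
have cL v : nm_cauchy (L^~ v).
  move=> e e0.
  pose D : R := 1 + nm v + 4 * K * nm v ^+ 2.
  have D0 : 1 <= D.
    rewrite /D; have := nm_ge0 v; have := mulr_ge0 (mulr_ge0 (ler0n R 4) K0) (sqr_ge0 (nm v)).
    by lra.
  (* Small enough that [s%:C *: v] stays in the ball of radius [r / 6] and that the two quadratic
     remainders together cost at most [s * e / 2]; the values at [s%:C *: v] and at 0 cost
     [s * e / 4] each. *)
  pose s : R := Num.min (r / 6) e / D.
  have m0 : 0 < Num.min (r / 6) e by rewrite lt_min e0 andbT divr_gt0.
  have s0 : 0 < s by rewrite divr_gt0//; lra.
  have sD : s * D = Num.min (r / 6) e by rewrite /s divfK// gt_eqF//; lra.
  have nsv : nm (s%:C *: v) = s * nm v by rewrite nmZ nmR ger0_norm ?(ltW s0).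
  have m6 : Num.min (r / 6) e <= r / 6 by rewrite ge_min lexx.
  have me : Num.min (r / 6) e <= e by rewrite ge_min lexx orbT.
  have sK : 0 <= s * (4 * K * nm v ^+ 2).
    apply: mulr_ge0; first exact: ltW.
    by apply: mulr_ge0; [apply: mulr_ge0|exact: sqr_ge0].
  have sv6 : nm (s%:C *: v) <= r / 6.
    by rewrite nsv; move: sD; rewrite /D; lra.
  have svr : nm (s%:C *: v) < r by apply: le_lt_trans sv6 _; lra.
  have sv0 : 0 <= s * nm v by rewrite mulr_ge0 ?nm_ge0 ?(ltW s0).
  have sKe : s * (4 * K * nm v ^+ 2) <= e by move: sD; rewrite /D; lra.
  have es0 : 0 < e * s / 4 by rewrite divr_gt0// mulr_gt0.
  have [N1 h1] := seqlim_cauchy (lG _ svr) es0.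
  have r0' : nm (0 : U) < r by rewrite nm0.
  have [N2 h2] := seqlim_cauchy (lG _ r0') es0.
  exists (maxn N1 N2) => m k; rewrite !geq_max => /andP[m1 m2] /andP[k1 k2].
  have {}h1 := h1 _ _ m1 k1; have {}h2 := h2 _ _ m2 k2.
  have [_ em] := est m _ sv6; have [_ ek] := est k _ sv6.
  have : s * nm (L m v - L k v) <= s * e.
    have -> : s * nm (L m v - L k v) = nm (L m (s%:C *: v) - L k (s%:C *: v)).
      by rewrite !(linear_mapZ (linL _)) -scalerBr nmZ nmR ger0_norm ?(ltW s0).
    set w := s%:C *: v in h1 em ek *.
    have -> : L m w - L k w = (G m w - G k w) - (G m 0 - G k 0)
        - ((G m w - G m 0 - L m w) - (G k w - G k 0 - L k w)).
      rewrite !opprD !opprK !addrA.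
      by rewrite [RHS](ACl (7*10*(1*5)*(2*8)*(3*6)*(4*9)))/= subrr addNr addNr subrr !addr0.
    apply: le_trans (nm_triangleB _ _) _.
    have t1 := nm_triangleB (G m w - G k w) (G m 0 - G k 0).
    have t2 := nm_triangleB (G m w - G m 0 - L m w) (G k w - G k 0 - L k w).
    move: em ek; rewrite nsv -/K => em ek.
    have : s * (s * (4 * K * nm v ^+ 2)) <= s * e by rewrite ler_pM2l.
    lra.
  by rewrite ler_pM2l.
pose Li v := sval (cid (cV _ (cL v))).
have lL v : seqlim (L^~ v) (Li v) by rewrite /Li; case: cid.
have linLi : linear Li.
  move=> k u v; apply: seqlim_unique (lL _) _.
  have := seqlimD (seqlimZ k (lL u)) (lL v).
  by move=> h e /h[N hN]; exists N => m /hN; rewrite linL.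
have bL v : nm v <= r / 6 -> nm (Li v) <= 6 * M / r * nm v.
  move=> hv; apply: (@seqlim_le _ _ _ _ 0%N _ (lL v)) => m _.
  by have [] := est m _ hv.
have eL v : nm v <= r / 6 -> nm (Ginf v - Ginf 0 - Li v) <= K * nm v ^+ 2.
  move=> hv; have vr : nm v < r by lra.
  have vr0 : nm (0 : U) < r by rewrite nm0.
  have h := seqlimB (seqlimB (lG _ vr) (lG _ vr0)) (lL v).
  apply: (@seqlim_le _ _ _ _ 0%N _ h) => m _.
  by have [] := est m _ hv.
exists Li; split => //.
  exists (6 * M / r) => v; have [->|v0] := eqVneq v 0.
    by rewrite (_ : Li 0 = 0) ?nm0 ?mulr0//; have := linear_mapB linLi 0 0; rewrite !subrr.
  have nv0 := nm_gt0 v0.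
  pose s := r / 6 / nm v; have s0 : 0 < s by rewrite !divr_gt0.
  have nsv : nm (s%:C *: v) = s * nm v by rewrite nmZ nmR ger0_norm ?(ltW s0).
  have sv : s * nm v = r / 6 by rewrite /s divfK// gt_eqF.
  have := bL (s%:C *: v); rewrite nsv sv lexx => /(_ isT).
  rewrite (linear_mapZ linLi) nmZ nmR (ger0_norm (ltW s0)) -sv.
  by rewrite mulrCA ler_pM2l.
move=> e e0.
have K1 : 0 < 1 + K by lra.
exists (Num.min (r / 6) (e / (1 + K))); first by rewrite lt_min !divr_gt0.
move=> v; rewrite lt_min add0r => /andP[h1 h2].
apply: le_trans (eL _ (ltW h1)) _; rewrite expr2 mulrA ler_wpM2r ?nm_ge0//.
move: h2; rewrite ltr_pdivlMr// => h2.
by have := nm_ge0 v; lra.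
Qed.

End Weierstrass.

(** * C*-algebras *)

Section CStar.
Variables (R : realType) (A : cstarAlgType R).
Implicit Types (a b x y h k : A).

Lemma nm_cmul a b : nm (a ** b) <= nm a * nm b.
Proof. by rewrite -lecR rmorphM /= !nmE cnormM. Qed.

Lemma nm_cstar_mul a : nm (cstar a ** a) = nm a ^+ 2.
Proof. by apply: complexI; rewrite rmorphXn /= !nmE cnorm_cstar. Qed.

Lemma nm_cstar a : nm (cstar a) = nm a.
Proof.
suff H b : nm b <= nm (cstar b).
  by apply/eqP; rewrite eq_le H andbT; have := H (cstar a); rewrite cstarK.
have [->|b0] := eqVneq b 0; first by rewrite nm0 nm_ge0.
have nb0 := nm_gt0 b0; rewrite -(ler_pM2r nb0) -expr2 -nm_cstar_mul.
exact: nm_cmul.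
Qed.

Lemma cmul0r a : (0 : A) ** a = 0.
Proof. by apply: (addrI (0 ** a)); rewrite -cmulDl !addr0. Qed.

Lemma cmulr0 a : a ** (0 : A) = 0.
Proof. by apply: (addrI (a ** 0)); rewrite -cmulDr !addr0. Qed.

Lemma cmulNl a b : (- a) ** b = - (a ** b).
Proof. by rewrite -scaleN1r -cscaleAl scaleN1r. Qed.

Lemma cmulNr a b : a ** (- b) = - (a ** b).
Proof. by rewrite -scaleN1r -cscaleAr scaleN1r. Qed.

Lemma cmulBl a b x : (a - b) ** x = a ** x - b ** x.
Proof. by rewrite cmulDl cmulNl. Qed.

Lemma cmulBr a b x : x ** (a - b) = x ** a - x ** b.
Proof. by rewrite cmulDr cmulNr. Qed.

Lemma cstarB a b : cstar (a - b) = cstar a - cstar b.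
Proof. by rewrite -scaleN1r cstarD cstarZ rmorphN rmorph1 scaleN1r. Qed.

Lemma cstar0 : cstar (0 : A) = 0.
Proof. by have := cstarB 0 0; rewrite !subrr. Qed.

Lemma cmul_linear_l a : linear (fun x => x ** a).
Proof. by move=> k u v; rewrite cmulDl -cscaleAl. Qed.

Lemma cmul_linear_r a : linear (fun x => a ** x).
Proof. by move=> k u v; rewrite cmulDr -cscaleAr. Qed.

Lemma seqlim_cmul (u v : nat -> A) a b : seqlim u a -> seqlim v b ->
  seqlim (fun m => u m ** v m) (a ** b).
Proof.
move=> hu hv e e0.
have K0 : 0 < 1 + nm a + nm b by have := nm_ge0 a; have := nm_ge0 b; lra.
pose e1 := Num.min 1 (e / (1 + nm a + nm b)).
have e10 : 0 < e1 by rewrite lt_min ltr01 divr_gt0.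
have e11 : e1 <= 1 by rewrite ge_min lexx.
have e1K : (1 + nm a + nm b) * e1 <= e.
  by rewrite -ler_pdivlMl// mulrC ge_min lexx orbT.
have [N1 h1] := hu _ e10; have [N2 h2] := hv _ e10.
exists (maxn N1 N2) => m; rewrite geq_max => /andP[/h1{}h1 /h2{}h2].
have -> : u m ** v m - a ** b = (u m - a) ** v m + a ** (v m - b).
  by rewrite cmulBl cmulBr addrA subrK.
apply: le_trans (nm_triangle _ _) _.
have h3 := nm_split (v m) b.
have hA : nm ((u m - a) ** v m) <= e1 * (1 + nm b).
  by apply: le_trans (nm_cmul _ _) _; apply: ler_pM; rewrite ?nm_ge0//; lra.
have hB : nm (a ** (v m - b)) <= nm a * e1.
  by apply: le_trans (nm_cmul _ _) _; rewrite ler_wpM2l ?nm_ge0.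
lra.
Qed.

Lemma seqlim_cstar (u : nat -> A) a : seqlim u a -> seqlim (fun m => cstar (u m)) (cstar a).
Proof.
apply: (@seqlim_bounded_linear _ _ _ _ 1); first exact: cstarB.
by move=> v; rewrite nm_cstar mul1r.
Qed.

(* If x and y commute, are self-adjoint and x^2 + (1 - y)^2 = 1 in the
   unitization, then x + i (1 - y) is unitary, so its action on A by left
   multiplication is isometric, and x is half its sum with its adjoint. *)
Lemma commuting_square_contraction x y : cstar x = x -> cstar y = y ->
  x ** y = y ** x -> x ** x + y ** y = y + y -> nm x <= 1.
Proof.
move=> sx sy xy sq.
have iso (c : R[i]) a : c = 'i \/ c = - 'i -> nm (x ** a + c *: (a - y ** a)) = nm a.
  move=> hc.
  have cc : conjc c = - c.
    by case: hc => ->; apply/eqP; rewrite eq_complex /= ?oppr0 ?opprK !eqxx.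
  have c2 : - c * c = 1.
    by case: hc => ->; apply/eqP; rewrite eq_complex /=; apply/andP; split; apply/eqP; ring.
  suff E : cstar (x ** a + c *: (a - y ** a)) ** (x ** a + c *: (a - y ** a)) = cstar a ** a.
    apply/eqP; rewrite -(eqrXn2 (_ : 0 < 2)%N) ?nm_ge0//.
    by rewrite -!nm_cstar_mul E.
  set d := a - y ** a; set p := x ** a.
  have sp : cstar p = cstar a ** x by rewrite /p cstarM sx.
  have sd : cstar d = cstar a - cstar a ** y by rewrite /d cstarB cstarM sy.
  rewrite cstarD cstarZ cc cmulDl !cmulDr -!cscaleAl -!cscaleAr.
  rewrite [(- c) *: (c *: _)]scalerA c2 scale1r.
  have -> : cstar d ** p = cstar p ** d.
    by rewrite sp sd /d /p cmulBl cmulBr !cmulA -(cmulA _ x y) xy !cmulA.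
  rewrite scaleNr addrA addrK sp sd /d /p.
  have H : cstar a ** x ** (x ** a) = cstar a ** (y ** a) + cstar a ** (y ** a)
      - cstar a ** y ** (y ** a).
    apply/eqP; rewrite eq_sym subr_eq eq_sym; apply/eqP.
    have := congr1 (fun z => cstar a ** z ** a) sq.
    by rewrite !cmulDr !cmulDl !cmulA.
  rewrite H cmulBl !cmulBr !cmulA !opprB !addrA.
  by rewrite [LHS](ACl (4*(1*5)*(2*7)*(3*6)))/= !subrr !addNr !addr0.
have xa a : nm (x ** a) <= nm a.
  have E : 2%:R *: (x ** a) = (x ** a + 'i *: (a - y ** a)) + (x ** a + (- 'i) *: (a - y ** a)).
    by rewrite scaleNr addrACA subrr addr0 scaler_nat mulr2n.
  have := nm_triangle (x ** a + 'i *: (a - y ** a)) (x ** a + (- 'i) *: (a - y ** a)).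
  rewrite -E nmZ (iso 'i a (or_introl erefl)) (iso (- 'i) a (or_intror erefl)).
  have -> : nm (2%:R : R[i]) = 2 by rewrite -[2%:R]invrK nmV nm2V invrK.
  lra.
have [->|x0] := eqVneq x 0; first by rewrite nm0 ler01.
have := xa x; rewrite -{1}sx nm_cstar_mul expr2 -[leRHS]mulr1 ler_pM2l//.
exact: nm_gt0.
Qed.

(** The element is 1 - sqrt(1 - h^2), the fixed point of [v |-> (h^2 + v^2) / 2]. On the ball of
    radius [r = nm h ^+ 2] this map preserves the ball and successive iterates approach by the ratio
    [r]. The iterates are polynomials in h^2 without constant term, so no unit is involved and they
    commute with [h]. *)
Lemma exists_quasi_sqrt h : cstar h = h -> nm h < 1 -> exists k,
  [/\ cstar k = k, h ** k = k ** h & h ** h + k ** k = k + k].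
Proof.
move=> sh h1; set q := h ** h; pose r := nm h ^+ 2.
have r0 : 0 <= r by exact: sqr_ge0.
have r1 : r < 1 by rewrite expr_lt1 ?nm_ge0.
have nq : nm q = r by rewrite /q -{1}sh nm_cstar_mul.
pose half (v : A) : A := 2^-1 *: v.
have nhalf v : nm (half v) = nm v / 2 by rewrite nmZ nm2V mulrC.
pose k n : A := iter n (fun v => half (q + v ** v)) 0.
have kS n : k n.+1 = half (q + k n ** k n) by [].
have nk n : nm (k n) <= r.
  elim: n => [|n ih]; first by rewrite nm0.
  rewrite kS nhalf; have := nm_triangle q (k n ** k n); rewrite nq.
  have : nm (k n ** k n) <= r * 1.
    by apply: le_trans (nm_cmul _ _) _; apply: ler_pM; rewrite ?nm_ge0//; lra.
  lra.
have sk n : cstar (k n) = k n.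
  elim: n => [|n ih]; first exact: cstar0.
  rewrite kS /half cstarZ cstarD !cstarM ih sh; congr (_ *: _).
  by rewrite fmorphV rmorphMn rmorph1.
have ck n : h ** k n = k n ** h.
  elim: n => [|n ih]; first by rewrite cmulr0 cmul0r.
  rewrite kS /half -cscaleAr -cscaleAl cmulDr cmulDl; congr (_ *: (_ + _)).
    by rewrite cmulA.
  by rewrite cmulA ih -cmulA ih cmulA.
(* The cancelling factor [(1 - r) / (1 - r)] makes these bounds telescope in [tail]. *)
have dk n : nm (k n.+1 - k n) <= r ^+ n * (1 - r) / (1 - r).
  rewrite mulfK; last by rewrite subr_eq0 gt_eqF.
  elim: n => [|n ih]; first by rewrite subr0 expr0; apply: le_trans (nk 1%N) _; exact: ltW.
  have -> : k n.+2 - k n.+1 = half (k n.+1 ** (k n.+1 - k n) + (k n.+1 - k n) ** k n).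
    rewrite [k n.+2]kS {2}[k n.+1]kS /half -scalerBr; congr (_ *: _).
    by rewrite cmulBr cmulBl addrA subrK opprD addrACA subrr add0r.
  rewrite nhalf; have h2 := nk n.+1; have h3 := nk n.
  set d := k n.+1 - k n in ih *.
  have h4 : nm (k n.+1 ** d) <= r * r ^+ n.
    by apply: le_trans (nm_cmul _ _) _; apply: ler_pM; rewrite ?nm_ge0.
  have h5 : nm (d ** k n) <= r ^+ n * r.
    by apply: le_trans (nm_cmul _ _) _; apply: ler_pM; rewrite ?nm_ge0.
  have := nm_triangle (k n.+1 ** d) (d ** k n).
  by rewrite exprS; lra.
have tail n j : nm (k (n + j)%N - k n) <= (r ^+ n - r ^+ (n + j)) / (1 - r).
  elim: j => [|j ih]; first by rewrite addn0 !subrr nm0 mul0r.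
  apply: le_trans (nm_dist (k (n + j)%N) _ _) _.
  have := dk (n + j)%N; rewrite -addnS => h2.
  have -> : (r ^+ n - r ^+ (n + j.+1)) / (1 - r) =
     r ^+ (n + j) * (1 - r) / (1 - r) + (r ^+ n - r ^+ (n + j)) / (1 - r).
    by rewrite addnS exprS -mulrDl; congr (_ / _); ring.
  exact: lerD.
have cauchy_k : nm_cauchy k.
  move=> e e0; have e2 : 0 < e / 2 * (1 - r) by rewrite mulr_gt0 ?divr_gt0// subr_gt0.
  have nr : `|r| < 1 by rewrite ger0_norm.
  have /cvgrPdist_lt /(_ _ e2) [N _ hN] := cvg_expr nr.
  have hk m : (N <= m)%N -> nm (k m - k N) <= e / 2.
    move=> Nm; have := tail N (m - N)%N; rewrite subnKC// => h2; apply: le_trans h2 _.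
    rewrite ler_pdivrMr ?subr_gt0//.
    have := hN N (leqnn N); rewrite /= sub0r normrN ger0_norm ?exprn_ge0 ?nm_ge0//.
    by have := exprn_ge0 m r0; lra.
  exists N => m l /hk hm /hk hl.
  by have := nm_dist (k N) (k m) (k l); rewrite (nmB (k N) (k l)); lra.
have [kk hkk] := completeNormedMod_nm_complete cauchy_k.
exists kk; split.
- apply: seqlim_unique (seqlim_cstar hkk) _.
  by move=> e /hkk[N hN]; exists N => m /hN; rewrite sk.
- apply: seqlim_unique (seqlim_cmul (seqlim_cst h) hkk) _.
  move=> e e0; have [N hN] := seqlim_cmul hkk (seqlim_cst h) e0.
  by exists N => m /hN; rewrite ck.
- have hS : seqlim (fun m => k m.+1) kk.
    by move=> e /hkk[N hN]; exists N => m Nm; apply: hN; exact: leqW.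
  apply: seqlim_unique (seqlimD (seqlim_cst q) (seqlim_cmul hkk hkk)) _.
  move=> e e0; have [N hN] := seqlimD hS hS e0.
  exists N => m /hN.
  have -> : k m.+1 + k m.+1 = q + k m ** k m; last by [].
  rewrite kS /half -scalerDl.
  by rewrite -[2^-1]div1r -splitr scale1r.
Qed.

Definition star_morphism (f : A -> A) :=
  [/\ linear f, {morph f : a b / a ** b} & {morph f : a / cstar a}].

(** The relation [h ** h + k ** k = k + k] mentions no unit, so [f] transports it and
    [commuting_square_contraction] applies to [f h]. Rescaling treats every self-adjoint element,
    and the C*-identity for [cstar a ** a] treats the rest. *)
Lemma star_morphism_contraction f : star_morphism f -> forall a, nm (f a) <= nm a.
Proof.
move=> [linf fM fS].
have sa1 h : cstar h = h -> nm h < 1 -> nm (f h) <= 1.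
  move=> sh /(exists_quasi_sqrt sh)[k [sk hk hh]].
  apply: (@commuting_square_contraction _ (f k)); rewrite -?fS ?sh ?sk -?fM ?hk//.
  by rewrite -!(linear_mapD linf) hh.
have sa h : cstar h = h -> nm (f h) <= nm h.
  move=> sh; apply/ler_addgt0Pr => e e0.
  have n0 : 0 < nm h + e by have := nm_ge0 h; lra.
  have nc : nm ((nm h + e)^-1%:C : R[i]) = (nm h + e)^-1.
    by rewrite nmR ger0_norm// invr_ge0 ltW.
  have := sa1 ((nm h + e)^-1%:C *: h); rewrite cstarZ sh.
  have -> : conjc (nm h + e)^-1%:C = (nm h + e)^-1%:C :> R[i].
    by apply/eqP; rewrite eq_complex /= oppr0 !eqxx.
  rewrite (linear_mapZ linf) !nmZ nc mulrC ltr_pdivrMr// mul1r ltrDl => /(_ erefl e0).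
  by rewrite mulrC ler_pdivrMr// mul1r.
move=> a; have := sa (cstar a ** a); rewrite cstarM cstarK => /(_ erefl).
by rewrite fM fS !nm_cstar_mul ler_sqr ?nnegrE ?nm_ge0.
Qed.

End CStar.

(** * Polystrips and states *)

Section RowVectors.
Variables (R : realType) (n : nat).
Implicit Types (w z : 'rV[CC R]_n) (x y : 'rV[R]_n).

(** The ball of a row vector is the product of the coordinate balls. The conjunct [0 < d] carries
    the content when [n = 0]. *)
Lemma nm_row_lt w (d : R) : nm w < d <-> 0 < d /\ forall k, nm (w 0 k) < d.
Proof.
have E : nm w < d <-> ball (0 : 'rV[CC R]_n) d%:C w.
  by rewrite -ball_normE /= sub0r normrN lt_nm.
split.
  move=> h; split; first exact: le_lt_trans (nm_ge0 w) h.
  move=> k; have /E[_ /(_ 0 k)] := h.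
  by rewrite mxE -ball_normE /= sub0r normrN lt_nm.
move=> [d0 h]; apply/E; split; first by rewrite ltcR.
by move=> i j; rewrite (ord1 i) mxE -ball_normE /= sub0r normrN lt_nm.
Qed.

Lemma nm_coord w k : nm (w 0 k) <= nm w.
Proof.
apply/ler_addgt0Pr => e e0.
have /nm_row_lt[_ h] : nm w < nm w + e by lra.
exact: ltW.
Qed.

Lemma nm_row_le w (d : R) : 0 <= d -> (forall k, nm (w 0 k) <= d) -> nm w <= d.
Proof.
move=> d0 h; apply/ler_addgt0Pr => e e0; apply/ltW/nm_row_lt; split; first lra.
by move=> k; have := h k; lra.
Qed.

Lemma mdiff_coord k z : mdiff (fun w : 'rV[CC R]_n => w 0 k : R[i]^o) z.
Proof.
exists (fun w => w 0 k); split; first by move=> c u v; rewrite !mxE.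
  by exists 1 => v; rewrite mul1r nm_coord.
move=> e e0; exists 1 => // v _.
by rewrite mxE (addrC (z 0 k)) addrK subrr nm0 mulr_ge0 ?nm_ge0// ltW.
Qed.

Definition re_vec z : 'rV[R]_n := \row_k Re (z 0 k).
Definition im_vec z : 'rV[R]_n := \row_k Im (z 0 k).

Lemma cvec_re_im z : cvec (re_vec z) (im_vec z) = z.
Proof. by apply/rowP => k; rewrite !mxE; case: (z 0 k). Qed.

Lemma cvecD x y x' y' : cvec x y + cvec x' y' = cvec (x + x') (y + y').
Proof. by apply/rowP => k; rewrite !mxE. Qed.

Lemma cvecZ (s : R[i]) x : s *: cvec x 0 = cvec (Re s *: x) (Im s *: x).
Proof.
apply/rowP => k; rewrite !mxE; case: s => a b /=.
by apply/eqP; rewrite eq_complex /= !mulr0 subr0 add0r !eqxx.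
Qed.

Definition conj_vec z : 'rV[CC R]_n := \row_k conjc (z 0 k).

Lemma nm_conjc (c : R[i]) : nm (conjc c) = nm c.
Proof. by rewrite /nm !normc_def; case: c => a b /=; rewrite sqrrN. Qed.

Lemma nm_conj_vec z : nm (conj_vec z) = nm z.
Proof.
suff H w : nm (conj_vec w) <= nm w.
  apply/eqP; rewrite eq_le H /=.
  have {1}-> : z = conj_vec (conj_vec z); last exact: H.
  by apply/rowP => k; rewrite !mxE conjcK.
by apply: nm_row_le => [|k]; rewrite ?nm_ge0// mxE nm_conjc nm_coord.
Qed.

Lemma nm_cvec_re x y (M : R) : 0 <= M -> (forall k, `|x 0 k| <= M) -> (forall k, `|y 0 k| <= M) ->
  nm (cvec x y) <= 2 * M.
Proof.
move=> M0 hx hy; apply: nm_row_le; first lra.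
move=> k; rewrite mxE; apply: le_trans (nm_le_ReIm _) _ => /=.
by have := hx k; have := hy k; lra.
Qed.

Lemma cdiff_slice (V : normedModType R[i]) (f : 'rV[CC R]_n -> V) a v (s0 : R[i]) :
  differentiable f (a + s0 *: v) -> cdiff (fun s => f (a + s *: v)) s0.
Proof. by move=> /differentiable_mdiff; exact: mdiff_slice. Qed.

(** On the complex line [s |-> x + s y] with [x] and [y] real, real [s] gives real points and
    [s = 'i] gives the point [x + i y]. *)
Theorem entire_vanishing_real (V : normedModType R[i]) (f : 'rV[CC R]_n -> V) :
  (forall z, differentiable f z) -> (forall x, f (cvec x 0) = 0) -> forall z, f z = 0.
Proof.
move=> df f0 z.
have := @entire_vanishing _ _ (fun s => f (cvec (re_vec z) 0 + s *: cvec (im_vec z) 0)).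
move=> /(_ _ _ 'i) h.
rewrite -(cvec_re_im z); have -> : cvec (re_vec z) (im_vec z) =
    cvec (re_vec z) 0 + 'i *: cvec (im_vec z) 0.
  by rewrite cvecZ /= scale0r scale1r cvecD addr0 add0r.
apply: h; first by move=> s; apply: cdiff_slice; exact: df.
by move=> x; rewrite cvecZ /= scale0r cvecD addr0 f0.
Qed.

(* Phragmen-Lindelof in one coordinate at a time, moving the remaining
   coordinates to the boundary of the polystrip. *)
Theorem polystrip_phragmen_lindelof (V : normedModType R[i]) (f : 'rV[CC R]_n -> V)
    (beta : 'rV[R]_n) (M K : R) :
  (forall z, differentiable f z) ->
  (forall z, polystrip beta z -> nm (f z) <= M) ->
  (forall gamma t, corners beta gamma -> nm (f (cvec t gamma)) <= K) ->
  forall z, polystrip beta z -> nm (f z) <= K.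
Proof.
move=> df bf cf.
suff H j z : polystrip beta z ->
    (forall k : 'I_n, (j <= k)%N -> Im (z 0 k) = 0 \/ Im (z 0 k) = beta 0 k) ->
    nm (f z) <= K.
  by move=> z hz; apply: (H n) => // k; rewrite leqNgt ltn_ord.
elim: j z => [|j ih] z hz hk.
  rewrite -(cvec_re_im z); apply: cf.
  exists (fun k => Im (z 0 k) != 0) => k; rewrite mxE.
  by case: eqVneq => [->|/eqP h]//; have [] := hk k isT.
have [jn|nj] := ltnP j n; last first.
  by apply: ih => // k jk; have := leq_ltn_trans (leq_trans nj jk) (ltn_ord k); rewrite ltnn.
pose k := Ordinal jn.
pose v : 'rV[CC R]_n := \row_l (if l == k then 1 else 0).
pose a : 'rV[CC R]_n := \row_l (if l == k then 0 else z 0 l).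
have ak s l : (a + s *: v) 0 l = if l == k then s else z 0 l.
  by rewrite !mxE; case: eqP => _; rewrite ?mulr1 ?mulr0 ?add0r ?addr0.
have E : z = a + z 0 k *: v.
  by apply/rowP => l; rewrite ak; case: eqP => [->|].
pose g (s : R[i]) := f (a + s *: v).
rewrite E -/(g _).
have hs s : 0 <= Im s <= beta 0 k -> polystrip beta (a + s *: v).
  by move=> hs l; rewrite ak; case: eqP => [->|_]; [|exact: hz].
have dg s : cdiff g s by apply: cdiff_slice; exact: df.
apply: (@phragmen_lindelof _ _ g (beta 0 k) M K); last exact: hz.
- by move=> w _; exact: ccont_cdiff.
- by [].
- by move=> w /hs; exact: bf.
- move=> w hw hb; apply: ih; first exact: hs.
  move=> l jl; rewrite ak; case: eqP => [->//|/eqP lk]; apply: hk.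
  rewrite ltn_neqAle jl andbT; apply: contraNneq lk => jl'.
  by apply/eqP/val_inj.
Qed.

End RowVectors.

Section State.
Variables (R : realType) (A : cstarAlgType R) (tau : {scalar A}).

Lemma state_bound : is_state tau -> forall a, nm (tau a) <= nm a.
Proof.
move=> [_ h1].
set E := [set Re `|tau a| | a in [set a : A | `|a| <= 1]].
have supE : has_sup E.
  apply: contrapT => /sup_out supE0; move: h1; rewrite /functional_norm -/E supE0 => /eqP.
  by rewrite eq_sym oner_eq0.
have H a : nm a <= 1 -> nm (tau a) <= 1.
  move=> ha; rewrite -[leRHS]h1; apply: sup_upper_bound => //.
  by exists a => //=; rewrite -nmE -(rmorph1 (real_complex R)) lecR.
move=> a; have [->|a0] := eqVneq a 0; first by rewrite linear0 !nm0.
have na := nm_gt0 a0.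
have nc : nm ((nm a)^-1%:C : R[i]) = (nm a)^-1.
  by rewrite nmR ger0_norm// invr_ge0 ltW.
have := H ((nm a)^-1%:C *: a); rewrite nmZ nc mulVf ?gt_eqF// lexx => /(_ isT).
by rewrite linearZ /= nmM nc mulrC ler_pdivrMr// mul1r.
Qed.

End State.

(** * Analytic elements *)

Section Dynamics.
Variables (R : realType) (A : cstarAlgType R) (n : nat).
Variable sigma : 'rV[R]_n -> A -> A.
Hypothesis dyn : cstar_dynamical_system sigma.
Implicit Types (a b : A) (s t : 'rV[R]_n) (z w : 'rV[CC R]_n) (f g : 'rV[CC R]_n -> A).

Lemma sigma_star_morphism t : star_morphism (sigma t).
Proof. by case: dyn => /(_ t)[]. Qed.

Lemma sigma_linear t : linear (sigma t).
Proof. by case: (sigma_star_morphism t). Qed.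

Lemma sigma0 a : sigma 0 a = a.
Proof. by case: dyn. Qed.

Lemma sigmaD s t a : sigma (s + t) a = sigma s (sigma t a).
Proof. by case: dyn. Qed.

Lemma nm_sigma t a : nm (sigma t a) = nm a.
Proof.
have le u b : nm (sigma u b) <= nm b.
  exact/star_morphism_contraction/sigma_star_morphism.
apply/eqP; rewrite eq_le le /=.
by have := le (- t) (sigma t a); rewrite -sigmaD addNr sigma0.
Qed.

Lemma sigma_continuous a s (e : R) : 0 < e -> exists2 d : R, 0 < d &
  forall t, (forall k, `|t 0 k - s 0 k| < d) -> nm (sigma t a - sigma s a) <= e.
Proof.
move=> e0; case: dyn => _ _ _ /(_ a s) /cvgrPdist_le /(_ e%:C).
rewrite ltcR => /(_ e0) /nbhs_ballP[d /= d0 hd]; exists d => // t ht.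
rewrite nmB -lecR nmE; apply: hd; split=> // i j; rewrite (ord1 i).
by rewrite -ball_normE /= distrC.
Qed.

Lemma analytic_extension_unique a f g :
  analytic_extension sigma a f -> analytic_extension sigma a g -> f = g.
Proof.
move=> [ef hf] [eg hg]; apply/funext => z; apply/subr0_eq.
apply: (@entire_vanishing_real _ _ _ (fun z => f z - g z)) => [w|x].
  by apply/mdiff_differentiable/mdiffB; apply: differentiable_mdiff.
by rewrite hf hg subrr.
Qed.

Lemma sigma_ext_eq a f z : analytic_extension sigma a f -> sigma_ext sigma z a = f z.
Proof.
move=> hf; rewrite /sigma_ext (@xget_unique _ _ _ f) //= => g hg.
exact: analytic_extension_unique hg hf.
Qed.

Lemma sigma_extP a : analytic_elements sigma a ->
  analytic_extension sigma a (sigma_ext sigma ^~ a).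
Proof.
move=> [f hf]; have -> : sigma_ext sigma ^~ a = f; last by [].
by apply/funext => z; exact: sigma_ext_eq.
Qed.

Lemma analytic_extension_linear k a b f g :
  analytic_extension sigma a f -> analytic_extension sigma b g ->
  analytic_extension sigma (k *: a + b) (fun z => k *: f z + g z).
Proof.
move=> [ef hf] [eg hg]; split => [z|t]; last by rewrite hf hg sigma_linear.
apply: mdiff_differentiable; apply: mdiffD; last exact: differentiable_mdiff.
by apply: mdiffZ; [exact: mdiff_cst|exact: differentiable_mdiff].
Qed.

Lemma analytic_extensionM a b f g :
  analytic_extension sigma a f -> analytic_extension sigma b g ->
  analytic_extension sigma (a ** b) (fun z => f z ** g z).
Proof.
move=> [ef hf] [eg hg]; split => [z|t]; last first.
  by rewrite hf hg; case: (sigma_star_morphism t).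
apply: mdiff_differentiable; apply: (@mdiff_bilinear _ _ _ _ _ (fun x y => x ** y)).
- exact: cmul_linear_l.
- exact: cmul_linear_r.
- exact: nm_cmul.
- exact: differentiable_mdiff.
- exact: differentiable_mdiff.
Qed.

Lemma analytic_extension_star a f :
  analytic_extension sigma a f ->
  analytic_extension sigma (cstar a) (fun z => cstar (f (conj_vec z))).
Proof.
move=> [ef hf]; split => [z|t]; last first.
  have -> : conj_vec (cvec t 0) = cvec t 0.
    by apply/rowP => k; rewrite !mxE /= oppr0.
  by rewrite hf; case: (sigma_star_morphism t).
apply: mdiff_differentiable.
apply: (@mdiff_comp_additive _ _ _ _ (@cstar R A) (@conj_vec R n) 1).
- exact: cstarB.
- by move=> v; rewrite nm_cstar mul1r.
- by move=> u v; apply/rowP => k; rewrite !mxE rmorphD.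
- exact: nm_conj_vec.
- move=> L linL k u v.
  have -> : conj_vec (k *: u + v) = conjc k *: conj_vec u + conj_vec v.
    by apply/rowP => l; rewrite !mxE rmorphD rmorphM.
  by rewrite linL cstarD cstarZ conjcK.
- exact: differentiable_mdiff.
Qed.

Lemma analytic_extension_shift a f s :
  analytic_extension sigma a f ->
  analytic_extension sigma (sigma s a) (fun z => f (cvec s 0 + z)).
Proof.
move=> [ef hf]; split => [z|t].
  by apply: mdiff_differentiable; apply/mdiff_shift; exact: differentiable_mdiff.
by rewrite cvecD addr0 hf addrC sigmaD.
Qed.

(** Together with [analytic_extension_shift] this gives two extensions for [sigma s a]; their
    uniqueness is the group law between a real and a complex time. *)
Lemma analytic_extension_sigma a f s :
  analytic_extension sigma a f ->
  analytic_extension sigma (sigma s a) (fun z => sigma s (f z)).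
Proof.
move=> [ef hf]; split => [z|t]; last by rewrite hf -!sigmaD addrC.
apply: mdiff_differentiable; apply: (@mdiff_comp_linear _ _ _ _ (sigma s) 1).
- exact: sigma_linear.
- by move=> v; rewrite nm_sigma mul1r.
- exact: differentiable_mdiff.
Qed.

Lemma sigma_ext_shift a s z : analytic_elements sigma a ->
  sigma_ext sigma (cvec s 0 + z) a = sigma_ext sigma z (sigma s a).
Proof. by move=> /sigma_extP/(analytic_extension_shift s)/sigma_ext_eq <-. Qed.

Lemma sigma_ext_sigma a s z : analytic_elements sigma a ->
  sigma_ext sigma (cvec s 0 + z) a = sigma s (sigma_ext sigma z a).
Proof.
move=> ha; rewrite sigma_ext_shift//.
by have /(analytic_extension_sigma s)/sigma_ext_eq -> := sigma_extP ha.
Qed.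

Lemma sigma_ext_real a t : analytic_elements sigma a ->
  sigma_ext sigma (cvec t 0) a = sigma t a.
Proof. by move=> /sigma_extP[_ ->]. Qed.

Lemma sigma_extB a b z : analytic_elements sigma a -> analytic_elements sigma b ->
  sigma_ext sigma z (a - b) = sigma_ext sigma z a - sigma_ext sigma z b.
Proof.
move=> /sigma_extP ha /sigma_extP hb.
have := sigma_ext_eq z (analytic_extension_linear (-1) hb ha).
by rewrite scaleN1r addrC => ->; rewrite scaleN1r addrC.
Qed.

Lemma analytic_star_subalgebra : star_subalgebra (analytic_elements sigma).
Proof.
split.
- exists (fun=> 0); split=> [z|t]; first exact: mdiff_differentiable (mdiff_cst _ _).
  by have := linear_mapB (sigma_linear t) 0 0; rewrite !subrr.
- by move=> k a b [f hf] [g hg]; eexists; exact: analytic_extension_linear hf hg.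
- by move=> a b [f hf] [g hg]; eexists; exact: analytic_extensionM hf hg.
- by move=> a [f hf]; eexists; exact: analytic_extension_star hf.
Qed.

Lemma analytic_invariant : action_invariant sigma (analytic_elements sigma).
Proof. by move=> t a [f hf]; eexists; exact: analytic_extension_sigma hf. Qed.

(** Real translations act isometrically, so only the imaginary part matters, and it ranges over a
    compact box. *)
Lemma sigma_ext_bounded (beta : 'rV[R]_n) a : (forall k, 0 <= beta 0 k) -> analytic_elements sigma a ->
  exists M : R, forall z, polystrip beta z -> nm (sigma_ext sigma z a) <= M.
Proof.
move=> b0 ha; have [ef _] := sigma_extP ha.
pose f z := sigma_ext sigma z a.
pose B : set 'rV[R]_n := [set y | forall k, `[0, beta 0 k]%classic (y ord0 k)].
have cB : compact B.
  apply: (@rV_compact R n (fun k => `[0, beta 0 k]%classic)) => k.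
  exact: segment_compact.
have B0 : B !=set0.
  by exists beta => k /=; rewrite in_itv /= lexx andbT.
have cf : {within B, continuous (fun y : 'rV[R]_n => nm (f (cvec 0 y)))}.
  suff : continuous (fun y : 'rV[R]_n => nm (f (cvec 0 y))).
    exact: continuous_subspaceT.
  move=> y; apply/(@cvgrPdist_le _ _ _ (nbhs y)) => e e0.
  have [d d0 hd] := mdiff_cont (differentiable_mdiff (ef (cvec 0 y))) e0.
  apply/nbhs_ballP; exists (d / 4) => /=; first by rewrite divr_gt0.
  move=> y' [_ hy]; pose v := cvec 0 (y' - y).
  have hv : nm v < d.
    apply: (@le_lt_trans _ _ (2 * (d / 4))); last lra.
    apply: nm_cvec_re; first lra; first by move=> k; rewrite mxE normr0; lra.
    move=> k; rewrite !mxE distrC; apply: ltW.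
    by have := hy 0 k; rewrite -ball_normE.
  have := hd v hv; rewrite cvecD add0r (addrC y) subrK => h.
  have := nm_split (f (cvec 0 y)) (f (cvec 0 y')); rewrite nmB.
  have := nm_split (f (cvec 0 y')) (f (cvec 0 y)).
  by rewrite /f ler_norml; lra.
have [c _ hc] := compact_EVT_max B0 cB cf.
exists (nm (f (cvec 0 c))) => z hz.
have -> : z = cvec (re_vec z) 0 + cvec 0 (im_vec z).
  by rewrite cvecD addr0 add0r cvec_re_im.
rewrite sigma_ext_sigma// nm_sigma; apply: hc; rewrite inE => k /=.
by rewrite in_itv /= mxE; exact: hz.
Qed.

End Dynamics.

(** * From the boundary condition to KMS *)

Section Density.
Variables (R : realType) (V : normedModType R[i]).

Lemma dense_nm (B : set V) :
  dense B <-> forall a (e : R), 0 < e -> exists2 b, B b & nm (b - a) < e.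
Proof.
split=> [dB a e e0|h O [a Oa] oO].
  have nb : nbhs a [set b | nm (b - a) < e] by apply/nbhs_nm; exists e.
  have [b [/interior_subset hb Bb]] := dB _ (ex_intro _ a nb) (@open_interior _ _).
  by exists b.
have /nbhs_nm[e e0 he] : nbhs a O by exact: open_nbhs_nbhs.
by have [b Bb /he Ob] := h a e e0; exists b.
Qed.

End Density.

Section FreePart.
Variables (R : realType) (n : nat).
Implicit Types (z w : 'rV[CC R]_n) (beta : 'rV[R]_n).

Lemma mdiff_precomp (U W V : normedModType R[i]) (f : W -> V) (S : U -> W) x :
  linear S -> (forall u, nm (S u) <= nm u) -> mdiff f (S x) -> mdiff (fun u => f (S u)) x.
Proof.
move=> linS Sn [L [linL [C hC] hL]]; exists (fun u => L (S u)); split.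
- by move=> k u v; rewrite linS linL.
- exists `|C| => v; apply: le_trans (hC _) _.
  apply: (@le_trans _ _ (`|C| * nm (S v))); last by rewrite ler_wpM2l.
  by rewrite ler_wpM2r ?nm_ge0 ?ler_norm.
- move=> e e0; have [d d0 hd] := hL e e0; exists d => // v hv.
  rewrite (linear_mapD linS); apply: le_trans (hd _ (le_lt_trans (Sn v) hv)) _.
  by rewrite ler_wpM2l// ltW.
Qed.

Lemma free_part_linear beta : linear (@free_part R n beta).
Proof.
move=> k u v; apply/rowP => l; rewrite !mxE.
by case: ifP => _ //; rewrite mulr0 addr0.
Qed.

Lemma nm_free_part beta w : nm (free_part beta w) <= nm w.
Proof.
apply: nm_row_le => [|k]; first exact: nm_ge0.
by rewrite mxE; case: ifP => _; rewrite ?nm0 ?nm_ge0 ?nm_coord.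
Qed.

Lemma uniform_positive (g : 'I_n -> R) : (forall k, 0 < g k) ->
  exists2 r, 0 < r & forall k, r <= g k.
Proof.
move=> g0; pose S := 1 + \sum_k (g k)^-1.
have S1 : 1 <= S by rewrite /S lerDl sumr_ge0// => k _; rewrite invr_ge0 ltW.
exists S^-1; first by rewrite invr_gt0; lra.
move=> k; rewrite -[leRHS]invrK lef_pV2 ?posrE ?invr_gt0//; last lra.
rewrite /S (bigD1 k) //= addrCA lerDl addr_ge0// sumr_ge0// => j _.
by rewrite invr_ge0 ltW.
Qed.

Lemma polystrip_interior_ball beta z : (forall k, 0 <= beta 0 k) -> polystrip_interior beta z ->
  exists2 r : R, 0 < r & forall w, nm w < r -> polystrip beta (z + free_part beta w).
Proof.
move=> b0 hz.
pose g k := if beta 0 k == 0 then 1 else Num.min (Im (z 0 k)) (beta 0 k - Im (z 0 k)).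
have [|r r0 hr] := @uniform_positive g.
  move=> k; rewrite /g; have := hz k; case: eqP => // _ /andP[h1 h2].
  by rewrite lt_min h1 subr_gt0.
exists r => // w hw k; rewrite !mxE.
have := hz k; have := hr k; rewrite /g; case: eqP => [-> _ h|_].
  by rewrite addr0 h lexx.
rewrite le_min => /andP[h1 h2] h3.
have := Im_le_nm (w 0 k); have := nm_coord w k; rewrite raddfD /= => h4 h5.
have : `|Im (w 0 k)| < r by lra.
by rewrite ltr_norml => /andP[h6 h7]; lra.
Qed.

Lemma corner_polystrip beta gamma t : (forall k, 0 <= beta 0 k) -> corners beta gamma ->
  polystrip beta (cvec t gamma).
Proof.
move=> b0 [e he] k; rewrite mxE /= he; case: (e k); rewrite ?lexx ?b0//.
Qed.

End FreePart.

Lemma null_sequence (R : realType) : exists dl : nat -> R,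
  [/\ forall m, 0 < dl m <= 1, forall m l, (m <= l)%N -> dl l <= dl m &
    forall e, 0 < e -> exists N, forall m, (N <= m)%N -> dl m <= e].
Proof.
exists (fun m => m.+1%:R^-1); split.
- by move=> m; rewrite invr_gt0 ltr0n invf_le1 ?ltr0n// ler1n.
- by move=> m l ml; rewrite lef_pV2 ?posrE ?ltr0n// ler_nat.
move=> e e0; exists (Num.trunc e^-1) => m; rewrite truncn_le_nat => /ltW hm.
by rewrite -[leRHS]invrK lef_pV2 ?posrE ?invr_gt0 ?ltr0n.
Qed.

Section BoundaryToKMS.
Variables (R : realType) (A : cstarAlgType R) (n : nat).
Variable sigma : 'rV[R]_n -> A -> A.
Hypothesis dyn : cstar_dynamical_system sigma.
Variable tau : {scalar A}.
Hypothesis tau_le : forall a, nm (tau a) <= nm a.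

Definition kms_fun a b (z : 'rV[CC R]_n) : (CC R)^o := tau (a ** sigma_ext sigma z b).

Lemma kms_fun_differentiable a b z : analytic_elements sigma b ->
  differentiable (kms_fun a b) z.
Proof.
move=> /sigma_extP[eb _]; apply: mdiff_differentiable.
apply: (@mdiff_comp_linear _ _ _ _ (fun x => tau (a ** x) : (CC R)^o) (nm a)).
- by move=> k u v; rewrite (cmul_linear_r a) linearP.
- by move=> v; apply: le_trans (tau_le _) _; exact: nm_cmul.
- exact: differentiable_mdiff.
Qed.

Variables (beta : 'rV[R]_n) (Lambda : set 'rV[R]_n).
Hypothesis beta0 : forall k, 0 <= beta 0 k.
Variable B : set A.
Hypotheses (Ban : B `<=` analytic_elements sigma) (Balg : star_subalgebra B).
Hypotheses (Bdense : dense B) (Binv : action_invariant sigma B).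
Hypothesis boundary : forall gamma, corners beta gamma -> forall a b, B a -> B b ->
  tau (a ** sigma_ext sigma (cvec 0 gamma) b) =
  if gamma \in Lambda then tau (b ** a) else tau (a ** b).

Lemma kms_fun_boundary a b gamma t : B a -> B b -> corners beta gamma ->
  kms_fun a b (cvec t gamma) =
  if gamma \in Lambda then tau (sigma t b ** a) else tau (a ** sigma t b).
Proof.
move=> Ba Bb hg; rewrite -boundary//; last exact: Binv.
rewrite -sigma_ext_shift//; last exact: Ban.
by rewrite cvecD addr0 add0r.
Qed.

(** The bound [M] on [sigma_ext] depends on [b] in an uncontrolled way and only licenses
    Phragmen-Lindelof; the bound obtained involves norms of [a] and [b] alone and so survives norm
    limits. *)
Lemma kms_fun_le a b z : B a -> B b -> polystrip beta z ->
  nm (kms_fun a b z) <= nm a * nm b.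
Proof.
move=> Ba Bb hz; have [M hM] := sigma_ext_bounded dyn beta0 (Ban Bb).
apply: (polystrip_phragmen_lindelof (f := kms_fun a b) (beta := beta) (M := nm a * M)) => //.
- by move=> w; apply: kms_fun_differentiable; exact: Ban.
- move=> w /hM h; apply: le_trans (tau_le _) _; apply: le_trans (nm_cmul _ _) _.
  by rewrite ler_wpM2l ?nm_ge0.
- move=> gamma t hg; rewrite kms_fun_boundary//.
  case: ifP => _; apply: le_trans (tau_le _) _; apply: le_trans (nm_cmul _ _) _.
    by rewrite nm_sigma// mulrC.
  by rewrite nm_sigma.
Qed.

Lemma star_subalgebraB a b : B a -> B b -> B (a - b).
Proof. by move=> Ba Bb; case: Balg => _ h _ _; have := h (-1) b a Bb Ba; rewrite scaleN1r addrC. Qed.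

Lemma kms_funB a b a' b' z : B a -> B b -> B a' -> B b' -> polystrip beta z ->
  nm (kms_fun a b z - kms_fun a' b' z) <= nm (a - a') * nm b + nm a' * nm (b - b').
Proof.
move=> Ba Bb Ba' Bb' hz.
have -> : kms_fun a b z - kms_fun a' b' z = kms_fun (a - a') b z + kms_fun a' (b - b') z.
  rewrite /kms_fun sigma_extB//; try exact: Ban.
  by rewrite cmulBl cmulBr !linearB /= addrA subrK.
apply: le_trans (nm_triangle _ _) _.
by apply: lerD; apply: kms_fun_le => //; exact: star_subalgebraB.
Qed.

Lemma approx_seq a (dl : nat -> R) : (forall m, 0 < dl m <= 1) ->
  exists2 u : nat -> A, forall m, B (u m) & forall m, nm (u m - a) <= dl m.
Proof.
move=> dl0; have h m : exists b, B b /\ nm (b - a) <= dl m.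
  have /andP[e0 _] := dl0 m.
  have [/dense_nm/(_ a _ e0)[b Bb hb] _] := (Bdense, I).
  by exists b; split => //; exact: ltW.
by exists (fun m => sval (cid (h m))) => m; case: cid => b [].
Qed.

Theorem kms_of_boundary : KMS_state sigma beta Lambda tau.
Proof.
move=> a b.
have [dl [delta dl_mono inv_seqlim0]] := null_sequence R.
have [u Bu hu] := approx_seq a delta; have [v Bv hv] := approx_seq b delta.
pose Ku := nm a + 1; pose Kv := nm b + 1.
have bu m : nm (u m) <= Ku.
  have /andP[_ d1] := delta m; apply: le_trans (nm_split _ a) _.
  by rewrite /Ku lerD2l; exact: le_trans (hu m) d1.
have bv m : nm (v m) <= Kv.
  have /andP[_ d1] := delta m; apply: le_trans (nm_split _ b) _.
  by rewrite /Kv lerD2l; exact: le_trans (hv m) d1.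
have Ku0 : 0 <= Ku by rewrite /Ku; have := nm_ge0 a; lra.
have Kv0 : 0 <= Kv by rewrite /Kv; have := nm_ge0 b; lra.
pose Fm m := kms_fun (u m) (v m).
(* Terms of index at least [m] differ by at most [2 * dl m] in each sequence; [kms_funB] multiplies
   this by [Kv] for the first and by [Ku] for the second. *)
pose K := 2 * (Ku + Kv).
have K0 : 0 <= K by rewrite /K; lra.
have lu : seqlim u a.
  by move=> e /inv_seqlim0[N hN]; exists N => m /hN; apply: le_trans (hu m).
have lv : seqlim v b.
  by move=> e /inv_seqlim0[N hN]; exists N => m /hN; apply: le_trans (hv m).
have Fdiff m l z : (m <= l)%N -> polystrip beta z -> nm (Fm l z - Fm m z) <= K * dl m.
  move=> ml hz; apply: le_trans (kms_funB (Bu l) (Bv l) (Bu m) (Bv m) hz) _.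
  have lm := dl_mono _ _ ml.
  have d1 : nm (u l - u m) <= 2 * dl m.
    by have := nm_dist a (u l) (u m); rewrite (nmB a); have := hu l; have := hu m; lra.
  have d2 : nm (v l - v m) <= 2 * dl m.
    by have := nm_dist b (v l) (v m); rewrite (nmB b); have := hv l; have := hv m; lra.
  have -> : K * dl m = 2 * dl m * Kv + Ku * (2 * dl m).
    by rewrite /K; ring.
  by apply: lerD; apply: ler_pM; rewrite ?nm_ge0.
have exF z : polystrip beta z -> exists l : R[i]^o, seqlim (Fm^~ z) l.
  move=> hz; apply: complex_nm_complete => e e0.
  have K1 : 0 < 2 * (K + 1) by lra.
  have [N hN] := inv_seqlim0 _ (divr_gt0 e0 K1).
  exists N => m l hm hl.
  have := Fdiff _ _ z hm hz; have := Fdiff _ _ z hl hz.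
  have := nm_dist (Fm N z) (Fm m z) (Fm l z); rewrite (nmB (Fm N z)).
  have := hN N (leqnn N); rewrite ler_pdivlMr//; have := delta N; lra.
(* Off the polystrip the limit may fail to exist, and [F] then takes the default value 0. *)
pose F z : (CC R)^o := xget 0 [set l : (CC R)^o | seqlim (Fm^~ z) l].
have lF z : polystrip beta z -> seqlim (Fm^~ z) (F z).
  by move=> /exF h; exact: (@xgetPex _ 0 [set l : (CC R)^o | seqlim (Fm^~ z) l]).
have eF z l : polystrip beta z -> seqlim (Fm^~ z) l -> F z = l.
  by move=> /lF; exact: seqlim_unique.
have unif m z : polystrip beta z -> nm (F z - Fm m z) <= K * dl m.
  move=> hz; have := seqlimB (lF z hz) (seqlim_cst (Fm m z)).
  by move=> h; apply: (@seqlim_le _ _ _ _ m _ h) => l ml; exact: Fdiff.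
have bF m z : polystrip beta z -> nm (Fm m z) <= Ku * Kv.
  move=> hz; apply: le_trans (kms_fun_le (Bu m) (Bv m) hz) _.
  by apply: ler_pM; rewrite ?nm_ge0.
have lsig t : seqlim (fun m => sigma t (v m)) (sigma t b).
  apply: (@seqlim_bounded_linear _ _ _ _ 1) lv; first exact/linear_mapB/sigma_linear.
  by move=> x; rewrite nm_sigma// mul1r.
have ltau (x : nat -> A) l : seqlim x l -> seqlim (fun m => tau (x m)) (tau l).
  apply: (@seqlim_bounded_linear _ _ _ _ 1); first by move=> *; exact: linearB.
  by move=> y; rewrite mul1r.
have bdF gamma t : corners beta gamma ->
    F (cvec t gamma) = if gamma \in Lambda then tau (sigma t b ** a) else tau (a ** sigma t b).
  move=> hg; apply: eF; first exact: corner_polystrip.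
  have E m : Fm m (cvec t gamma) = if gamma \in Lambda then tau (sigma t (v m) ** u m)
      else tau (u m ** sigma t (v m)) by exact: kms_fun_boundary.
  move=> e e0.
  have [N hN] : exists N, forall m, (N <= m)%N ->
      nm ((if gamma \in Lambda then tau (sigma t (v m) ** u m) else tau (u m ** sigma t (v m)))
       - (if gamma \in Lambda then tau (sigma t b ** a) else tau (a ** sigma t b))) <= e.
    by case: ifP => _; apply: ltau e0; exact: seqlim_cmul.
  by exists N => m /hN; rewrite -E.
exists F; split.
- move=> z hz; have [r r0 hr] := polystrip_interior_ball beta0 hz.
  apply: mdiff_differentiable.
  (* Increments filtered through [free_part] keep a whole ball inside the polystrip, even where it
     is degenerate. *)
  apply: (@mdiff_limit _ _ _ (fun m w => Fm m (z + free_part beta w)) _ r (Ku * Kv)) => //.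
  + exact: complex_nm_complete.
  + move=> m w hw.
    apply: (@mdiff_precomp _ _ _ _ (fun w => Fm m (z + w)) (free_part beta)).
    * exact: free_part_linear.
    * exact: nm_free_part.
    * apply/mdiff_shift/differentiable_mdiff/kms_fun_differentiable; exact: Ban.
  + by move=> m w /hr; exact: bF.
  + by move=> w /hr; exact: lF.
- apply/subspace_continuousP => z hz; apply/cvgrPdist_le => _ /posC_real[e e0 ->].
  have K1 : 0 < 4 * (K + 1) by lra.
  have [N hN] := inv_seqlim0 _ (divr_gt0 e0 K1).
  have {hN} := hN N (leqnn N); rewrite ler_pdivlMr// => hN.
  have dN : differentiable (Fm N) z by apply: kms_fun_differentiable; exact: Ban.
  have [d d0 hd] := mdiff_cont (differentiable_mdiff dN) (divr_gt0 e0 (ltr0n _ 2)).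
  rewrite near_withinE; apply/nbhs_nm; exists d => // w hw Dw.
  have := hd (w - z) hw; rewrite (addrC z) subrK => h1.
  have h2 := unif N z hz; have h3 := unif N w Dw.
  rewrite -nmE lecR.
  have := nm_dist (Fm N z) (F z) (F w); have := nm_dist (Fm N w) (Fm N z) (F w).
  rewrite (nmB (Fm N w) (F w)) (nmB (Fm N z) (Fm N w)).
  have := delta N; lra.
- exists (Ku * Kv) => z hz; rewrite -nmE lecR.
  by apply: (@seqlim_le _ _ _ _ 0%N _ (lF z hz)) => m _; exact: bF.
- move=> t; apply: eF; first by move=> k; rewrite mxE /= mxE lexx beta0.
  have E m : Fm m (cvec t 0) = tau (u m ** sigma t (v m)).
    by rewrite /Fm /kms_fun sigma_ext_real//; exact: Ban.
  move=> e e0; have [N hN] := ltau _ _ (seqlim_cmul lu (lsig t)) e e0.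
  by exists N => m /hN; rewrite -E.
- exact: bdF.
Qed.

End BoundaryToKMS.

(** * From KMS to the boundary condition *)

Section KMSToBoundary.
Variables (R : realType) (A : cstarAlgType R) (n : nat).
Variable sigma : 'rV[R]_n -> A -> A.
Hypothesis dyn : cstar_dynamical_system sigma.
Variable tau : {scalar A}.
Hypothesis tau_le : forall a, nm (tau a) <= nm a.
Variables (beta : 'rV[R]_n) (Lambda : set 'rV[R]_n).
Hypothesis beta0 : forall k, 0 <= beta 0 k.
Variables (a b : A) (F : 'rV[CC R]_n -> (CC R)^o).
Hypothesis b_an : analytic_elements sigma b.
Hypothesis F_diff : analytic_on_polystrip_interior beta F.
Hypothesis F_cont : {within polystrip beta, continuous F}.
Hypothesis F_real : forall t, F (cvec t 0) = tau (a ** sigma t b).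

Lemma kms_continuous_nm z (e : R) : polystrip beta z -> 0 < e -> exists2 d : R, 0 < d &
  forall w, polystrip beta w -> nm (w - z) < d -> nm (F w - F z) <= e.
Proof.
move=> hz e0; have /subspace_continuousP/(_ z hz) := F_cont.
move=> /cvgrPdist_le/(_ e%:C); rewrite ltcR => /(_ e0); rewrite near_withinE.
move=> /nbhs_nm[d d0 hd]; exists d => // w Dw /hd/(_ Dw).
by rewrite nmB -lecR nmE.
Qed.

(** Since [g] is positive in the free directions and at most [beta], the slice [s |-> s *: v] runs
    in the relative interior for [0 < Im s < 1] and in the polystrip for [0 <= Im s <= 1]. The
    difference of the two functions vanishes for real [s], so [vanishing_on_side] applies. *)
Lemma kms_fun_agree_interior (g : 'rV[R]_n) (y : R) :
  (forall k, if beta 0 k == 0 then g 0 k = 0 else 0 < g 0 k <= beta 0 k) ->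
  0 <= y < 1 -> F (cvec 0 (y *: g)) = kms_fun sigma tau a b (cvec 0 (y *: g)).
Proof.
move=> hg hy; pose v := cvec g 0.
have hD s : 0 <= Im s <= 1 -> polystrip beta (s *: v).
  move=> hs k; rewrite cvecZ mxE /= mxE.
  have := hg k; case: eqP => [-> ->|_]; first by rewrite mulr0 lexx.
  by nra.
pose h (s : R[i]) : R[i]^o := F (s *: v) - kms_fun sigma tau a b (s *: v).
suff : h (0 +i* y) = 0.
  by rewrite /h cvecZ /= scale0r => /subr0_eq.
have dG s : cdiff (fun s => kms_fun sigma tau a b (s *: v)) s.
  have := @cdiff_slice _ _ _ (kms_fun sigma tau a b) 0 v s.
  move=> /(_ (kms_fun_differentiable tau_le _ _ b_an)).
  apply: cdiff_eq; first exact: ltr01.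
  by move=> w _; rewrite add0r.
apply: vanishing_on_side => //.
- move=> s [_ hs]; apply: ccontB; last exact: ccont_cdiff.
  move=> e e0; have [d d0 hd] := kms_continuous_nm (hD s hs) e0.
  have v1 : 0 < 1 + nm v by have := nm_ge0 v; lra.
  exists (d / (1 + nm v)); first by rewrite divr_gt0.
  move=> w [_ hw]; rewrite ltr_pdivlMr// => hws; apply: hd; first exact: hD.
  rewrite -scalerBl nmZ; apply: le_lt_trans hws.
  by rewrite ler_wpM2l ?nm_ge0//; lra.
- move=> s _ hs; apply: cdiffB; last exact: dG.
  have hI : polystrip_interior beta (s *: v).
    move=> k; rewrite cvecZ mxE /= mxE.
    have := hg k; case: eqP => [_ ->|_]; first by rewrite mulr0.
    by nra.
  (* [F_diff] speaks of increments through [free_part]; [v] vanishes in the other coordinates, so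
     along the slice [free_part] acts as the identity. *)
  have dF : differentiable (fun w => F (s *: v + free_part beta w))
      ((0 : 'rV[CC R]_n) + (0 : R[i]) *: v).
    by rewrite scale0r addr0; exact: F_diff.
  have dF' := cdiff_slice dF.
  have : cdiff (fun w => F (s *: v + free_part beta (0 + (w - s) *: v))) s.
    apply: (@cdiff_comp _ _ (fun w => w - s) (fun w => F (s *: v + free_part beta (0 + w *: v)))).
      by apply: cdiffB; [exact: cdiff_id|exact: cdiff_cst].
    by rewrite subrr; exact: dF'.
  apply: cdiff_eq; first exact: ltr01.
  move=> w _; congr F; apply/rowP => k; rewrite !mxE.
  have := hg k; case: eqP => [_ ->|_ _]; first by rewrite addr0 !mulr0.
  by rewrite add0r -mulrDl addrC subrK.
- move=> x _; rewrite /h cvecZ /= scale0r F_real /kms_fun sigma_ext_real// subrr//.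
Qed.

Lemma kms_fun_agree_corner gamma : corners beta gamma ->
  F (cvec 0 gamma) = kms_fun sigma tau a b (cvec 0 gamma).
Proof.
move=> hg; apply/subr0_eq/nm_eq0/eqP; rewrite eq_le nm_ge0 andbT.
apply/ler_addgt0Pr => e e0; rewrite add0r.
have hgk k : 0 <= gamma 0 k <= beta 0 k /\ (gamma 0 k = 0 \/ gamma 0 k = beta 0 k).
  by have [c ->] := hg; case: (c k); rewrite ?lexx ?beta0; split; auto.
have Dg : polystrip beta (cvec 0 gamma) by exact: corner_polystrip.
have e2 : 0 < e / 2 by lra.
have [d1 d10 h1] := kms_continuous_nm Dg e2.
have dG := kms_fun_differentiable tau_le a (cvec 0 gamma) b_an.
have [d2 d20 h2] := mdiff_cont (differentiable_mdiff dG) e2.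
pose S := \sum_k beta 0 k.
have S0 : 0 <= S by apply: sumr_ge0.
have hS k : beta 0 k <= S by rewrite /S (bigD1 k) //= lerDl sumr_ge0.
have m0 : 0 < Num.min d1 d2 by rewrite lt_min d10.
(* Each coordinate of the perturbed point is within [d * S] of [gamma], and [nm_cvec_re] doubles
   this. *)
pose d : R := Num.min 1 (Num.min d1 d2 / (4 * (S + 1))).
have S4 : 0 < 4 * (S + 1) by lra.
have d0 : 0 < d by rewrite lt_min ltr01 divr_gt0.
have dle1 : d <= 1 by rewrite ge_min lexx.
have dS : 4 * (S + 1) * d <= Num.min d1 d2.
  by rewrite -ler_pdivlMl// mulrC ge_min lexx orbT.
(* Moving from [gamma] towards [beta] by the fraction [d] makes every free coordinate positive. The
   further factor [1 - d] is the height on the slice, which has to be below 1. *)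
pose g : 'rV[R]_n := gamma + d *: (beta - gamma).
have gk k : g 0 k = gamma 0 k + d * (beta 0 k - gamma 0 k) by rewrite !mxE.
have hgg k : if beta 0 k == 0 then g 0 k = 0 else 0 < g 0 k <= beta 0 k.
  rewrite gk; have [h3 h4] := hgk k; case: eqP => [b0|/eqP b0].
    by rewrite b0 in h3 *; case: h4 => ->; rewrite ?b0; ring.
  have bp : 0 < beta 0 k by rewrite lt_neqAle eq_sym b0 beta0.
  by case: h4 => ->; rewrite ?subrr ?subr0 ?add0r ?mulr0 ?addr0 ?bp ?lexx//; nra.
have hy : 0 <= 1 - d < 1 by lra.
have E := kms_fun_agree_interior hgg hy.
set p := cvec 0 _ in E.
have Dp : polystrip beta p.
  move=> k; rewrite mxE /= mxE; have := hgg k; case: eqP => [-> ->|_].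
    by rewrite mulr0 lexx.
  by nra.
have np : nm (p - cvec 0 gamma) < Num.min d1 d2.
  apply: (@le_lt_trans _ _ (2 * (d * S))); last first.
    apply: lt_le_trans dS; have := mulr_ge0 (ltW d0) S0; lra.
  have -> : p - cvec 0 gamma = cvec 0 ((1 - d) *: g - gamma).
    apply/rowP => k; rewrite !mxE.
    by apply/eqP; rewrite eq_complex /= subrr !eqxx.
  apply: nm_cvec_re; first by rewrite mulr_ge0// ltW.
    by move=> k; rewrite mxE normr0 mulr_ge0// ltW.
  move=> k.
  have -> : ((1 - d) *: g - gamma) 0 k = d * ((1 - d) * (beta 0 k - gamma 0 k) - gamma 0 k).
    by rewrite mxE [((1 - d) *: g) 0 k]mxE gk mxE; ring.
  rewrite normrM (gtr0_norm d0) ler_pM2l//.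
  have [h3 _] := hgk k; have := hS k; rewrite ler_norml => h5.
  by nra.
have [np1 np2] : nm (p - cvec 0 gamma) < d1 /\ nm (p - cvec 0 gamma) < d2.
  by move: np; rewrite lt_min => /andP[].
have := h1 _ Dp np1; have := h2 _ np2; rewrite (addrC (cvec 0 gamma)) subrK -E => h3 h4.
have := nm_dist (F p) (F (cvec 0 gamma)) (kms_fun sigma tau a b (cvec 0 gamma)).
by rewrite (nmB (F (cvec 0 gamma)) (F p)); lra.
Qed.

End KMSToBoundary.

Theorem boundary_of_kms (R : realType) (A : cstarAlgType R) (n : nat)
    (sigma : 'rV[R]_n -> A -> A) (tau : {scalar A}) (beta : 'rV[R]_n)
    (Lambda : set 'rV[R]_n) a b gamma :
  cstar_dynamical_system sigma -> (forall a, nm (tau a) <= nm a) ->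
  (forall k, 0 <= beta 0 k) -> KMS_state sigma beta Lambda tau ->
  analytic_elements sigma b -> corners beta gamma ->
  tau (a ** sigma_ext sigma (cvec 0 gamma) b) =
  if gamma \in Lambda then tau (b ** a) else tau (a ** b).
Proof.
move=> dyn tau_le beta0 /(_ a b)[F [dF cF _ F0 Fg]] b_an hg.
have := kms_fun_agree_corner tau_le beta0 b_an dF cF F0 hg.
by rewrite /kms_fun => <-; rewrite Fg// (sigma0 dyn).
Qed.

(** * Dyadic integrals over the real line *)

Section DyadicMean.
Variables (R : realType) (V : normedModType R[i]).
Implicit Types (f g : R -> V) (p d s x : R).

Fixpoint rmean f m p d : V :=
  if m is k.+1 then 2^-1 *: (rmean f k p (d / 2) + rmean f k (p + d / 2) (d / 2))
  else f p.

Lemma scale_half (v : V) : 2^-1 *: (v + v) = v.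
Proof. by rewrite scalerDr -scalerDl -[2^-1]div1r -splitr scale1r. Qed.

Lemma rmean_cst (v : V) m p d : rmean (fun=> v) m p d = v.
Proof. by elim: m p d => //= m ih p d; rewrite !ih scale_half. Qed.

Lemma rmeanB f g m p d : rmean (fun x => f x - g x) m p d = rmean f m p d - rmean g m p d.
Proof. by elim: m p d => //= m ih p d; rewrite !ih -scalerBr opprD addrACA. Qed.

Lemma rmean_shift f m p d s : rmean f m (p + s) d = rmean (fun x => f (x + s)) m p d.
Proof. by elim: m p d => //= m ih p d; rewrite -!ih addrAC. Qed.

Lemma rmean_bound f m p d K : 0 <= d -> (forall x, p <= x <= p + d -> nm (f x) <= K) ->
  nm (rmean f m p d) <= K.
Proof.
elim: m p d => [|m ih] p d d0 h /=; first by apply: h; rewrite lexx lerDl.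
have h1 : nm (rmean f m p (d / 2)) <= K.
  by apply: ih => [|x hx]; [|apply: h]; lra.
have h2 : nm (rmean f m (p + d / 2) (d / 2)) <= K.
  by apply: ih => [|x hx]; [|apply: h]; lra.
rewrite nmZ nm2V.
by have := nm_triangle (rmean f m p (d / 2)) (rmean f m (p + d / 2) (d / 2)); lra.
Qed.

(** Refinement replaces the value at the left end of each of the [2^m] cells, of length
    [d * 2^-1 ^+ m], by a mean over that cell. *)
Lemma rmean_refine f m j p d e : 0 <= d ->
  (forall x y, p <= x <= p + d -> p <= y <= p + d -> `|x - y| <= d * 2^-1 ^+ m ->
     nm (f x - f y) <= e) ->
  nm (rmean f (m + j) p d - rmean f m p d) <= e.
Proof.
elim: m p d => [|m ih] p d d0 h /=.
  rewrite -(rmean_cst (f p) j p d) -rmeanB; apply: rmean_bound => // x hx.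
  apply: h => //; first by rewrite lexx lerDl.
  by rewrite expr0 mulr1 ler_norml; lra.
rewrite -scalerBr opprD addrACA nmZ nm2V.
have h1 : nm (rmean f (m + j) p (d / 2) - rmean f m p (d / 2)) <= e.
  apply: ih; first lra.
  move=> x y hx hy hxy; apply: h; [lra|lra|].
  by move: hxy; rewrite exprS mulrA.
have h2 : nm (rmean f (m + j) (p + d / 2) (d / 2) - rmean f m (p + d / 2) (d / 2)) <= e.
  apply: ih; first lra.
  move=> x y hx hy hxy; apply: h; [lra|lra|].
  by move: hxy; rewrite exprS mulrA.
have := nm_triangle (rmean f (m + j) p (d / 2) - rmean f m p (d / 2))
  (rmean f (m + j) (p + d / 2) (d / 2) - rmean f m (p + d / 2) (d / 2)).
lra.
Qed.

(** A shift by one cell of level [j] permutes the cells apart from the first and the new last one.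
    The identity is exact because the shift matches the mesh; this is the source of the restriction
    to dyadic translations. *)
Lemma rmean_telescope f m j p d : let c := d * 2^-1 ^+ j in
  rmean f (m + j) (p + c) d - rmean f (m + j) p d =
  2^-1 ^+ j *: (rmean f m (p + d) c - rmean f m p c).
Proof.
elim: j p d => [|j ih] p d c /=.
  by rewrite addn0 /c !expr0 mulr1 scale1r.
rewrite addnS /=; have hc : c = d / 2 * 2^-1 ^+ j by rewrite /c exprS mulrA.
rewrite -scalerBr opprD addrACA (addrAC p c) hc !ih exprS -scalerA -scalerDr.
congr (_ *: (_ *: _)); rewrite -hc.
have -> : p + d / 2 + d / 2 = p + d by rewrite -addrA -splitr.
by rewrite [LHS]addrC addrA subrK.
Qed.

End DyadicMean.

(** * Improper Riemann integrals of decaying vector-valued functions *)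

Section DyadicIntegral.
Variables (R : realType) (V : normedModType R[i]).
Hypothesis cV : nm_complete V.
Implicit Types (f g : R -> V) (B : R).

(** The shape [B / (2 + x ^+ 2)] is what a Gaussian satisfies through exp(-x^2/2) <= 1/(1 + x^2/2).
    Uniform continuity on bounded intervals is included to make Riemann sums Cauchy directly. *)
Definition integrable_decay f B := [/\
  forall T e, 0 < e -> exists2 d, 0 < d & forall x y, `|x| <= T -> `|y| <= T ->
    `|x - y| < d -> nm (f x - f y) <= e &
  forall x, nm (f x) <= B / (2 + x ^+ 2)].

(* Riemann sums over [-2^k, 2^k]; the limits below are 0 when they do not
   exist. *)
Definition truncated_sum f k m : V :=
  (2 ^+ k.+1)%:C *: rmean f m (- 2 ^+ k) (2 ^+ k.+1).

Definition truncated_integral f k : V := xget 0 [set l | seqlim (truncated_sum f k) l].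

Definition dyadic_integral f : V := xget 0 [set l | seqlim (truncated_integral f) l].

Lemma nm_pow2 k : nm ((2 ^+ k)%:C : R[i]) = 2 ^+ k.
Proof. by rewrite nmR ger0_norm// exprn_ge0. Qed.

Lemma pow2_gt0 k : 0 < 2 ^+ k :> R.
Proof. by rewrite exprn_gt0. Qed.

Lemma pow2_ge1 k : 1 <= 2 ^+ k :> R.
Proof. by rewrite exprn_ege1// ler1n. Qed.

Lemma geometric_lt (e : R) : 0 < e -> exists N, forall m, (N <= m)%N -> 2^-1 ^+ m < e.
Proof.
move=> e0; have h : `|2^-1 : R| < 1 by rewrite ger0_norm ?invr_ge0// invf_lt1// ltr1n.
have /cvgrPdist_lt /(_ _ e0) [N _ hN] := cvg_expr h; exists N => m /hN /=.
by rewrite sub0r normrN ger0_norm// exprn_ge0// invr_ge0.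
Qed.

Lemma decay_ge0 f B : integrable_decay f B -> 0 <= B.
Proof.
move=> [_ /(_ 0)]; rewrite expr0n addr0 => h.
by have := nm_ge0 (f 0); move: h; lra.
Qed.

Lemma truncated_sum_cauchy f B (k : nat) : integrable_decay f B -> nm_cauchy (truncated_sum f k).
Proof.
move=> [uc _] e e0.
have k0 := pow2_gt0 k.+1.
have [d d0 hd] := uc (2 ^+ k) _ (divr_gt0 e0 (mulr_gt0 (ltr0n R 2) k0)).
have [N hN] := geometric_lt (divr_gt0 d0 k0).
have ref j : nm (truncated_sum f k (N + j) - truncated_sum f k N) <= e / 2.
  rewrite /truncated_sum -scalerBr nmZ nm_pow2.
  have -> : e / 2 = 2 ^+ k.+1 * (e / (2 * 2 ^+ k.+1)) by field; rewrite gt_eqF.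
  rewrite ler_pM2l//; apply: rmean_refine; first exact: ltW.
  move=> x y hx hy hxy; apply: hd.
  - by move: hx; rewrite exprS ler_norml; lra.
  - by move: hy; rewrite exprS ler_norml; lra.
  - apply: le_lt_trans hxy _.
    by have := hN N (leqnn N); rewrite ltr_pdivlMr// mulrC.
exists N => m l hm hl.
have := ref (m - N)%N; have := ref (l - N)%N; rewrite !subnKC//.
have := nm_dist (truncated_sum f k N) (truncated_sum f k m) (truncated_sum f k l).
by rewrite (nmB (truncated_sum f k N)); lra.
Qed.

Lemma truncated_integralP f B k : integrable_decay f B ->
  seqlim (truncated_sum f k) (truncated_integral f k).
Proof.
move=> hf; have h := cV (truncated_sum_cauchy k hf).
exact: (@xgetPex _ 0 [set l | seqlim (truncated_sum f k) l]).
Qed.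

Lemma decay_on f B (T x : R) : integrable_decay f B -> 0 < T -> T <= `|x| ->
  nm (f x) <= B / T ^+ 2.
Proof.
move=> hf T0 hx; have B0 := decay_ge0 hf; case: hf => _ /(_ x) h; apply: le_trans h _.
rewrite ler_wpM2l// lef_pV2 ?posrE ?exprn_gt0//; last by have := sqr_ge0 x; lra.
rewrite -(real_normK (num_real x)).
have : T ^+ 2 <= `|x| ^+ 2 by rewrite lerXn2r ?nnegrE ?normr_ge0 ?(ltW T0).
lra.
Qed.

(** Doubling the interval while adding one level keeps the mesh, so the sums over the central part
    cancel exactly. *)
Lemma truncated_sum_step f k m :
  truncated_sum f k.+1 m.+2 - truncated_sum f k m.+1 =
  (2 ^+ k)%:C *: (rmean f m (- 2 ^+ k.+1) (2 ^+ k) + rmean f m (2 ^+ k) (2 ^+ k)).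
Proof.
set T : R := 2 ^+ k.
have e1 : 2 ^+ k.+1 = 2 * T by rewrite exprS.
have e2 : 2 ^+ k.+2 = 4 * T by rewrite !exprS -/T; ring.
rewrite /truncated_sum e1 e2 /=.
have -> : - (2 * T) + 4 * T / 2 + 4 * T / 2 / 2 = T by field.
have -> : - (2 * T) + 4 * T / 2 = 0 by field.
have -> : 4 * T / 2 / 2 = T by field.
have -> : 2 * T / 2 = T by field.
have -> : - (2 * T) + T = - T by ring.
have -> : - T + T = 0 by ring.
set a := rmean f m (- (2 * T)) T; set b := rmean f m (- T) T.
set c := rmean f m 0 T; set d := rmean f m T T.
rewrite !rmorphM !rmorph_nat !scalerA.
have -> : 4 * T%:C * 2^-1 = 2 * T%:C :> R[i] by field.
have -> : 2 * T%:C * 2^-1 = T%:C :> R[i] by field.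
rewrite !scalerDr !scalerA; have -> : 2 * T%:C * 2^-1 = T%:C :> R[i] by field.
by rewrite opprD !addrA [LHS](ACl (1*4*(2*5)*(3*6)))/= !subrr !addr0.
Qed.

Lemma seqlim_addn (u : nat -> V) l j : seqlim u l -> seqlim (fun m => u (m + j)%N) l.
Proof.
move=> h e /h[N hN]; exists N => m hm; apply: hN.
exact: leq_trans hm (leq_addr _ _).
Qed.

Lemma truncated_integral_step f B k : integrable_decay f B ->
  nm (truncated_integral f k.+1 - truncated_integral f k) <= 2 * B * 2^-1 ^+ k.
Proof.
move=> hf.
have h1 := seqlim_addn 2 (truncated_integralP k.+1 hf).
have h2 := seqlim_addn 1 (truncated_integralP k hf).
apply: (seqlim_le (N0 := 0%N) (seqlimB h1 h2)) => m _.
rewrite addn2 addn1 truncated_sum_step nmZ nm_pow2; have T0 := pow2_gt0 k.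
set T : R := 2 ^+ k in T0 *.
have b1 : nm (rmean f m (- 2 ^+ k.+1) T) <= B / T ^+ 2.
  apply: rmean_bound => [|x hx]; first exact: ltW.
  apply: decay_on => //; move: hx; rewrite exprS -/T => hx.
  by rewrite ler0_norm; lra.
have b2 : nm (rmean f m T T) <= B / T ^+ 2.
  apply: rmean_bound => [|x hx]; first exact: ltW.
  by apply: decay_on => //; rewrite ger0_norm; lra.
have -> : 2 * B * 2^-1 ^+ k = T * (B / T ^+ 2 + B / T ^+ 2).
  by rewrite exprVn -/T; field; rewrite gt_eqF.
rewrite ler_pM2l//.
have := nm_triangle (rmean f m (- 2 ^+ k.+1) T) (rmean f m T T); lra.
Qed.

Lemma truncated_integral_tail f B k j : integrable_decay f B ->
  nm (truncated_integral f (k + j) - truncated_integral f k) <= 4 * B * 2^-1 ^+ k.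
Proof.
move=> hf; have B0 := decay_ge0 hf.
have p0 i : 0 <= B * 2^-1 ^+ i by rewrite mulr_ge0// exprn_ge0// invr_ge0.
(* Subtracting the remaining tail strengthens the bound enough for the induction on [j] to close. *)
suff : nm (truncated_integral f (k + j) - truncated_integral f k) <=
    4 * B * 2^-1 ^+ k - 4 * B * 2^-1 ^+ (k + j).
  by have := p0 (k + j)%N; lra.
elim: j => [|j ih]; first by rewrite addn0 !subrr nm0.
apply: le_trans (nm_dist (truncated_integral f (k + j)) _ _) _.
have := truncated_integral_step (k + j) hf.
by rewrite -addnS addnS exprS; lra.
Qed.

Lemma dyadic_integralP f B : integrable_decay f B ->
  seqlim (truncated_integral f) (dyadic_integral f).
Proof.
move=> hf; suff cI : nm_cauchy (truncated_integral f).
  exact: (@xgetPex _ 0 [set l | seqlim (truncated_integral f) l] (cV cI)).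
have B0 := decay_ge0 hf.
move=> e e0; have B1 : 0 < 8 * (B + 1) by lra.
have [N hN] := geometric_lt (divr_gt0 e0 B1); exists N => m l hm hl.
have := truncated_integral_tail N (m - N) hf.
have := truncated_integral_tail N (l - N) hf; rewrite !subnKC//.
have := nm_dist (truncated_integral f N) (truncated_integral f m) (truncated_integral f l).
rewrite (nmB (truncated_integral f N)).
have := hN N (leqnn N); rewrite ltr_pdivlMr//.
have : 0 <= (2^-1 : R) ^+ N by rewrite exprn_ge0// invr_ge0.
lra.
Qed.

Lemma dyadic_integral_tail f B k : integrable_decay f B ->
  nm (dyadic_integral f - truncated_integral f k) <= 4 * B * 2^-1 ^+ k.
Proof.
move=> hf; apply: (seqlim_le (N0 := k) (seqlimB (dyadic_integralP hf) (seqlim_cst _))) => m hm.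
by have := truncated_integral_tail k (m - k) hf; rewrite subnKC.
Qed.

Lemma truncated_sum_bound f k m K : (forall x, `|x| <= 2 ^+ k -> nm (f x) <= K) ->
  nm (truncated_sum f k m) <= 2 ^+ k.+1 * K.
Proof.
move=> h; rewrite nmZ nm_pow2 ler_pM2l ?pow2_gt0//; apply: rmean_bound.
  exact/ltW/pow2_gt0.
by move=> x hx; apply: h; move: hx; rewrite exprS ler_norml; lra.
Qed.

Lemma truncated_integral_bound f B k K : integrable_decay f B ->
  (forall x, `|x| <= 2 ^+ k -> nm (f x) <= K) ->
  nm (truncated_integral f k) <= 2 ^+ k.+1 * K.
Proof.
move=> hf h; apply: (seqlim_le (N0 := 0%N) (truncated_integralP k hf)) => m _.
exact: truncated_sum_bound.
Qed.

Lemma decay_le f B x : integrable_decay f B -> nm (f x) <= B.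
Proof.
move=> hf; have B0 := decay_ge0 hf; case: hf => _ /(_ x) h; apply: le_trans h _.
have h2 : 1 <= 2 + x ^+ 2 by have := sqr_ge0 x; lra.
by rewrite ler_pdivrMr ?ler_peMr//; lra.
Qed.

Lemma dyadic_integral_bound f B : integrable_decay f B -> nm (dyadic_integral f) <= 6 * B.
Proof.
move=> hf; have := dyadic_integral_tail 0 hf; rewrite expr0 mulr1.
have := @truncated_integral_bound f B 0 B hf (fun x _ => decay_le x hf); rewrite expr1.
have := nm_split (dyadic_integral f) (truncated_integral f 0); lra.
Qed.

Lemma dyadic_integral_eq f B (l : nat -> V) L : integrable_decay f B ->
  (forall k, seqlim (truncated_sum f k) (l k)) -> seqlim l L -> dyadic_integral f = L.
Proof.
move=> hf hl hL; apply: (seqlim_unique (dyadic_integralP hf)).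
move=> e /hL[N hN]; exists N => k /hN.
by rewrite (seqlim_unique (truncated_integralP k hf) (hl k)).
Qed.

(** By [rmean_telescope] the sums over [[-2^k, 2^k]] change only by two pieces of length [2^-1 ^+ i]
    near the ends, where [f] is small. *)
Lemma dyadic_integral_shift f B B' (i : nat) : integrable_decay f B ->
  integrable_decay (fun x => f (x + 2^-1 ^+ i)) B' ->
  dyadic_integral (fun x => f (x + 2^-1 ^+ i)) = dyadic_integral f.
Proof.
move=> hf hf'; have B0 := decay_ge0 hf.
set s : R := 2^-1 ^+ i; have s0 : 0 < s by rewrite exprn_gt0// invr_gt0.
have s1 : s <= 1 by rewrite exprn_ile1// ?invr_ge0// invf_le1// ler1n.
have h1 := dyadic_integralP hf; have h2 := dyadic_integralP hf'.
apply/subr0_eq/nm_eq0/eqP; rewrite eq_le nm_ge0 andbT.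
apply/ler_addgt0Pr => e e0; rewrite add0r.
have B1 : 0 < 8 * (B + 1) by lra.
have [N hN] := geometric_lt (divr_gt0 e0 B1).
apply: (seqlim_le (N0 := N.+1) (seqlimB h2 h1)) => k hk.
apply: (seqlim_le (N0 := (k.+1 + i)%N)
  (seqlimB (truncated_integralP k hf') (truncated_integralP k hf))) => m hm.
(* At level [j] the cells of an interval of length [2 ^+ k.+1] have length exactly [s]. *)
rewrite -(subnK hm); set m' := (m - _)%N; set j := (k.+1 + i)%N.
have T0 := pow2_gt0 k; set T : R := 2 ^+ k in T0 *.
have T2 : 2 <= T.
  by rewrite /T -[k](ltn_predK hk) exprS ler_peMr// pow2_ge1.
have sE : 2 ^+ k.+1 * 2^-1 ^+ j = s.
  by rewrite /j exprD mulrA -exprMn mulfV ?pnatr_eq0// expr1n mul1r.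
have E := rmean_telescope f m' j (- T) (2 ^+ k.+1); rewrite /= sE in E.
rewrite /truncated_sum -scalerBr -rmean_shift -/s E.
rewrite scalerA nmZ nmM nm_pow2.
have -> : nm ((2^-1 : R[i]) ^+ j) = 2^-1 ^+ j.
  have -> : (2^-1 : R[i]) ^+ j = (2^-1 ^+ j)%:C by rewrite rmorphXn fmorphV rmorph_nat.
  by rewrite nmR ger0_norm// exprn_ge0// invr_ge0.
rewrite sE.
(* The left piece reaches inward to [- T + s]; as [s <= 1] and [2 <= T], it stays at distance at
   least [T / 2] from 0. *)
have Th : 0 < T / 2 by rewrite divr_gt0.
have b1 : nm (rmean f m' (- T + 2 ^+ k.+1) s) <= B / (T / 2) ^+ 2.
  apply: rmean_bound => [|x]; first exact: ltW.
  rewrite exprS -/T => hx; apply: (decay_on hf Th).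
  by rewrite ger0_norm; lra.
have b2 : nm (rmean f m' (- T) s) <= B / (T / 2) ^+ 2.
  apply: rmean_bound => [|x hx]; first exact: ltW.
  apply: (decay_on hf Th).
  by rewrite ler0_norm; lra.
have h3 := nm_triangleB (rmean f m' (- T + 2 ^+ k.+1) s) (rmean f m' (- T) s).
have hk' := hN k (ltnW hk).
have TB : B / (T / 2) ^+ 2 <= 4 * B * 2^-1 ^+ k.
  rewrite exprVn -/T.
  have -> : B / (T / 2) ^+ 2 = 4 * B * (T^-1 * T^-1) by field; rewrite gt_eqF.
  rewrite ler_wpM2l ?mulr_ge0// ler_piMr ?invr_ge0 ?(ltW T0)// invf_le1//; lra.
have hB : 8 * (B * 2^-1 ^+ k) <= e.
  move: hk'; rewrite ltr_pdivlMr//.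
  have : 0 <= (2^-1 : R) ^+ k by rewrite exprn_ge0// invr_ge0.
  lra.
have n0 := nm_ge0 (rmean f m' (- T + 2 ^+ k.+1) s - rmean f m' (- T) s).
have := ler_piMl n0 s1; lra.
Qed.

End DyadicIntegral.

Section DyadicIntegralLinear.
Variables (R : realType) (V W : normedModType R[i]).
Hypotheses (cV : nm_complete V) (cW : nm_complete W).
Implicit Types (f : R -> V).

Lemma rmean_linear (T : V -> W) f m p d : linear T ->
  rmean (fun x => T (f x)) m p d = T (rmean f m p d).
Proof.
move=> linT; elim: m p d => //= m ih p d.
by rewrite !ih (linear_mapZ linT) (linear_mapD linT).
Qed.

Lemma dyadic_integral_linear (T : V -> W) (C : R) f B B' : linear T ->
  (forall v, nm (T v) <= C * nm v) ->
  integrable_decay f B -> integrable_decay (fun x => T (f x)) B' ->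
  dyadic_integral (fun x => T (f x)) = T (dyadic_integral f).
Proof.
move=> linT TC hf hTf.
have TB := linear_mapB linT.
apply: (dyadic_integral_eq cW hTf (l := fun k => T (truncated_integral f k))).
  move=> k; have := seqlim_bounded_linear TB TC (truncated_integralP cV k hf).
  move=> h e /h[N hN]; exists N => m /hN.
  by rewrite /truncated_sum rmean_linear// (linear_mapZ linT).
exact: seqlim_bounded_linear TB TC (dyadic_integralP cV hf).
Qed.

End DyadicIntegralLinear.

(** * Gaussian mollification *)

Section Gaussian.
Variables (R : realType).
Implicit Types (w : R[i]) (x y : R).

Definition gaussian w x : R[i] := cexp (- (x%:C - w) ^+ 2).

(** With u = Re w, the excess of Re (x - w)^2 over x^2/2 - |w|^2 is (x - 2 u)^2 / 2; then exp(-y) <=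
    1/(1 + y) with y = x^2/2. *)
Lemma nm_gaussian w x : nm (gaussian w x) <= 2 * expR (nm w ^+ 2) / (2 + x ^+ 2).
Proof.
have h1 : nm (gaussian w x) <= expR (nm w ^+ 2) * expR (- (x ^+ 2 / 2)).
  rewrite nm_cexp -expRD ler_expR nm_sqr; case: w => u v /=.
  have := sqr_ge0 (x - 2 * u); lra.
apply: le_trans h1 _.
have x0 := sqr_ge0 x.
have -> : 2 * expR (nm w ^+ 2) / (2 + x ^+ 2) = expR (nm w ^+ 2) * (1 + x ^+ 2 / 2)^-1.
  by field; rewrite gt_eqF//; lra.
rewrite ler_pM2l ?expR_gt0// expRN lef_pV2 ?posrE ?expR_gt0 ?expR_ge1Dx//; lra.
Qed.

Lemma gaussian_unif_cont w (T e : R) : 0 < e -> exists2 d : R, 0 < d &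
  forall x y, `|x| <= T -> `|y| <= T -> `|x - y| < d ->
  nm (gaussian w x - gaussian w y) <= e.
Proof.
move=> e0; pose E := expR (nm w ^+ 2); have E0 : 0 < E := expR_gt0 _.
have [d d0 hd] := cdiff_cont (cdiff_cexp 0) (divr_gt0 e0 E0).
have T0 : 0 < 1 + 2 * `|T| + 2 * nm w.
  by have := nm_ge0 w; have := normr_ge0 T; lra.
exists (d / (1 + 2 * `|T| + 2 * nm w)); first by rewrite divr_gt0.
move=> x y hx hy; rewrite ltr_pdivlMr// => hxy.
(* [zeta] is (y - w)^2 - (x - w)^2, so continuity of [cexp] at 0 is enough. *)
pose zeta : R[i] := (y - x)%:C * ((x + y)%:C - 2 * w).
have -> : gaussian w x - gaussian w y = gaussian w y * (cexp zeta - cexp 0).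
  rewrite cexp0 mulrBr mulr1 -cexpD; congr (cexp _ - _).
  by rewrite /zeta !rmorphD rmorphN /=; ring.
have hz : nm (zeta - 0) < d.
  rewrite subr0 nmM nmR distrC; apply: le_lt_trans hxy.
  apply: ler_wpM2l => //; apply: le_trans (nm_triangleB _ _) _.
  have n2 : nm (2 : R[i]) = 2 by rewrite -[2]invrK nmV nm2V invrK.
  rewrite nmR nmM n2; have := ler_normD x y; have := ler_norm T; lra.
rewrite nmM; have h1 := hd _ I hz.
have h2 : nm (gaussian w y) <= E.
  apply: le_trans (nm_gaussian w y) _; rewrite -/E.
  have y0 := sqr_ge0 y; rewrite ler_pdivrMr; last lra.
  have := mulr_ge0 (ltW E0) y0; lra.
have -> : e = E * (e / E) by field; rewrite gt_eqF.
by apply: ler_pM; rewrite ?nm_ge0.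
Qed.

Lemma cdiff_gaussian x w : cdiff (fun w => gaussian w x : R[i]^o) w.
Proof.
apply: cdiff_cexp_comp.
apply: (@cdiff_eq _ _ (fun w => (-1) * (w - x%:C) ^+ 2 : R[i]^o) _ _ 1) => //.
  by move=> w' _; ring.
by apply: cdiffM; [exact: cdiff_cst|exact: cdiff_sqr_sub].
Qed.

Lemma gaussian_decay (V : normedModType R[i]) (w : R[i]) (u : R -> V) (M : R) :
  (forall x, nm (u x) <= M) ->
  (forall e, 0 < e -> exists2 d, 0 < d & forall x y, `|x - y| < d -> nm (u x - u y) <= e) ->
  integrable_decay (fun x => gaussian w x *: u x) (2 * expR (nm w ^+ 2) * M).
Proof.
move=> uM uc; have M0 : 0 <= M := le_trans (nm_ge0 _) (uM 0).
pose E := expR (nm w ^+ 2); have E0 : 0 < E := expR_gt0 _.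
have hE x : nm (gaussian w x) <= E.
  apply: le_trans (nm_gaussian w x) _; rewrite -/E.
  have x0 := sqr_ge0 x; rewrite ler_pdivrMr; last lra.
  have := mulr_ge0 (ltW E0) x0; lra.
split.
  move=> T e e0.
  have K0 : 0 < 2 * (M + E) by lra.
  have e1 : 0 < e / (2 * (M + E)) by rewrite divr_gt0.
  have [d1 d10 h1] := gaussian_unif_cont w T e1.
  have [d2 d20 h2] := uc _ e1.
  exists (Num.min d1 d2); first by rewrite lt_min d10.
  move=> x y hx hy; rewrite lt_min => /andP[/(h1 _ _ hx hy){}h1 /h2{}h2].
  have -> : gaussian w x *: u x - gaussian w y *: u y =
      (gaussian w x - gaussian w y) *: u x + gaussian w y *: (u x - u y).
    by rewrite scalerBl scalerBr addrA subrK.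
  apply: le_trans (nm_triangle _ _) _; rewrite !nmZ.
  have -> : e = e / (2 * (M + E)) * (2 * (M + E)) by field; rewrite gt_eqF//; lra.
  have A1 : nm (gaussian w x - gaussian w y) * nm (u x) <= e / (2 * (M + E)) * M.
    by apply: ler_pM; rewrite ?nm_ge0.
  have A2 : nm (gaussian w y) * nm (u x - u y) <= E * (e / (2 * (M + E))).
    by apply: ler_pM; rewrite ?nm_ge0.
  have := mulr_ge0 (ltW e1) M0; have := mulr_ge0 (ltW e1) (ltW E0).
  set q := e / _ in A1 A2 *; lra.
move=> x; rewrite nmZ mulrAC; apply: ler_pM; rewrite ?nm_ge0//.
exact: nm_gaussian.
Qed.

Lemma integrable_decay_le (V : normedModType R[i]) (f : R -> V) (B B' : R) :
  B <= B' -> integrable_decay f B -> integrable_decay f B'.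
Proof.
move=> BB [h1 h2]; split => // x; apply: le_trans (h2 x) _.
by rewrite ler_wpM2r// invr_ge0; have := sqr_ge0 x; lra.
Qed.

(** This is sqrt(pi), the normalising constant of the mollifier. *)
Definition gaussian_mass : R[i]^o := dyadic_integral (gaussian 0 : R -> R[i]^o).

Lemma gaussian0_decay : integrable_decay (gaussian 0 : R -> R[i]^o) 2.
Proof.
have h : integrable_decay (fun x => gaussian 0 x *: (1 : R[i]^o)) (2 * expR (nm (0 : R[i]) ^+ 2) * 1).
  apply: gaussian_decay => [x|e e0]; first by rewrite nm1.
  by exists 1 => // x y _; rewrite subrr nm0 ltW.
move: h; rewrite nm0 expr0n expR0 !mulr1.
have -> : (fun x => gaussian 0 x *: (1 : R[i]^o)) = gaussian 0; last by [].
by apply/funext => x; rewrite -[LHS]/(gaussian 0 x * 1) mulr1.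
Qed.

Lemma Re_gaussian0 x : Re (gaussian 0 x) = expR (- x ^+ 2).
Proof.
rewrite /gaussian subr0 -rmorphXn -rmorphN /=.
by rewrite cos0 mulr1.
Qed.

Lemma Re_rmean_ge (g : R -> R[i]^o) m (p d a : R) : 0 <= d ->
  (forall x, p <= x <= p + d -> a <= Re (g x)) -> a <= Re (rmean g m p d).
Proof.
elim: m p d => [|m ih] p d d0 h /=; first by apply: h; rewrite lexx lerDl.
have h1 : a <= Re (rmean g m p (d / 2)).
  by apply: ih => [|x hx]; [|apply: h]; lra.
have h2 : a <= Re (rmean g m (p + d / 2) (d / 2)).
  by apply: ih => [|x hx]; [|apply: h]; lra.
have -> (z : R[i]^o) : Re (2^-1 *: z) = 2^-1 * Re z.
  have -> : 2^-1 *: z = (2^-1)%:C * z by rewrite fmorphV rmorph_nat.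
  by case: z => b c /=; rewrite mul0r subr0.
by rewrite [Re (_ + _)]raddfD /=; lra.
Qed.

Lemma Re_seqlim_ge (u : nat -> R[i]^o) l (a : R) : seqlim u l ->
  (forall m, a <= Re (u m)) -> a <= Re l.
Proof.
move=> h ha; apply/ler_addgt0Pr => e /h[N hN].
have := hN N (leqnn N); have := Re_le_nm (u N - l); rewrite raddfB /= ler_norml.
by have := ha N; lra.
Qed.

Lemma Re_scale (k : nat) (z : R[i]^o) : Re ((2 ^+ k)%:C *: z) = 2 ^+ k * Re z.
Proof. by case: z => b c /=; rewrite mul0r subr0. Qed.

(** The integrand is positive, so the real parts of the truncated integrals increase with [k]; it is
    at least [expR (-1)] on [-1, 1], which bounds the first of them from below. *)
Lemma gaussian_mass_neq0 : gaussian_mass != 0.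
Proof.
have cC := @complex_nm_complete R.
have hg := gaussian0_decay.
have step k : Re (truncated_integral (gaussian 0 : R -> R[i]^o) k) <=
    Re (truncated_integral (gaussian 0 : R -> R[i]^o) k.+1).
  rewrite -subr_ge0 -raddfB.
  have h := seqlimB (seqlim_addn 2 (truncated_integralP cC k.+1 hg))
    (seqlim_addn 1 (truncated_integralP cC k hg)).
  apply: (Re_seqlim_ge h) => m; rewrite addn2 addn1 truncated_sum_step Re_scale.
  rewrite mulr_ge0 ?exprn_ge0// raddfD addr_ge0//.
    by apply: Re_rmean_ge => [|x _]; rewrite ?exprn_ge0 ?Re_gaussian0 ?expR_ge0.
  by apply: Re_rmean_ge => [|x _]; rewrite ?exprn_ge0 ?Re_gaussian0 ?expR_ge0.
have e0 := expR_gt0 (-1 : R).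
have base : expR (-1) <= Re (truncated_integral (gaussian 0 : R -> R[i]^o) 0).
  apply: (Re_seqlim_ge (truncated_integralP cC 0 hg)) => m.
  rewrite Re_scale expr1.
  have : expR (-1) <= Re (rmean (gaussian 0 : R -> R[i]^o) m (- 2 ^+ 0) (2 ^+ 1)).
    apply: Re_rmean_ge; first by rewrite exprn_ge0.
    move=> x; rewrite expr0 expr1 => hx; rewrite Re_gaussian0 ler_expR lerN2.
    by have := sqr_ge0 x; nra.
  lra.
have all k : expR (-1) <= Re (truncated_integral (gaussian 0 : R -> R[i]^o) k).
  by elim: k => [|k ih]; [exact: base|exact: le_trans ih (step k)].
have h := Re_seqlim_ge (dyadic_integralP cC hg) all.
apply/eqP => c0; move: h; rewrite -/gaussian_mass c0 /= => h.
by have := lt_le_trans e0 h; rewrite ltxx.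
Qed.

End Gaussian.

(** * Mollification of an orbit along one coordinate *)

Section Mollifier.
Variables (R : realType) (A : cstarAlgType R) (n : nat).
Variable sigma : 'rV[R]_n -> A -> A.
Hypothesis dyn : cstar_dynamical_system sigma.
Variables (j : 'I_n) (del : R).
Hypothesis del0 : 0 < del.
Implicit Types (x a : A) (z w : 'rV[CC R]_n) (s t : R) (v : 'rV[R]_n).

Let cA : nm_complete A := @completeNormedMod_nm_complete R A.

Definition axis (j : 'I_n) : 'rV[R]_n := \row_k (k == j)%:R.

Lemma sigma_axis_unif (e : R) (x : A) : 0 < e -> exists2 d : R, 0 < d &
  forall s, `|s| < d -> nm (sigma (s *: axis j) x - x) <= e.
Proof.
move=> e0; have [d d0 hd] := sigma_continuous dyn x 0 e0; exists d => // s hs.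
have := hd (s *: axis j); rewrite (sigma0 dyn); apply=> k.
rewrite !mxE subr0; case: eqP => _; first by rewrite mulr1.
by rewrite mulr0 normr0.
Qed.

Lemma sigma_axisD s t x :
  sigma ((s + t) *: axis j) x = sigma (s *: axis j) (sigma (t *: axis j) x).
Proof. by rewrite scalerDl sigmaD. Qed.

(** The integrand of a Gaussian convolution after rescaling time by [del]: the kernel keeps its
    width and the orbit is slowed down. The coordinate [z 0 j] enters the kernel as an entire
    parameter. A function [G] stands in place of a fixed element so that the construction can be
    repeated for the next coordinate. *)
Definition orbit_gauss (G : 'rV[CC R]_n -> A) z t : A :=
  gaussian (z 0 j / del%:C) t *: sigma ((del * t) *: axis j) (G z).

Definition mollify (G : 'rV[CC R]_n -> A) z : A := dyadic_integral (orbit_gauss G z).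

Lemma sigma_path_unif (e : R) x : 0 < e -> exists2 d : R, 0 < d & forall s t,
  `|s - t| < d -> nm (sigma ((del * s) *: axis j) x - sigma ((del * t) *: axis j) x) <= e.
Proof.
move=> e0; have [d d0 hd] := sigma_axis_unif x e0.
exists (d / del); first by rewrite divr_gt0.
move=> s t; rewrite ltr_pdivlMr// => hst.
have -> : del * s = del * t + (s - t) * del by ring.
rewrite sigma_axisD -(linear_mapB (sigma_linear dyn _)) (nm_sigma dyn).
by apply: hd; rewrite normrM (gtr0_norm del0).
Qed.

Lemma orbit_gauss_decay G z : integrable_decay (orbit_gauss G z)
  (2 * expR (nm (z 0 j / del%:C) ^+ 2) * nm (G z)).
Proof.
apply: gaussian_decay => [x|e e0]; first by rewrite nm_sigma.
exact: sigma_path_unif.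
Qed.

Lemma mdiff_rmean (U V : normedModType R[i]) (f : U -> R -> V) m (p d : R) (x : U) :
  (forall t, mdiff (fun u => f u t) x) -> mdiff (fun u => rmean (f u) m p d) x.
Proof.
move=> h; elim: m p d => [|m ih] p d /=; first exact: h.
by apply: mdiffZ; [exact: mdiff_cst|apply: mdiffD; exact: ih].
Qed.

Lemma orbit_gauss_mdiff G z t : mdiff G z -> mdiff (fun w => orbit_gauss G w t) z.
Proof.
move=> dG; apply: mdiffZ.
  have hz : mdiff (fun w : 'rV[CC R]_n => w 0 j / del%:C : R[i]^o) z.
    have h := mdiffZ (mdiff_coord j z) (@mdiff_cst _ 'rV[CC R]_n (R[i]^o) (del%:C)^-1 z).
    exact: h.
  exact: (mdiff_cdiff_comp hz (cdiff_gaussian t _)).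
apply: (@mdiff_comp_linear _ _ _ _ (sigma ((del * t) *: axis j)) 1) => //.
  exact: sigma_linear.
by move=> v; rewrite nm_sigma// mul1r.
Qed.

Lemma orbit_gauss_local_bound G z : mdiff G z -> exists2 r : R, 0 < r & exists B, forall w,
  nm w < r -> integrable_decay (orbit_gauss G (z + w)) B.
Proof.
move=> dG; have [r r0 hr] := mdiff_cont dG ltr01.
exists (Num.min r 1); first by rewrite lt_min r0 ltr01.
pose W := (nm z + 1) / del.
exists (2 * expR (W ^+ 2) * (nm (G z) + 1)) => w; rewrite lt_min => /andP[/hr h1 h2].
apply: integrable_decay_le (orbit_gauss_decay _ _).
have W0 : 0 <= W by rewrite divr_ge0 ?(ltW del0)//; have := nm_ge0 z; lra.
have hW : nm ((z + w) 0 j / del%:C) <= W.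
  rewrite nmM nmV nmR (gtr0_norm del0) ler_pM2r ?invr_gt0//.
  apply: le_trans (nm_coord _ _) _; apply: le_trans (nm_triangle _ _) _.
  by rewrite lerD2l ltW.
apply: ler_pM; rewrite ?nm_ge0 ?mulr_ge0 ?expR_ge0//.
  by rewrite ler_pM2l// ler_expR lerXn2r ?nnegrE ?nm_ge0.
by apply: le_trans (nm_split _ (G z)) _; rewrite lerD2l.
Qed.

(** [mdiff_limit] is used twice, from Riemann sums to truncated integrals and from these to the
    integral, with locally uniform bounds. The factor 10 is 6 from [dyadic_integral_bound] plus 4
    from [dyadic_integral_tail]. *)
Lemma mollify_mdiff G : (forall z, mdiff G z) -> forall z, mdiff (mollify G) z.
Proof.
move=> dG z0.
have dI k z : mdiff (fun w => truncated_integral (orbit_gauss G w) k) z.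
  have [r r0 [B hB]] := orbit_gauss_local_bound (dG z).
  rewrite -[z]addr0; apply/mdiff_shift.
  apply: (@mdiff_limit _ _ _ (fun m w => truncated_sum (orbit_gauss G (z + w)) k m) _ r (2 ^+ k.+1 * B)) => //.
  - move=> m w _.
    apply/(@mdiff_shift _ _ _ (fun w => truncated_sum (orbit_gauss G w) k m)).
    apply: mdiffZ; first exact: mdiff_cst.
    by apply: mdiff_rmean => t; exact: orbit_gauss_mdiff.
  - move=> m w hw; apply: truncated_sum_bound => t _.
    exact: decay_le (hB w hw).
  - move=> w hw; exact: (truncated_integralP (V := A) cA k (hB w hw)).
have [r r0 [B hB]] := orbit_gauss_local_bound (dG z0).
rewrite -[z0]addr0; apply/mdiff_shift.
apply: (@mdiff_limit _ _ _ (fun k w => truncated_integral (orbit_gauss G (z0 + w)) k) _ r (10 * B)) => //.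
- move=> k w _.
  by apply/(@mdiff_shift _ _ _ (fun w => truncated_integral (orbit_gauss G w) k)).
- move=> k w hw; have h := hB w hw; have B0 := decay_ge0 h.
  apply: le_trans (nm_split _ (dyadic_integral (orbit_gauss G (z0 + w)))) _.
  have h1 := dyadic_integral_bound (V := A) cA h.
  have h2 := dyadic_integral_tail (V := A) cA k h; rewrite nmB in h2.
  apply: le_trans (lerD h1 h2) _.
  have : 4 * B * 2^-1 ^+ k <= 4 * B * 1.
    by rewrite ler_wpM2l ?mulr_ge0// exprn_ile1 ?invr_ge0// invf_le1// ler1n.
  lra.
- by move=> w hw; exact: (dyadic_integralP (V := A) cA (hB w hw)).
Qed.

Lemma mollify_invariant G v z : v 0 j = 0 -> G (z + cvec v 0) = G z ->
  mollify G (z + cvec v 0) = mollify G z.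
Proof.
move=> vj Gz; congr dyadic_integral; apply/funext => t.
by rewrite /orbit_gauss Gz !mxE vj addr0.
Qed.

Lemma dyadic_integral_sigma (f : R -> A) B v : integrable_decay f B ->
  dyadic_integral (fun t => sigma v (f t)) = sigma v (dyadic_integral f).
Proof.
move=> hf; apply: (@dyadic_integral_linear _ _ _ cA cA (sigma v) 1 f B B) => //.
- exact: sigma_linear.
- by move=> x; rewrite nm_sigma// mul1r.
- case: hf => h1 h2; split => [T e e0|t]; last by rewrite nm_sigma.
  have [d d0 hd] := h1 T e e0; exists d => // s t hs ht hst.
  by rewrite -(linear_mapB (sigma_linear dyn _)) nm_sigma//; exact: hd.
Qed.

(** A translation with [v 0 j = 0] leaves the kernel unchanged, and [sigma v] commutes with the flow
    along the axis and with the integral; covariance gained in other coordinates thus survives. *)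
Lemma mollify_equivariant G v z : v 0 j = 0 -> G (z + cvec v 0) = sigma v (G z) ->
  mollify G (z + cvec v 0) = sigma v (mollify G z).
Proof.
move=> vj Gz; rewrite -(dyadic_integral_sigma v (orbit_gauss_decay G z)).
congr dyadic_integral; apply/funext => t.
rewrite /orbit_gauss Gz (linear_mapZ (sigma_linear dyn _)) -!(sigmaD dyn) (addrC v).
by rewrite !mxE vj addr0.
Qed.

Section Translation.
Variable G : 'rV[CC R]_n -> A.
Hypothesis dG : forall z, mdiff G z.
Hypothesis Ginv : forall s z, G (z + cvec (s *: axis j) 0) = G z.

(** The translation moves the centre of the kernel by [2^-1 ^+ i]; shifting the integration variable
    by the same amount undoes this and brings out the factor [sigma]. *)
Lemma mollify_translate_dyadic i z :
  mollify G (z + cvec ((del * 2^-1 ^+ i) *: axis j) 0) =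
  sigma ((del * 2^-1 ^+ i) *: axis j) (mollify G z).
Proof.
set s := del * _; set z' := z + _.
have hz' := orbit_gauss_decay G z'.
have hz := orbit_gauss_decay G z.
have dn : del%:C != 0 :> R[i] by rewrite (inj_eq (@complexI _)) gt_eqF.
have E t : orbit_gauss G z' (t + 2^-1 ^+ i) = sigma (s *: axis j) (orbit_gauss G z t).
  rewrite /orbit_gauss /z' Ginv (linear_mapZ (sigma_linear dyn _)) -sigma_axisD.
  congr (_ *: _); last by congr sigma; congr (_ *: _); rewrite /s; ring.
  congr cexp; congr (- (_ ^+ 2)).
  have -> : (z + cvec (s *: axis j) 0) 0 j = z 0 j + s%:C by rewrite !mxE eqxx mulr1.
  by rewrite /s rmorphD rmorphM /=; field.
have E' : (fun t => orbit_gauss G z' (t + 2^-1 ^+ i)) =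
    fun t => sigma (s *: axis j) (orbit_gauss G z t).
  by apply/funext.
have hs : integrable_decay (fun t => sigma (s *: axis j) (orbit_gauss G z t))
    (2 * expR (nm (z 0 j / del%:C) ^+ 2) * nm (G z)).
  have [h1 h2] := hz; split => [T e e0|t]; last by rewrite nm_sigma.
  have [d d0 hd] := h1 T e e0; exists d => // t t' ht ht' htt.
  by rewrite -(linear_mapB (sigma_linear dyn _)) nm_sigma//; exact: hd.
rewrite -(dyadic_integral_sigma _ hz) -E'.
apply/esym/(dyadic_integral_shift (V := A) cA hz' (B' := 2 * expR (nm (z 0 j / del%:C) ^+ 2) * nm (G z))).
by rewrite E'.
Qed.

(** The times [s] for which this holds form a group containing all dyadic multiples of [del]; both
    sides are continuous in [s], so approximation from below by such multiples reaches every real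
    time. *)
Lemma mollify_translate s z :
  mollify G (z + cvec (s *: axis j) 0) = sigma (s *: axis j) (mollify G z).
Proof.
pose Tr s := forall z, mollify G (z + cvec (s *: axis j) 0) = sigma (s *: axis j) (mollify G z).
have TrD s1 s2 : Tr s1 -> Tr s2 -> Tr (s1 + s2).
  move=> h1 h2 w; rewrite sigma_axisD -h2 -h1 -addrA cvecD addr0 -scalerDl addrC.
  by rewrite (addrC s2) addrC.
have TrN s1 : Tr s1 -> Tr (- s1).
  move=> h w; have := h (w + cvec (- s1 *: axis j) 0).
  rewrite -addrA cvecD -scalerDl addNr scale0r addr0.
  have -> : cvec 0 0 = 0 :> 'rV[CC R]_n by apply/rowP => k; rewrite !mxE.
  by rewrite addr0 => ->; rewrite -sigma_axisD addNr scale0r (sigma0 dyn).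
have Tr0 : Tr 0.
  move=> w; rewrite scale0r (sigma0 dyn); congr mollify.
  by rewrite -[RHS]addr0; congr (_ + _); apply/rowP => k; rewrite !mxE.
have Trn i m : Tr (m%:R * (del * 2^-1 ^+ i)).
  elim: m => [|m ih]; first by rewrite mul0r.
  by rewrite -natr1 mulrDl mul1r; apply: TrD ih _ => w; exact: mollify_translate_dyadic.
suff Trpos s1 : 0 <= s1 -> Tr s1.
  have [s0|s0] := leP 0 s; first exact: Trpos.
  by rewrite -(opprK s); apply: TrN; apply: Trpos; lra.
move=> s10 w; apply/subr0_eq/nm_eq0/eqP; rewrite eq_le nm_ge0 andbT.
apply/ler_addgt0Pr => e e0; rewrite add0r.
have e2 : 0 < e / 2 by lra.
have [d1 d10 h1] := mdiff_cont (mollify_mdiff dG (w + cvec (s1 *: axis j) 0)) e2.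
have [d2 d20 h2] := sigma_axis_unif (mollify G w) e2.
have m0 : 0 < Num.min d1 d2 / del / 2 by rewrite !divr_gt0// lt_min d10.
have [N hN] := geometric_lt m0.
pose q := del * 2^-1 ^+ N.
have p0 : 0 < (2^-1 : R) ^+ N by rewrite exprn_gt0// invr_gt0.
have q0 : 0 < q by rewrite mulr_gt0.
pose m := Num.trunc (s1 / q); pose u := m%:R * q.
have /andP[hm1 hm2] := truncn_itv (divr_ge0 s10 (ltW q0)).
have us : u <= s1 < u + q.
  move: hm1 hm2; rewrite -/m ler_pdivlMr// ltr_pdivrMr// => -> /=.
  by rewrite -natr1 mulrDl mul1r.
have qd : 2 * q < Num.min d1 d2.
  have := hN N (leqnn N); rewrite ltr_pdivlMr// ltr_pdivlMr// /q.
  by lra.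
have [qd1 qd2] : 2 * q < d1 /\ 2 * q < d2 by move: qd; rewrite lt_min => /andP[].
have hu := Trn N m w; rewrite -/q -/u in hu.
have E1 : nm (mollify G (w + cvec (u *: axis j) 0) - mollify G (w + cvec (s1 *: axis j) 0)) <= e / 2.
  have -> : w + cvec (u *: axis j) 0 = w + cvec (s1 *: axis j) 0 + cvec ((u - s1) *: axis j) 0.
    by rewrite -addrA cvecD addr0 -scalerDl (addrC s1) subrK.
  apply: h1; apply: (@le_lt_trans _ _ (2 * q)) => //.
  apply: nm_cvec_re; first exact: ltW.
    move=> k; rewrite !mxE; case: eqP => _; rewrite ?mulr1 ?mulr0 ?normr0 ?(ltW q0)//.
    have /andP[su1 su2] : 0 <= s1 - u < q by rewrite subr_ge0 ltrBlDl.
    by rewrite distrC ger0_norm// ltW.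
  by move=> k; rewrite mxE normr0 ltW.
have E2 : nm (sigma (u *: axis j) (mollify G w) - sigma (s1 *: axis j) (mollify G w)) <= e / 2.
  have -> : s1 = u + (s1 - u) by rewrite addrC subrK.
  rewrite sigma_axisD -(linear_mapB (sigma_linear dyn _)) nm_sigma// nmB.
  have /andP[su1 su2] : 0 <= s1 - u < q by rewrite subr_ge0 ltrBlDl.
  by apply: h2; rewrite ger0_norm//; apply: lt_trans su2 (le_lt_trans _ qd2); lra.
rewrite hu in E1.
have := nm_dist (sigma (u *: axis j) (mollify G w)) (mollify G (w + cvec (s1 *: axis j) 0))
  (sigma (s1 *: axis j) (mollify G w)).
rewrite (nmB (mollify G _) (sigma (u *: _) _)); lra.
Qed.

End Translation.

End Mollifier.

Lemma dyadic_integralB (R : realType) (V : normedModType R[i]) (f g : R -> V) (B B' B'' : R) :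
  nm_complete V -> integrable_decay f B -> integrable_decay g B' ->
  integrable_decay (fun t => f t - g t) B'' ->
  dyadic_integral (fun t => f t - g t) = dyadic_integral f - dyadic_integral g.
Proof.
move=> cV hf hg hfg.
apply: (dyadic_integral_eq cV hfg
  (l := fun k => truncated_integral f k - truncated_integral g k)).
  move=> k; have := seqlimB (truncated_integralP cV k hf) (truncated_integralP cV k hg).
  move=> h e /h[N hN]; exists N => m /hN.
  by rewrite /truncated_sum rmeanB scalerBr.
exact: seqlimB (dyadic_integralP cV hf) (dyadic_integralP cV hg).
Qed.

(** * Density of the analytic elements *)

Section AnalyticDensity.
Variables (R : realType) (A : cstarAlgType R) (n : nat).
Variable sigma : 'rV[R]_n -> A -> A.
Hypothesis dyn : cstar_dynamical_system sigma.
Implicit Types (x a : A) (z w : 'rV[CC R]_n).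

Let cA : nm_complete A := @completeNormedMod_nm_complete R A.

Lemma gaussian_mass_scale x :
  dyadic_integral (fun t => gaussian 0 t *: x) = (gaussian_mass R : R[i]) *: x.
Proof.
have h : integrable_decay (fun t => gaussian 0 t *: x) (2 * expR (nm (0 : R[i]) ^+ 2) * nm x).
  apply: gaussian_decay => // e e0.
  by exists 1 => // s t _; rewrite subrr nm0 ltW.
apply: (@dyadic_integral_linear _ (R[i]^o) A (@complex_nm_complete R) cA
  (fun k : R[i]^o => (k : R[i]) *: x) (nm x) (gaussian 0) 2 _ _ _ (gaussian0_decay R) h).
- by move=> k u v; rewrite scalerDl scalerA.
- by move=> k; rewrite nmZ mulrC.
Qed.

Lemma mollify_approx (j : 'I_n) (G : 'rV[CC R]_n -> A) (e : R) : 0 < e ->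
  exists2 del : R, 0 < del &
  nm ((gaussian_mass R : R[i])^-1 *: mollify sigma j del G 0 - G 0) <= e.
Proof.
move=> e0; set x := G 0; set c : R[i] := gaussian_mass R.
have c0 : c != 0 := gaussian_mass_neq0 R.
have nc : 0 < nm c := nm_gt0 c0.
have nx := nm_ge0 x.
have X0 : 0 < 32 * (nm x + 1) by lra.
have ec : 0 < e * nm c by rewrite mulr_gt0.
(* The tail of [psi], with decay constant [4 * nm x], is at most [16 * nm x * 2^-1 ^+ k]; the factor
   32 brings it below half of [e * nm c]. *)
have [k hk] := geometric_lt (divr_gt0 ec X0).
have {hk} := hk k (leqnn k); rewrite ltr_pdivlMr// => hk.
have p0 : 0 < (2 ^+ k.+1 : R) := pow2_gt0 R k.+1.
pose eta := e * nm c / 2 / 2 ^+ k.+1.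
have eta0 : 0 < eta by rewrite !divr_gt0.
have [d d0 hd] := sigma_axis_unif dyn j x eta0.
(* For [|t| <= 2 ^+ k] the orbit time [del * t] is at most [d / 2], so the orbit has hardly moved
   where the kernel is not negligible. *)
pose del := d / 2 ^+ k.+1; have del0 : 0 < del by rewrite divr_gt0.
exists del => //.
have w0 : (0 : 'rV[CC R]_n) 0 j / del%:C = 0 by rewrite mxE mul0r.
pose psi t := orbit_gauss sigma j del G 0 t - gaussian 0 t *: x.
have psiE t : psi t = gaussian 0 t *: (sigma ((del * t) *: axis R j) x - x).
  by rewrite /psi /orbit_gauss w0 scalerBr.
have hf := orbit_gauss_decay dyn j del0 G 0.
have hx : integrable_decay (fun t => gaussian 0 t *: x) (2 * expR (nm (0 : R[i]) ^+ 2) * nm x).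
  apply: gaussian_decay => // e1 e10.
  by exists 1 => // s t _; rewrite subrr nm0 ltW.
have hpsi : integrable_decay psi (4 * nm x).
  have -> : psi = fun t => gaussian 0 t *: (sigma ((del * t) *: axis R j) x - x).
    by apply/funext => t; exact: psiE.
  have -> : 4 * nm x = 2 * expR (nm (0 : R[i]) ^+ 2) * (2 * nm x).
    by rewrite nm0 expr0n expR0; ring.
  apply: gaussian_decay => [t|e1 e10].
    by apply: le_trans (nm_triangleB _ _) _; rewrite nm_sigma//; lra.
  have [d1 d10 hd1] := sigma_path_unif dyn j del0 x e10; exists d1 => // s t hst.
  by rewrite opprB addrA subrK; exact: hd1.
have Jpsi : dyadic_integral psi = mollify sigma j del G 0 - c *: x.
  by rewrite (dyadic_integralB (V := A) cA hf hx hpsi) gaussian_mass_scale.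
have bpsi t : `|t| <= 2 ^+ k -> nm (psi t) <= eta.
  move=> ht; rewrite psiE nmZ -[leRHS]mul1r; apply: ler_pM; rewrite ?nm_ge0//.
    apply: le_trans (nm_gaussian 0 t) _; rewrite nm0 expr0n expR0.
    by have t0 := sqr_ge0 t; rewrite ler_pdivrMr; lra.
  apply: hd; rewrite normrM (gtr0_norm del0).
  apply: (@le_lt_trans _ _ (del * 2 ^+ k)); first by rewrite ler_pM2l.
  have -> : del * 2 ^+ k = d / 2.
    by rewrite /del exprS; field; rewrite expf_neq0// pnatr_eq0.
  lra.
have Jb : nm (dyadic_integral psi) <= e * nm c.
  have h1 := dyadic_integral_tail (V := A) cA k hpsi.
  have h2 := truncated_integral_bound (V := A) cA hpsi bpsi.
  have h3 : 2 ^+ k.+1 * eta = e * nm c / 2 by rewrite /eta mulrC divfK// gt_eqF.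
  apply: le_trans (nm_split _ (truncated_integral psi k)) _.
  apply: le_trans (lerD h2 h1) _; rewrite h3.
  have : 0 <= (2^-1 : R) ^+ k by rewrite exprn_ge0// invr_ge0.
  move: hk; lra.
have -> : c^-1 *: mollify sigma j del G 0 - x = c^-1 *: dyadic_integral psi.
  by rewrite Jpsi scalerBr scalerA mulVf// scale1r.
by rewrite nmZ nmV mulrC ler_pdivrMr.
Qed.

(** Induction on the number [m] of coordinates already mollified, from the constant function [x].
    Invariance in the remaining coordinates is the hypothesis that [mollify_translate] needs at the
    next step, where it is traded for covariance. *)
Lemma entire_orbit_approx x (m : nat) (e : R) : (m <= n)%N -> 0 < e ->
  exists G : 'rV[CC R]_n -> A, [/\ forall z, mdiff G z,
    forall (v : 'rV[R]_n) z, (forall k : 'I_n, (m <= k)%N -> v 0 k = 0) ->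
      G (z + cvec v 0) = sigma v (G z),
    forall (v : 'rV[R]_n) z, (forall k : 'I_n, (k < m)%N -> v 0 k = 0) -> G (z + cvec v 0) = G z &
    nm (G 0 - x) <= e].
Proof.
elim: m e => [|m ih] e mn e0.
  exists (fun=> x); split => // [z|v z hv|]; first exact: mdiff_cst.
    by have -> : v = 0; [apply/rowP => k; rewrite mxE hv|rewrite (sigma0 dyn)].
  by rewrite subrr nm0 ltW.
have e2 : 0 < e / 2 by lra.
have [G [dG eG iG aG]] := ih _ (ltnW mn) e2.
pose j : 'I_n := Ordinal mn.
have [del del0 hdel] := mollify_approx j G e2.
set c : R[i] := gaussian_mass R in hdel.
exists (fun z => c^-1 *: mollify sigma j del G z); split.
- move=> z; apply: mdiffZ; first exact: mdiff_cst.
  exact: mollify_mdiff.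
(* The j-th component of [v] is handled by [mollify_translate], the rest by [mollify_equivariant]
   and the induction hypothesis. *)
- move=> v z hv; pose v' := v - v 0 j *: axis R j.
  have v'j : v' 0 j = 0 by rewrite !mxE eqxx mulr1 subrr.
  have vE : v = v' + v 0 j *: axis R j by rewrite subrK.
  rewrite (linear_mapZ (sigma_linear dyn v)); congr (_ *: _).
  have -> : z + cvec v 0 = z + cvec (v 0 j *: axis R j) 0 + cvec v' 0.
    by rewrite -addrA cvecD addr0 (addrC (v 0 j *: _)) -vE.
  rewrite (mollify_equivariant dyn)//.
    rewrite (mollify_translate dyn)//; last first.
      move=> s w; apply: iG => k km; rewrite !mxE.
      by case: eqP => [kj|_]; rewrite ?mulr0//; move: km; rewrite kj ltnn.
    by rewrite -(sigmaD dyn) -vE.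
  apply: eG => k; rewrite leq_eqVlt => /orP[/eqP mk|mk].
    by have -> : k = j by apply: val_inj.
  rewrite !mxE (hv k)// sub0r; case: eqP => [kj|_]; last by rewrite mulr0 oppr0.
  by move: mk; rewrite kj ltnn.
- move=> v z hv; congr (_ *: _); apply: mollify_invariant; first exact: hv.
  by apply: iG => k km; apply: hv; exact: ltnW.
- apply: le_trans (nm_dist (G 0) _ _) _; lra.
Qed.

Theorem analytic_elements_dense : dense (analytic_elements sigma).
Proof.
apply/dense_nm => x e e0; have e2 : 0 < e / 2 by lra.
have [G [dG eG _ aG]] := entire_orbit_approx x (leqnn n) e2.
exists (G 0); last lra.
exists G; split => [z|t]; first exact: mdiff_differentiable.
by rewrite -[cvec t 0]add0r eG// => k; rewrite leqNgt ltn_ord.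
Qed.

End AnalyticDensity.

Unset Implicit Arguments.

Theorem theorem4p4 (R : realType) (A : cstarAlgType R) (n : nat)
    (sigma : 'rV[R]_n -> A -> A) (tau : {scalar A})
    (beta : 'rV[R]_n) (Lambda : set 'rV[R]_n) :
  cstar_dynamical_system sigma ->
  is_state tau ->
  vec_pos beta ->
  prescribing_set beta Lambda ->
  KMS_state sigma beta Lambda tau <->
  exists B : set A,
    [/\ B `<=` analytic_elements sigma, star_subalgebra B, dense B,
        action_invariant sigma B
      & forall gamma, corners beta gamma -> forall a b, B a -> B b ->
          tau (a ** sigma_ext sigma (cvec 0 gamma) b) =
          if gamma \in Lambda then tau (b ** a) else tau (a ** b)].
Proof.
move=> dyn /state_bound tau_le [beta0 _] _; split.
  move=> kms; exists (analytic_elements sigma); split => //.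
  - exact: analytic_star_subalgebra.
  - exact: analytic_elements_dense.
  - exact: analytic_invariant.
  - by move=> gamma hg a b _ hb; exact: boundary_of_kms.
by move=> [B [Ban Balg Bdense Binv boundary]]; exact: (kms_of_boundary dyn tau_le beta0 Ban).
Qed.
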